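(* Let $\tau>0$, $L>0$ and $0<l<u<\infty$ be fixed constants. Suppose that one of the following two settings holds: (a) $\alpha>1/2$ and for each $n\ge1$ one observes $$Y_{i,n}=\int_0^{i/n}\sigma(s)\,dW_s+\tau\epsilon_{i,n},\qquad i=1,\ldots,n;$$ (b) $\alpha\ge 1$ and for each $n\ge1$ one observes $$Y_{i,n}=\sigma\left(\tfrac{i}{n}\right)W_{i/n}+\tau\epsilon_{i,n},\qquad i=1,\ldots,n.$$ Then there exists a constant $C>0$ (depending only on $\alpha,L,l,u$ and the fixed constant $\tau$) such that $$\liminf_{n\to\infty}\ \inf_{\hat\sigma_n^2}\ \sup_{\sigma^2\in\mathcal{C}^b(\alpha,L)}\ \operatorname{E}\left(n^{\frac{\alpha}{2\alpha+1}}\left\|\hat\sigma_n^2-\sigma^2\right\|_2^2\right)\ge C,$$ where the infimum is over all estimators $\hat\sigma_n^2$ of the function $\sigma^2$ based on the observations $Y_{1,n},\ldots,Y_{n,n}$.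
   Context: $(W_t)_{t\in[0,1]}$ is a standard Brownian motion, and for each $n$ the variables $\epsilon_{1,n},\ldots,\epsilon_{n,n}$ are i.i.d. $\mathcal{N}(0,1)$, with $(W_t)_{t\in[0,1]}$ and $(\epsilon_{1,n},\ldots,\epsilon_{n,n})$ independent. The function $\sigma:[0,1]\to(0,\infty)$ is unknown, positive and deterministic; $\tau>0$ is a known constant. An estimator $\hat\sigma_n^2$ is a measurable function of $(Y_{1,n},\ldots,Y_{n,n})$ with values in $L_2([0,1])$; $\|\cdot\|_2$ is the $L_2([0,1])$-norm; $\operatorname{E}$ is the expectation under the law of the observations when the true volatility function is $\sigma$ (the positive square root of $\sigma^2$). For $\alpha>0$ let $[\alpha]:=\max\{z\in\mathbb{Z}:z\le\alpha\}$. The class of uniformly bounded Hölder continuous functions of index $\alpha$ on $[0,1]$ is $$\mathcal{C}^b(\alpha,L)=\mathcal{C}^b(\alpha,L,[l,u]):=\left\{f:[0,1]\to\mathbb{R}:\ f^{(p)}\text{ exists for }p=[\alpha],\ |f^{(p)}(x)-f^{(p)}(y)|\le L|x-y|^{\alpha-p}\ \forall x,y\in[0,1],\ 0<l\le f\le u<\infty\right\}.$$ *)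

(* Defs.v *)
From HB Require Import structures.
From mathcomp Require Import all_boot all_order all_algebra.
From mathcomp Require Import all_classical all_reals all_analysis.
Import Order.TTheory GRing.Theory Num.Theory.
Import numFieldNormedType.Exports.

Set Implicit Arguments.
Unset Strict Implicit.
Unset Printing Implicit Defensive.

Local Open Scope classical_set_scope.
Local Open Scope ring_scope.

(* Functions on [0, 1] are represented by functions R -> R; no definition below
   looks at their values outside [0, 1]. *)

Section holder_class.
Context {R : realType}.
Implicit Types f g h : R -> R.

(* The limit is taken within [0, 1], hence is one-sided at 0 and at 1. *)
Definition is_deriv01 f g :=
  forall x, x \in `[0, 1] ->
    (fun y => (f y - f x) / (y - x)) @ within `[0, 1] x^' --> g x.

Fixpoint is_nderiv01 (p : nat) f g : Prop :=
  if p is p'.+1 then exists2 h, is_deriv01 f h & is_nderiv01 p' h g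
  else {in `[0, 1], f =1 g}.

Definition holder_class (alpha L l u : R) : set (R -> R) :=
  let p := Num.truncn alpha in
  [set f | (exists2 g, is_nderiv01 p f g &
              {in `[0, 1] &, forall x y,
                `|g x - g y| <= L * `|x - y| `^ (alpha - p%:R)}) /\
           {in `[0, 1], forall x, l <= f x <= u}].

End holder_class.

Section L2_estimators.
Context {R : realType}.
Implicit Types f g : R -> R.

Definition L2norm f : \bar R :=
  'N[@lebesgue_measure R]_2%:E[EFin \o (f \_ `[0, 1])].

Definition in_L2 f :=
  measurable_fun (`[0, 1] : set R) f /\ (L2norm f < +oo)%E.

(* Open sets of L2([0, 1]), given by representatives; such a set is
   automatically saturated for almost-everywhere equality within in_L2. *)
Definition L2_open (U : set (R -> R)) :=
  forall f, in_L2 f -> U f ->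
    exists2 e : R, 0 < e &
      forall g, in_L2 g -> (L2norm (g \- f)%R < e%:E)%E -> U g.

(* Borel maps from R^n to L2([0, 1]). *)
Definition estimator (n : nat) : set (n.-tuple R -> R -> R) :=
  [set est | (forall y, in_L2 (est y)) /\
             (forall U, L2_open U -> measurable [set y | U (est y)])].

End L2_estimators.

Arguments estimator {R} n.

Section probability.
Context {R : realType} {d : measure_display} {T : measurableType d}.
Variable P : probability T R.
Local Open Scope ereal_scope.

(* Measures are only compared on measurable sets: the library's measures are
   unspecified on the other ones. *)
Definition is_normal (X : T -> R) (m s : R) :=
  forall A : set R, measurable A -> pushforward P X A = normal_prob m s A.

Definition mutually_independent (I : finType) (X : I -> T -> R) :=
  forall B : I -> set R, (forall i, measurable (B i)) ->
    P (\bigcap_i (X i @^-1` B i)) = \prod_(i : I) P (X i @^-1` B i).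

Definition sigma_generated (I : Type) (J : set I) (X : I -> T -> R) :
    set (set T) :=
  <<s \bigcup_(i in J) preimage_set_system setT (X i) measurable >>.

Definition independent_systems (F G : set (set T)) :=
  forall A B, F A -> G B -> P (A `&` B) = P A * P B.

Definition brownian_motion01 (W : R -> {RV P >-> R}) :=
  [/\ {ae P, forall w, W 0%R w = 0%R},
      forall s t : R, (0 <= s)%R -> (s < t)%R -> (t <= 1)%R ->
        is_normal (W t \- W s)%R 0 (Num.sqrt (t - s)),
      forall (m : nat) (t : nat -> R),
        {homo t : i j / (i <= j)%N >-> (i <= j)%R} ->
        (0 <= t 0%N)%R -> (t m <= 1)%R ->
        mutually_independent (fun i : 'I_m => W (t i.+1) \- W (t i))%R &
      {ae P, forall w, {within `[0%R, 1%R], continuous (fun t => W t w)}}].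

(* The list of triples (c, a, b) stands for the step function which is the sum
   of the c * 1_]a, b]. *)
Definition step_fun (s : seq (R * R * R)) (x : R) : R :=
  (\sum_(p <- s) p.1.1 * \1_(`]p.1.2, p.2]) x)%R.

Definition step_integral (W : R -> {RV P >-> R}) (s : seq (R * R * R)) (w : T)
    : R :=
  (\sum_(p <- s) p.1.1 * (W p.2 w - W p.1.2 w))%R.

Definition step_within (t : R) (s : seq (R * R * R)) :=
  all (fun p => (0 <= p.1.2 <= p.2)%R && (p.2 <= t)%R) s.

(* X is a version of the Wiener integral of f over [0, t]: the L2(P)-limit of
   the integrals of step functions that converge to f in L2([0, t]). *)
Definition is_wiener_integral (W : R -> {RV P >-> R}) (f : R -> R) (t : R)
    (X : {RV P >-> R}) :=
  exists s : nat -> seq (R * R * R),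
    [/\ forall k, step_within t (s k),
        \int[lebesgue_measure]_(x in `[0%R, t])
          ((step_fun (s k) x - f x) ^+ 2)%:E @[k --> \oo] --> 0 &
        \int[P]_w ((step_integral W (s k) w - X w) ^+ 2)%:E
          @[k --> \oo] --> 0].

End probability.

Section model.
Context {R : realType} {d : measure_display} {T : measurableType d}.
Variables (P : probability T R) (W : R -> {RV P >-> R}).
Variables (tau : R) (n : nat) (eps : 'I_n -> {RV P >-> R}).

Definition grid_point (i : 'I_n) : R := i.+1%:R / n%:R.

Definition integral_model (sigma : R -> R) (Y : 'I_n -> {RV P >-> R}) :=
  forall i, exists2 X : {RV P >-> R},
    is_wiener_integral W sigma (grid_point i) X &
    forall w, Y i w = X w + tau * eps i w.

Definition product_model (sigma : R -> R) (Y : 'I_n -> {RV P >-> R}) :=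
  forall i w,
    Y i w = sigma (grid_point i) * W (grid_point i) w + tau * eps i w.

End model.

(* E (n ^ (alpha / (2 alpha + 1)) ||est(Y) - f||_2 ^ 2), where f is the squared
   volatility. *)
Definition scaled_risk {R : realType} {d : measure_display}
    {T : measurableType d} (P : probability T R) (alpha : R) (n : nat)
    (Y : 'I_n -> {RV P >-> R}) (est : n.-tuple R -> R -> R) (f : R -> R)
    : \bar R :=
  (\int[P]_w ((n%:R `^ (alpha / (2 * alpha + 1)))%:E *
              L2norm (est [tuple Y i w | i < n] \- f)%R ^+ 2))%E.

(* Main.v *)
Require Import Defs.
From HB Require Import structures.
From mathcomp Require Import all_boot all_order all_algebra.
From mathcomp Require Import all_classical all_reals all_analysis.
From mathcomp Require Import measurable_realfun ring lra zify.
Import Order.TTheory GRing.Theory Num.Theory.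
Import numFieldNormedType.Exports.

(** The bound is proved by Assouad's method. Cut [0, 1] into [M] cells, with
    [M] of order [n ^ (1 / (4 alpha + 2))], and let a vertex [th] of the cube
    [{0, 1} ^ M] encode the squared volatility that is [l] plus, on each cell [k]
    with [th k], a smooth bump of width [1 / M] and height [A * M ^ - alpha].
    For small [A] all of these functions are in the Hoelder class, whatever [M]
    is ([bump_volatility_holder]). The two ends of an edge of the cube are at a
    squared L2 distance of order [M ^ - (2 alpha + 1)]. If moreover the laws of
    the observations at the two ends are at most 1/2 apart in total variation,
    then no estimator can tell them apart reliably, and averaging over the cube
    ([assouad_average], [hypercube_risk]) gives a vertex at which the risk is of
    order [M * M ^ - (2 alpha + 1) = M ^ - (2 alpha)], which is the order of
    [n ^ - (alpha / (2 alpha + 1))].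

    Both models are first compared, in total variation, with one model: a random
    walk with independent Gaussian increments, observed with noise. In the model
    of the Wiener integral, the integral is close in mean square to a step
    integral on a fine grid, and the noise turns this into closeness of laws
    ([integral_model_tv]). In the product model, multiplying the path by the
    volatility, instead of multiplying its increments, is a feedback of the walk
    on its own increments; this is an adaptive shift, whose energy is small as
    the volatility has a small Lipschitz constant when [1 <= alpha]
    ([product_model_tv]).

    The heart of the proof is that an edge of the cube is hard to detect in the
    random walk model ([observe_law_tv]). Adding a bump adds independent variance
    to the increments of one cell, that is, it adds to the observed path an
    independent Gaussian path. This path has to be seen as a random shift of the
    two Gaussian inputs. A jump of the path could be realised by its own increment
    alone, or by the noise alone; the first costs too much because a single
    increment has a small variance, the second because the jump persists at all
    later times. The compromise is to cut time into blocks of [m] observations, to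
    spread a jump evenly over the increments of its block, and to let the noise
    make up for the difference within the block. Per unit of added variance, the
    Gram matrix of this shift then vanishes between different blocks and is at
    most [1 / (m * N * lo) + m / tau ^ 2] within a block, where [lo] is a lower
    bound for the variance of an increment and [N] the number of increments
    between two observations. The chi-square distance between a standard Gaussian vector
    and its shift by an independent Gaussian vector is controlled by the squared
    Hilbert-Schmidt norm of the Gram matrix ([gauss_mixture_tv]), and for [m] of
    order [sqrt n] this is of order [A ^ 2 * sqrt n * M ^ - (2 alpha + 1)]. So
    [M] may be as large as [n ^ (1 / (4 alpha + 2))], which is the slow rate of
    the theorem. *)

Set Implicit Arguments.
Unset Strict Implicit.
Unset Printing Implicit Defensive.

Local Open Scope classical_set_scope.
Local Open Scope ring_scope.

(** * Densities and affine substitutions *)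

Section density.
Local Open Scope ereal_scope.
Context d (T : measurableType d) (R : realType).
Variables (m nu : {measure set T -> \bar R}) (g : T -> R).
Hypotheses (mg : measurable_fun setT g) (g0 : forall x, (0 <= g x)%R).
Hypothesis nuE : forall A, measurable A -> nu A = \int[m]_(x in A) (g x)%:E.

Import HBNNSimple.

Let integral_density_nnsfun (f : {nnsfun T >-> R}) :
  \int[nu]_x (f x)%:E = \int[m]_x ((f x)%:E * (g x)%:E).
Proof.
under [LHS]eq_integral do rewrite fimfunE -fsumEFin//.
rewrite [LHS]ge0_integral_fsum//; last 2 first.
  - by move=> r; exact/measurable_EFinP/measurableT_comp.
  - by move=> n x _; rewrite EFinM nnfun_muleindic_ge0.
under [RHS]eq_integral.
  move=> x xD; rewrite fimfunE -fsumEFin// ge0_mule_fsuml; last first.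
    by move=> r; rewrite EFinM nnfun_muleindic_ge0.
  over.
rewrite [RHS]ge0_integral_fsum//; last 2 first.
  - move=> r; apply: emeasurable_funM; apply/measurable_EFinP => //.
    exact/measurableT_comp.
  - by move=> n x _; rewrite mule_ge0 ?lee_fin// -lee_fin EFinM nnfun_muleindic_ge0.
apply: eq_fsbigr => r _.
rewrite integralZl_indic_nnsfun// integral_indic// setIT nuE//.
have [r0|r0] := leP 0%R r; last first.
  rewrite preimage_nnfun0// integral_set0 mule0.
  by rewrite integral0_eq// => x _; rewrite indic0/= mulr0 mul0e.
rewrite -ge0_integralZl//; last 2 first.
  - exact/measurable_EFinP/measurable_funTS.
  - by move=> x _; rewrite lee_fin.
rewrite integral_mkcond; apply: eq_integral => x _.
rewrite patchE indicE; case: ifPn => _; first by rewrite mulr1.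
by rewrite mulr0 mul0e.
Qed.

(** Both sides agree on nonnegative simple functions and respect increasing
    limits. *)
Lemma ge0_integral_density (f : T -> \bar R) :
  measurable_fun setT f -> (forall x, 0 <= f x) ->
  \int[nu]_x f x = \int[m]_x (f x * (g x)%:E).
Proof.
move=> mf f0.
pose f_ := nnsfun_approx measurableT mf.
transitivity (limn (fun n => \int[nu]_x (f_ n x)%:E)).
  rewrite -monotone_convergence//=.
  - apply: eq_integral => ? /[!inE] xD; apply/esym/cvg_lim => //=.
    exact: cvg_nnsfun_approx.
  - by move=> n; exact/measurable_EFinP/measurable_funTS.
  - by move=> n ? _; rewrite lee_fin.
  - by move=> ? _ ? ? mn; rewrite lee_fin; exact/lefP/nd_nnsfun_approx.
under eq_fun do rewrite integral_density_nnsfun.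
rewrite -monotone_convergence//=.
- apply: eq_integral => x /[!inE] xD; apply/cvg_lim => //=.
  rewrite [X in X @ _ --> _](_ : _ = (fun n => (g x)%:E * (f_ n x)%:E)); last first.
    by apply/funext => n; rewrite muleC.
  rewrite muleC; apply: cvgeZl => //; exact: cvg_nnsfun_approx.
- by move=> n; apply: emeasurable_funM; exact/measurable_EFinP.
- by move=> n ? _; rewrite mule_ge0// lee_fin.
- move=> x _ ? ? mn; apply: lee_wpmul2r; rewrite lee_fin//.
  exact/lefP/nd_nnsfun_approx.
Qed.

End density.

Section lebesgue_affine.
Local Open Scope ereal_scope.
Context (R : realType).
Local Notation mu := (@lebesgue_measure R).

Lemma measurable_affine (a b : R) :
  measurable_fun [set: R] (fun x => a * x + b)%R.
Proof. by apply: measurable_funD => //; exact: measurable_funM. Qed.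

Let aff (a b : R) : measurableTypeR R -> measurableTypeR R :=
  fun x => (a * x + b)%R.

Let maff a b : measurable_fun setT (aff a b).
Proof. exact: measurable_affine. Qed.

Let image_aff a b : {measure set (measurableTypeR R) -> \bar R} :=
  measure_function_pushforward__canonical__measure_function_Measure mu (maff a b).

(** The image measure, scaled by [a], has the right values on intervals, and
    these determine the Lebesgue measure. *)
Lemma lebesgue_measure_affine (a b : R) (a0 : (0 < a)%R) (A : set R) :
  measurable A -> a%:E * mu ((fun x => (a * x + b)%R) @^-1` A) = mu A.
Proof.
move=> mA.
have an : (0 <= a)%R by exact: ltW.
pose m' := mscale (NngNum an) (image_aff a b).
rewrite -[LHS]/(m' A); apply/esym/lebesgue_measure_unique => //= _ [[c d] _ <-].
rewrite /m' /mscale/= /image_aff/= /pushforward.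
rewrite (_ : aff a b @^-1` _ = `]((c - b) / a)%R, ((d - b) / a)%R]%classic); last first.
  apply/seteqP; split=> x /=; rewrite !in_itv/=.
    by rewrite ltr_pdivrMr// ler_pdivlMr// /aff mulrC ltrBlDr lerBrDr.
  by rewrite ltr_pdivrMr// ler_pdivlMr// /aff mulrC ltrBlDr lerBrDr.
rewrite !lebesgue_measure_itv/= !lte_fin ltr_pM2r ?invr_gt0// ltrD2r.
case: ifPn => _; last by rewrite mule0.
by rewrite -!EFinB -EFinM; congr EFin; field; exact: lt0r_neq0.
Qed.

Lemma ge0_integral_affine (a b : R) (f : R -> \bar R) : (0 < a)%R ->
  measurable_fun [set: R] f -> (forall x, 0 <= f x) ->
  \int[mu]_x f x = a%:E * \int[mu]_x f (a * x + b)%R.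
Proof.
move=> a0 mf f0.
have an : (0 <= a)%R by exact: ltW.
transitivity (\int[mscale (NngNum an) (image_aff a b)]_x f x).
  by apply: eq_measure_integral => A mA _; rewrite /mscale/= -(@lebesgue_measure_affine a b).
rewrite ge0_integral_mscale//; congr (_ * _).
by rewrite ge0_integral_pushforward.
Qed.

End lebesgue_affine.

(** * The standard normal law *)

Lemma integral_prob_cst d (T : measurableType d) (R : realType)
    (P : probability T R) (r : \bar R) : (\int[P]_x r = r)%E.
Proof. by rewrite integral_cst// -[RHS]mule1; congr (_ * _)%E; exact: probability_setT. Qed.

Section std_gaussian.
Local Open Scope ereal_scope.
Context (R : realType).
Local Notation mu := (@lebesgue_measure R).

Let idR : measurableTypeR R -> R := id.

Let midR : measurable_fun setT idR. Proof. exact: measurable_id. Qed.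

HB.instance Definition _ := isMeasurableFun.Build _ _ _ _ idR midR.

(** The standard normal law, carried over from the type of reals that bears
    the Lebesgue measure to the canonical measurable structure of [R]. *)
Definition gauss1 : probability R R :=
  distribution (normal_prob 0%R 1%R) idR.

Let phi (x : R) : R := normal_pdf 0 1 x.

Let phiE x : phi x = (normal_peak (1 : R) * expR (- x ^+ 2 / 2))%R.
Proof.
by rewrite /phi normal_pdfE ?oner_eq0// /normal_fun subr0 expr1n.
Qed.

Let phi_ge0 x : (0 <= phi x)%R. Proof. exact: normal_pdf_ge0. Qed.

Let mphi : measurable_fun [set: R] phi.
Proof. exact: measurable_normal_pdf. Qed.

Let integral_phi : \int[mu]_x (phi x)%:E = 1.
Proof. exact: integral_normal_pdf. Qed.

Let gauss1E (f : R -> \bar R) :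
  measurable_fun [set: R] f -> (forall x, 0 <= f x) ->
  \int[gauss1]_x f x = \int[mu]_x (f x * (phi x)%:E).
Proof.
move=> mf f0; rewrite ge0_integral_distribution//.
by apply: (@ge0_integral_density _ (measurableTypeR R)).
Qed.

Let normal_prob_indic (s : R) (A : set R) : measurable A ->
  normal_prob 0 s A = \int[mu]_x (normal_pdf 0 s x * \1_A x)%:E.
Proof.
move=> mA; rewrite /normal_prob integral_mkcond; apply: eq_integral => x _.
by rewrite patchE indicE; case: ifPn => _; rewrite ?mulr1 ?mulr0.
Qed.

Lemma gauss1_scale (s : R) (s0 : (0 < s)%R) (A : set R) : measurable A ->
  normal_prob 0 s A = gauss1 ((fun x => s * x)%R @^-1` A).
Proof.
move=> mA; have mA' : measurable ((fun x => s * x)%R @^-1` A).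
  by rewrite -[X in measurable X]setTI; exact: (measurable_funM (measurable_cst _)).
rewrite -[RHS]/(normal_prob 0 1 _) !normal_prob_indic//.
have mpdf t B : measurable B ->
    measurable_fun [set: R] (fun x => (normal_pdf 0 t x * \1_B x)%:E).
  move=> mB; apply/measurable_EFinP/measurable_funM.
    exact: measurable_normal_pdf.
  exact: measurable_indic.
have pdf0 t B x : 0 <= (normal_pdf 0 t x * \1_B x)%:E.
  by rewrite lee_fin mulr_ge0// normal_pdf_ge0.
rewrite (@ge0_integral_affine _ s 0%R)//; last exact: mpdf.
rewrite -ge0_integralZl//; last 2 first.
- exact: (measurableT_comp (mpdf s A mA) (measurable_affine s 0)).
- by rewrite lee_fin ltW.
apply: eq_integral => x _; rewrite -EFinM addr0 mulrA; congr (_ * _)%:E.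
rewrite -/(phi x) phiE normal_pdfE ?lt0r_neq0// /normal_peak /normal_fun subr0.
rewrite mulrA; congr (_ * expR _)%R.
  have -> : (s ^+ 2 * pi *+ 2 = s ^+ 2 * (1 ^+ 2 * pi *+ 2) :> R)%R by ring.
  rewrite sqrtrM ?sqr_ge0// sqrtr_sqr gtr0_norm// invfM mulrA divff ?mul1r//.
  exact: lt0r_neq0.
by field; exact: lt0r_neq0.
Qed.

(** The Cameron-Martin formula on the line: complete the square in the
    density. *)
Lemma gauss1_shift (m : R) (f : R -> \bar R) :
  measurable_fun [set: R] f -> (forall x, 0 <= f x) ->
  \int[gauss1]_x f (x + m)%R =
  \int[gauss1]_x (f x * (expR (m * x - m ^+ 2 / 2))%:E).
Proof.
move=> mf f0.
have mfm : measurable_fun [set: R] (fun x => f (x + m)%R).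
  by apply: (measurableT_comp mf); exact: measurable_funD.
have mexp : measurable_fun [set: R] (fun x => expR (m * x - m ^+ 2 / 2)).
  apply: measurableT_comp => //.
  by apply: measurable_funB => //; exact: measurable_funM.
rewrite !gauss1E//; last 2 first.
- by apply: emeasurable_funM => //; exact/measurable_EFinP.
- by move=> x; rewrite mule_ge0// lee_fin expR_ge0.
rewrite [RHS](@ge0_integral_affine _ 1%R m)//; last 2 first.
- apply: emeasurable_funM; last exact/measurable_EFinP.
  by apply: emeasurable_funM => //; exact/measurable_EFinP.
- by move=> x; rewrite !mule_ge0// lee_fin ?expR_ge0.
rewrite mul1e; apply: eq_integral => x _; rewrite mul1r -muleA -EFinM.
congr (_ * _%:E); rewrite !phiE mulrCA -expRD; congr (_ * expR _)%R.
by field.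
Qed.

Lemma gauss1_sym (f : R -> \bar R) :
  measurable_fun [set: R] f -> (forall x, 0 <= f x) ->
  \int[gauss1]_x f (- x)%R = \int[gauss1]_x f x.
Proof.
move=> mf f0.
have mfN : measurable_fun [set: R] (fun x => f (- x)%R).
  by apply: (measurableT_comp mf); exact: oppr_measurable.
rewrite !gauss1E//.
have mN : measurable_fun setT (-%R : measurableTypeR R -> measurableTypeR R).
  exact: oppr_measurable.
have mfphi : measurable_fun [set: measurableTypeR R] (fun x => f x * (phi x)%:E).
  by apply: emeasurable_funM => //; exact/measurable_EFinP.
have fphi0 : {in [set: measurableTypeR R], forall x, 0 <= f x * (phi x)%:E}.
  by move=> x _; rewrite mule_ge0// lee_fin.
have := ge0_integral_pushforward mN mu measurableT mfphi fphi0.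
rewrite preimage_setT => e.
transitivity (\int[mu]_x ((fun x => f x * (phi x)%:E) \o -%R) x).
  by apply: eq_integral => x _; rewrite /= !phiE sqrrN.
rewrite -e.
by apply: eq_measure_integral => A mA _; exact: lebesgue_measureN.
Qed.

Let mexp_lin (a b : R) : measurable_fun [set: R] (fun x => (expR (a * x - b))%:E).
Proof.
apply/measurable_EFinP; apply: measurableT_comp => //.
by apply: measurable_funB => //; exact: measurable_funM.
Qed.

Lemma gauss1_mgf (a : R) :
  \int[gauss1]_x (expR (a * x))%:E = (expR (a ^+ 2 / 2))%:E.
Proof.
have := @gauss1_shift a (cst 1) (@measurable_cst _ _ _ _ _ _) (fun=> lee01).
rewrite /= integral_prob_cst.
under eq_integral do rewrite mul1e.
move=> h; rewrite -[RHS]mule1 h -ge0_integralZl// ?lee_fin ?expR_ge0//.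
by apply: eq_integral => x _; rewrite -EFinM -expRD; congr (expR _)%:E; ring.
Qed.

Let mexp_sqr (t : R) : measurable_fun [set: R] (fun x => (expR (t * x ^+ 2 / 2))%:E).
Proof.
apply/measurable_EFinP; apply: measurableT_comp => //.
by apply: measurable_funM => //; apply: measurable_funM.
Qed.

(** Up to its normalisation the integrand is the density of a centred normal
    law of variance [(1 - t)^-1]. *)
Lemma gauss1_mgf_sqr (t : R) : (t < 1)%R ->
  \int[gauss1]_x (expR (t * x ^+ 2 / 2))%:E = ((Num.sqrt (1 - t))^-1)%:E.
Proof.
move=> t1; set r := Num.sqrt (1 - t).
have r0 : (0 < r)%R by rewrite sqrtr_gt0 subr_gt0.
rewrite gauss1E//.
rewrite -[RHS]mule1 -integral_phi.
rewrite (@ge0_integral_affine _ r 0%R (fun x => (phi x)%:E))//; last first.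
  exact/measurable_EFinP.
rewrite muleA -EFinM mulVf ?lt0r_neq0// mul1e; apply: eq_integral => x _.
rewrite -EFinM !phiE mulrCA -expRD; congr (_ * expR _)%:E.
rewrite addr0 exprMn sqr_sqrtr ?subr_ge0 ?ltW//.
by field.
Qed.

(** The joint density of [c x + s y] and [x] factors into the density of the
    first and a normal density in [x], which integrates to one. *)
Lemma gauss1_rotation (c s : R) (f : R -> \bar R) : (0 < c)%R -> (0 <= s)%R ->
  (c ^+ 2 + s ^+ 2 = 1)%R ->
  measurable_fun [set: R] f -> (forall x, 0 <= f x) ->
  \int[gauss1]_x \int[gauss1]_y f (c * x + s * y)%R = \int[gauss1]_x f x.
Proof.
move=> c0 s0 cs mf f0.
have maff a b : measurable_fun [set: R] (fun x => f (a * x + b)%R).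
  exact: (measurableT_comp mf (measurable_affine a b)).
have [s0'|sn0] := eqVneq s 0%R.
  have c1 : c = 1%R.
    by apply/eqP; rewrite -(@sqrp_eq1 _ c) ?ltW// -cs s0' expr0n/= addr0.
  subst c s; apply: eq_integral => x _.
  transitivity (\int[gauss1]_y f x); last by rewrite integral_prob_cst.
  by apply: eq_integral => y _; rewrite mul1r mul0r addr0.
have {s0 sn0} s0 : (0 < s)%R by rewrite lt_neqAle eq_sym sn0.
have mf2 : measurable_fun setT (fun p : R * R => f (c * p.1 + s * p.2)%R).
  apply: (measurableT_comp mf).
  by apply: measurable_funD; exact: measurable_funM.
rewrite (@gauss1E (fun x => \int[gauss1]_y f (c * x + s * y)%R)); last 2 first.
- exact: (measurable_fun_fubini_tonelli_F (m2 := gauss1) _ mf2).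
- by move=> x; exact: integral_ge0.
have sn0 : s != 0%R by exact: lt0r_neq0.
(* the joint density of the first coordinate and of the rotated one *)
pose q (x z : R) := (phi ((z - c * x) / s) / s * phi x)%R.
have q0 x z : (0 <= q x z)%R by rewrite /q !mulr_ge0// invr_ge0 ltW.
have qC x z : q x z = (phi z * (s^-1 * phi (s^-1 * x - c * z / s)))%R.
  rewrite /q !phiE.
  have e2 : (expR (- ((z - c * x) / s) ^+ 2 / 2) * expR (- x ^+ 2 / 2) =
      expR (- z ^+ 2 / 2) * expR (- (s^-1 * x - c * z / s) ^+ 2 / 2))%R.
    rewrite -!expRD; congr expR; apply: (@mulfI _ (s ^+ 2 *+ 2)).
      by rewrite mulrn_eq0/= expf_eq0.
    have -> : (s ^+ 2 *+ 2 * (- ((z - c * x) / s) ^+ 2 / 2 + - x ^+ 2 / 2) =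
      - (z - c * x) ^+ 2 - s ^+ 2 * x ^+ 2)%R by field.
    have -> : (s ^+ 2 *+ 2 * (- z ^+ 2 / 2 + - (s^-1 * x - c * z / s) ^+ 2 / 2) =
      - s ^+ 2 * z ^+ 2 - (x - c * z) ^+ 2)%R by field.
    have -> : (s ^+ 2 = 1 - c ^+ 2)%R by rewrite -cs; ring.
    by ring.
  move: (expR _) (expR _) (expR _) (expR _) e2 => e4 e3 e2 e1 e12.
  transitivity (normal_peak 1 * normal_peak 1 / s * (e1 * e2))%R; first by ring.
  by rewrite e12; ring.
have mq : measurable_fun [set: R * R] (fun p => q p.1 p.2).
  apply: measurable_funM; last exact: measurableT_comp.
  apply: measurable_funM => //; apply: measurableT_comp => //.
  by apply: measurable_funM => //; apply: measurable_funB => //; exact: measurable_funM.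
have mK : measurable_fun [set: R * R] (fun p => f p.2 * (q p.1 p.2)%:E).
  apply: emeasurable_funM; last exact/measurable_EFinP.
  exact: measurableT_comp.
have mq1 x : measurable_fun [set: R] (fun z => (q x z)%:E).
  by apply/measurable_EFinP; exact: (measurableT_comp mq (pair1_measurable x)).
have mq2 z : measurable_fun [set: R] (fun x => (q x z)%:E).
  by apply/measurable_EFinP; exact: (measurableT_comp mq (pair2_measurable z)).
transitivity (\int[mu]_x \int[mu]_z (f z * (q x z)%:E)).
  apply: eq_integral => x _.
  rewrite gauss1E//; last first.
    by apply: eq_measurable_fun (maff s (c * x)%R) => y _; rewrite addrC.
  rewrite [RHS](@ge0_integral_affine _ s (c * x)%R)//; last 2 first.
  - exact: emeasurable_funM.
  - by move=> z; rewrite mule_ge0// lee_fin.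
  rewrite -ge0_integralZr//; last 3 first.
  - apply: emeasurable_funM; last exact/measurable_EFinP.
    by apply: eq_measurable_fun (maff s (c * x)%R) => y _; rewrite addrC.
  - by move=> y _; rewrite mule_ge0// lee_fin.
  - by rewrite lee_fin.
  rewrite -[RHS]ge0_integralZl//; last 3 first.
  - apply: (measurableT_comp (f := fun z => f z * (q x z)%:E)).
      exact: emeasurable_funM.
    exact: measurable_affine.
  - by move=> y _; rewrite mule_ge0// lee_fin.
  - by rewrite lee_fin ltW.
  apply: eq_integral => y _; rewrite muleCA -muleA -!EFinM /q addrK.
  rewrite [(c * x + _)%R]addrC; congr (_ * _%:E).
  rewrite (_ : (s * y / s)%R = y); last by rewrite mulrC mulKf.
  by rewrite !mulrA (mulrC s) mulfK.
rewrite (@fubini_tonelli _ _ _ _ _ mu mu (fun p => f p.2 * (q p.1 p.2)%:E))//=; last first.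
  by move=> p; rewrite mule_ge0// lee_fin.
rewrite gauss1E//; apply: eq_integral => z _.
under eq_integral do rewrite qC EFinM muleA.
rewrite ge0_integralZl//; last 3 first.
- apply/measurable_EFinP; apply: measurable_funM => //.
  by apply: (measurableT_comp mphi); exact: measurable_affine.
- by move=> x _; rewrite lee_fin mulr_ge0// invr_ge0 ltW.
- by rewrite mule_ge0// lee_fin.
rewrite [X in _ * X](_ : _ = 1) ?mule1//.
under eq_integral do rewrite EFinM.
rewrite ge0_integralZl//; last 3 first.
- by apply/measurable_EFinP; apply: (measurableT_comp mphi); exact: measurable_affine.
- by move=> x _; rewrite lee_fin.
- by rewrite lee_fin invr_ge0 ltW.
rewrite -(@ge0_integral_affine _ s^-1 (- (c * z / s)) (fun x => (phi x)%:E)) ?invr_gt0//.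
exact/measurable_EFinP.
Qed.

Definition gauss_m2 : R := fine (\int[gauss1]_x (x ^+ 2)%:E).

Lemma gauss1_m2 : \int[gauss1]_x (x ^+ 2)%:E = gauss_m2%:E.
Proof.
have h : \int[gauss1]_x (x ^+ 2)%:E <= \int[gauss1]_x (4 * expR (2^-1 * x ^+ 2 / 2))%:E.
  apply: ge0_le_integral => //.
  - by move=> x _; rewrite lee_fin sqr_ge0.
  - by apply/measurable_EFinP; exact: measurable_funX.
  - by apply/measurable_EFinP; apply: measurable_funM => //; apply/measurable_EFinP; exact: mexp_sqr.
  - move=> x _; rewrite lee_fin.
    rewrite [X in (X <= _)%R](_ : _ = 4 * (2^-1 * x ^+ 2 / 2))%R; last by field.
    rewrite ler_pM2l//; apply: le_trans (expR_ge1Dx _).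
    by rewrite lerDr.
rewrite /gauss_m2 fineK// ge0_fin_numE; last first.
  by apply: integral_ge0 => x _; rewrite lee_fin sqr_ge0.
apply: le_lt_trans h _; under eq_integral do rewrite EFinM.
rewrite ge0_integralZl//; first by rewrite gauss1_mgf_sqr ?ltry//; lra.
Qed.

Lemma gauss_m2_ge0 : (0 <= gauss_m2)%R.
Proof. by apply: fine_ge0; apply: integral_ge0 => x _; rewrite lee_fin sqr_ge0. Qed.

Lemma gauss1_sqr_affine (a b : R) :
  \int[gauss1]_x ((a + b * x) ^+ 2)%:E = (a ^+ 2 + gauss_m2 * b ^+ 2)%:E.
Proof.
pose f (x : R) := ((a + b * x) ^+ 2)%:E.
have mf : measurable_fun [set: R] f.
  apply/measurable_EFinP/measurable_funX.
  by apply: measurable_funD => //; exact: measurable_funM.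
have f0 x : 0 <= f x by rewrite lee_fin sqr_ge0.
have e : 2%:E * \int[gauss1]_x f x = 2%:E * (a ^+ 2 + gauss_m2 * b ^+ 2)%:E.
  rewrite [LHS](_ : _ = \int[gauss1]_x f x + \int[gauss1]_x f x); last first.
    by rewrite [2%:E](_ : _ = 1 + 1)// ge0_muleDl ?lee01// !mul1e.
  rewrite -[X in _ + X]gauss1_sym//.
  rewrite -ge0_integralD//; last 1 first.
    by apply: (measurableT_comp mf); exact: oppr_measurable.
  under eq_integral.
    move=> x _; rewrite -EFinD.
    rewrite (_ : (_ + _)%R = (2 * a ^+ 2 + (2 * b ^+ 2) * x ^+ 2)%R); last by ring.
    rewrite EFinD (EFinM (2 * b ^+ 2)); over.
  have mq : measurable_fun [set: R] (fun x : R => (x ^+ 2)%:E).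
    by apply/measurable_EFinP; exact: measurable_funX.
  have q0 : 0 <= (2 * b ^+ 2)%:E by rewrite lee_fin mulr_ge0// sqr_ge0.
  rewrite ge0_integralD//; last 3 first.
  - by move=> x _; rewrite lee_fin mulr_ge0// sqr_ge0.
  - by move=> x _; rewrite mule_ge0// lee_fin sqr_ge0.
  - exact: emeasurable_funM.
  rewrite integral_prob_cst ge0_integralZl//; last first.
    by move=> x _; rewrite lee_fin sqr_ge0.
  by rewrite gauss1_m2 -!EFinM -EFinD; congr EFin; ring.
have /(congr1 (fun z => (2^-1)%:E * z)) := e.
by rewrite !muleA -!EFinM mulVf ?pnatr_eq0// !mul1e mul1r.
Qed.

End std_gaussian.

(** * Standard Gaussian vectors *)

Section gauss_tuple.
Local Open Scope ereal_scope.
Context (R : realType).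

Section cons_pair.
Variable n : nat.

Definition cons_pair (p : R * n.-tuple R) : n.+1.-tuple R := [tuple of p.1 :: p.2].

Lemma measurable_cons_pair : measurable_fun setT cons_pair.
Proof. exact: (measurable_cons measurable_fst measurable_snd). Qed.

HB.instance Definition _ :=
  isMeasurableFun.Build _ _ _ _ cons_pair measurable_cons_pair.

End cons_pair.

(** Built one coordinate at a time, so that integrals unfold by recursion on
    the dimension. *)
Fixpoint gauss n : probability (n.-tuple R) R :=
  match n with
  | 0%N => \d_ [tuple]
  | n'.+1 => distribution (gauss1 R \x gauss n' : probability _ R) (@cons_pair n')
  end.

Lemma integral_gauss0 (f : 0.-tuple R -> \bar R) :
  \int[gauss 0]_v f v = f [tuple].
Proof.
transitivity (\int[gauss 0]_v f [tuple]).
  by apply: eq_integral => v _; rewrite tuple0.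
by rewrite integral_prob_cst.
Qed.

Section cons_integral.
Variables (n : nat) (f : n.+1.-tuple R -> \bar R).
Hypotheses (mf : measurable_fun setT f) (f0 : forall v, 0 <= f v).

Let mfc : measurable_fun setT (f \o @cons_pair n).
Proof. exact: (measurableT_comp mf (@measurable_cons_pair n)). Qed.

Lemma measurable_fun_cons_section (x : R) :
  measurable_fun setT (fun v : n.-tuple R => f [tuple of x :: v]).
Proof.
exact: (measurableT_comp mf (measurable_cons (measurable_cst x) (@measurable_id _ _ _))).
Qed.

Lemma measurable_integral_cons_section :
  measurable_fun setT (fun x : R => \int[gauss n]_v f [tuple of x :: v]).
Proof.
exact: (measurable_fun_fubini_tonelli_F (m2 := gauss n) _ mfc (fun=> f0 _)).
Qed.

Lemma integral_gaussS : \int[gauss n.+1]_v f v =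
  \int[gauss1 R]_x \int[gauss n]_v f [tuple of x :: v].
Proof.
rewrite /= ge0_integral_distribution//.
exact: (fubini_tonelli1 (m1 := gauss1 R) (m2 := gauss n) _ mfc (fun=> f0 _)).
Qed.

End cons_integral.

Lemma measurable_tnth_preimage n (B : set R) (i : 'I_n) : measurable B ->
  measurable [set v : n.-tuple R | B (tnth v i)].
Proof.
move=> mB; rewrite -[X in measurable X]setTI.
exact: (measurable_tnth i).
Qed.

Lemma measurable_rectangle n (B : 'I_n -> set R) : (forall i, measurable (B i)) ->
  measurable [set v : n.-tuple R | forall i, B i (tnth v i)].
Proof.
move=> mB; rewrite [X in measurable X](_ : _ =
    \bigcap_(i in [set: 'I_n]) [set v : n.-tuple R | B i (tnth v i)]).
  by apply: fin_bigcap_measurable => // i _; exact: measurable_tnth_preimage.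
by apply/seteqP; split=> [v Bv i _|v Bv i]; exact: Bv.
Qed.

Lemma gauss_rectangle n (B : 'I_n -> set R) : (forall i, measurable (B i)) ->
  gauss n [set v | forall i, B i (tnth v i)] = \prod_(i < n) gauss1 R (B i).
Proof.
elim: n B => [|n IH] B mB.
  rewrite big_ord0 [X in gauss 0 X](_ : _ = setT) ?probability_setT//.
  by apply/seteqP; split=> // v _ [].
have mB' i : measurable (B (lift ord0 i)) by exact: mB.
have mr := measurable_rectangle mB'.
rewrite big_ord_recl -IH// -(product_measure1E _ _ (mB _) mr).
rewrite -[LHS]/((gauss1 R \x gauss n) (@cons_pair n @^-1` _)).
congr ((gauss1 R \x gauss n) _).
apply/seteqP; split=> [[x v] /= Bxv|[x v] /= [Bx Bv] i].
  split; first by have := Bxv ord0; rewrite /cons_pair/= tnth0.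
  by move=> i; have := Bxv (lift ord0 i); rewrite tnthS.
by case: (unliftP ord0 i) => [j|] ->; [rewrite tnthS|rewrite tnth0].
Qed.

(** Rectangles form a generating pi-system, so they determine the law. *)
Lemma gauss_unique n (m : {measure set (n.-tuple R) -> \bar R}) :
  (forall B : 'I_n -> set R, (forall i, measurable (B i)) ->
     m [set v | forall i, B i (tnth v i)] = \prod_(i < n) gauss1 R (B i)) ->
  forall A, measurable A -> m A = gauss n A.
Proof.
move=> mE A mA.
pose G : set (set (n.-tuple R)) := [set [set v | forall i, B i (tnth v i)] |
  B in [set B : 'I_n -> set R | forall i, measurable (B i)]].
have GT : G setT by exists (fun=> setT) => //; apply/seteqP.
apply: (measure_unique G (fun=> setT)) => //.
- apply/seteqP; split.
    apply: smallest_sub; first exact: smallest_sigma_algebra.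
    have sub (k : 'I_n) C : preimage_set_system setT (fun v : n.-tuple R => tnth v k)
        measurable C -> <<s G >> C.
      move=> [B mB <-]; rewrite setTI; apply: sub_gen_smallest.
      exists (fun i => if i == k then B else setT) => /=.
        by move=> i; case: ifP.
      apply/seteqP; split=> [v /(_ k)|v Bv i]; first by rewrite eqxx.
      by case: eqP => // ->.
    case: n {m mE A mA GT} @G sub => [|n'] G sub; first by rewrite big_ord0.
    rewrite -bigcup_mkord_ord => C [i Ii]; exact: sub.
  apply: smallest_sub; first exact: sigma_algebra_measurable.
  by move=> _ [B mB <-]; exact: measurable_rectangle.
- move=> _ _ [B mB <-] [C mC <-].
  exists (fun i => B i `&` C i); first by move=> i; exact: measurableI.
  apply/seteqP; split=> [v BC|v [Bv Cv] i].
    by split=> i; case: (BC i).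
  by split; [exact: Bv|exact: Cv].
- by rewrite bigcup_const//; exists 0%N.
- move=> _ [B mB <-]; transitivity (\prod_(i < n) gauss1 R (B i)).
    exact: mE.
  exact/esym/gauss_rectangle.
- move=> _.
  have := mE (fun=> setT) (fun=> measurableT).
  rewrite (_ : [set v | _] = setT); last by apply/seteqP; split.
  move=> ->; rewrite big1 ?ltry// => i _; exact: probability_setT.
Qed.

End gauss_tuple.

Section gauss_calculus.
Local Open Scope ereal_scope.
Context (R : realType).
Implicit Types n : nat.

Lemma mktuple_cons (T : Type) n (F : 'I_n.+1 -> T) :
  [tuple F i | i < n.+1] = [tuple of F ord0 :: [tuple F (lift ord0 i) | i < n]].
Proof.
apply: eq_from_tnth => i; rewrite tnth_mktuple.
by case: (unliftP ord0 i) => [j|] ->; rewrite ?tnth0// tnthS tnth_mktuple.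
Qed.

Lemma measurable_mktuple d (T : measurableType d) n (F : T -> 'I_n -> R) :
  (forall i, measurable_fun setT (F ^~ i)) ->
  measurable_fun setT (fun t => [tuple F t i | i < n]).
Proof.
move=> mF; apply/measurable_fun_tnthP => i.
by apply: eq_measurable_fun (mF i) => t _ /=; rewrite tnth_mktuple.
Qed.

Lemma measurable_linear_form n (a : R) (c : 'I_n -> R) :
  measurable_fun setT (fun v : n.-tuple R => a + \sum_(i < n) c i * tnth v i)%R.
Proof.
apply: measurable_funD => //; apply: measurable_sum => i.
by apply: measurable_funM => //; exact: measurable_tnth.
Qed.

Lemma linear_form_cons n (c : 'I_n.+1 -> R) x (v : n.-tuple R) :
  (\sum_(i < n.+1) c i * tnth [tuple of x :: v] i =
   c ord0 * x + \sum_(i < n) c (lift ord0 i) * tnth v i)%R.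
Proof.
rewrite big_ord_recl tnth0; congr (_ + _)%R.
by apply: eq_bigr => i _; rewrite tnthS.
Qed.

(** The Cameron-Martin formula in finite dimension. *)
Lemma gauss_shift n (m : 'I_n -> R) (f : n.-tuple R -> \bar R) :
  measurable_fun setT f -> (forall v, 0 <= f v) ->
  \int[gauss R n]_v f [tuple (tnth v i + m i)%R | i < n] =
  \int[gauss R n]_v (f v *
    (expR (\sum_(i < n) m i * tnth v i - (\sum_(i < n) m i ^+ 2) / 2))%:E).
Proof.
elim: n m f => [|n IH] m f mf f0.
  rewrite !integral_gauss0 !big_ord0 mul0r subr0 expR0 mule1.
  by congr f; exact: tuple0.
have mexp p (c : 'I_p -> R) b :
    measurable_fun setT (fun v : p.-tuple R =>
      (expR (\sum_(i < p) c i * tnth v i - b))%:E).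
  apply/measurable_EFinP; apply: measurableT_comp => //.
  apply: measurable_funB => //.
  apply: (eq_measurable_fun (fun v : p.-tuple R => 0 + \sum_(i < p) c i * tnth v i)%R).
    by move=> v _; rewrite add0r.
  exact: measurable_linear_form.
have mL : measurable_fun setT
    (fun v : n.+1.-tuple R => f [tuple (tnth v i + m i)%R | i < n.+1]).
  apply: (measurableT_comp mf); apply: measurable_mktuple => i.
  by apply: measurable_funD => //; exact: measurable_tnth.
have mR := emeasurable_funM mf (mexp _ m ((\sum_(i < n.+1) m i ^+ 2) / 2)%R).
have fexp0 (v : n.+1.-tuple R) b : 0 <= f v * (expR b)%:E.
  by rewrite mule_ge0// lee_fin expR_ge0.
rewrite (integral_gaussS mL (fun=> f0 _)) (integral_gaussS mR (fun=> fexp0 _ _)).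
pose H x := \int[gauss R n]_v f [tuple of x :: [tuple (tnth v i + m (lift ord0 i))%R | i < n]].
transitivity (\int[gauss1 R]_x H (x + m ord0)%R).
  apply: eq_integral => x _; apply: eq_integral => v _; congr f.
  apply: eq_from_tnth => i; rewrite tnth_mktuple.
  by case: (unliftP ord0 i) => [j|] ->; rewrite ?tnth0// !tnthS tnth_mktuple.
have HE x : H x = \int[gauss R n]_v (f [tuple of x :: v] *
    (expR (\sum_(i < n) m (lift ord0 i) * tnth v i -
       (\sum_(i < n) m (lift ord0 i) ^+ 2) / 2))%:E).
  rewrite /H (IH (fun i => m (lift ord0 i)) (fun v => f [tuple of x :: v]))//.
  exact: measurable_fun_cons_section.
have mH : measurable_fun [set: R] H.
  pose m' i := if unlift ord0 i is Some j then m (lift ord0 j) else 0%R.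
  pose b := ((\sum_(i < n) m (lift ord0 i) ^+ 2) / 2)%R.
  pose g (w : n.+1.-tuple R) :=
    f w * (expR (\sum_(i < n.+1) m' i * tnth w i - b))%:E.
  have mg : measurable_fun setT g by apply: emeasurable_funM => //; exact: mexp.
  apply: (eq_measurable_fun _ _ (measurable_integral_cons_section mg (fun=> fexp0 _ _))).
  move=> x _; rewrite HE; apply: eq_integral => v _.
  rewrite /g linear_form_cons {1}/m' unlift_none mul0r add0r.
  have -> // : (\sum_(i < n) m' (lift ord0 i) * tnth v i =
    \sum_(i < n) m (lift ord0 i) * tnth v i)%R.
  by apply: eq_bigr => i _; rewrite /m' liftK.
rewrite gauss1_shift//; last by move=> x; exact: integral_ge0.
apply: eq_integral => x _; rewrite HE.
have mfx : measurable_fun setT (fun v : n.-tuple R => f [tuple of x :: v]).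
  exact: measurable_fun_cons_section.
rewrite -(ge0_integralZr _ measurableT (emeasurable_funM mfx (mexp _ _ _))); last 2 first.
- by move=> v _; rewrite mule_ge0// lee_fin expR_ge0.
- by rewrite lee_fin expR_ge0.
apply: eq_integral => v _; rewrite -muleA -EFinM -expRD linear_form_cons.
rewrite big_ord_recl; congr (_ * (expR _)%:E); ring.
Qed.

Let mexp n (c : 'I_n -> R) (a b : R) :
  measurable_fun setT (fun v : n.-tuple R =>
    (expR (a * \sum_(i < n) c i * tnth v i - b))%:E).
Proof.
apply/measurable_EFinP; apply: measurableT_comp => //.
apply: measurable_funB => //; apply: measurable_funM => //.
apply: (eq_measurable_fun (fun v : n.-tuple R => 0 + \sum_(i < n) c i * tnth v i)%R).
  by move=> v _; rewrite add0r.
exact: measurable_linear_form.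
Qed.

Lemma gauss_mgf n (a : R) (c : 'I_n -> R) :
  \int[gauss R n]_v (expR (a * \sum_(i < n) c i * tnth v i))%:E =
  (expR (a ^+ 2 * (\sum_(i < n) c i ^+ 2) / 2))%:E.
Proof.
have := gauss_shift (fun i => a * c i)%R (measurable_cst (1 : \bar R)) (fun=> lee01).
rewrite /= integral_prob_cst.
have e1 v : (\sum_(i < n) a * c i * tnth v i = a * \sum_(i < n) c i * tnth v i)%R.
  by rewrite mulr_sumr; apply: eq_bigr => i _; rewrite mulrA.
have e2 : (\sum_(i < n) (a * c i) ^+ 2 = a ^+ 2 * \sum_(i < n) c i ^+ 2)%R.
  by rewrite mulr_sumr; apply: eq_bigr => i _; rewrite exprMn.
under eq_integral do rewrite mul1e e1 e2.
set b := (a ^+ 2 * _ / 2)%R => h.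
rewrite -[RHS]mule1 h -(ge0_integralZl _ measurableT (mexp _ _ _)); last 2 first.
- by move=> v _; rewrite lee_fin expR_ge0.
- by rewrite lee_fin expR_ge0.
by apply: eq_integral => v _; rewrite -EFinM -expRD; congr (expR _)%:E; ring.
Qed.

Lemma gauss_linear_sqr n (a : R) (c : 'I_n -> R) :
  \int[gauss R n]_v ((a + \sum_(i < n) c i * tnth v i) ^+ 2)%:E =
  (a ^+ 2 + gauss_m2 R * \sum_(i < n) c i ^+ 2)%:E.
Proof.
elim: n a c => [|n IH] a c.
  by rewrite integral_gauss0 !big_ord0 mulr0 !addr0.
rewrite integral_gaussS; last 2 first.
- by apply/measurable_EFinP/measurable_funX; exact: measurable_linear_form.
- by move=> v; rewrite lee_fin sqr_ge0.
transitivity (\int[gauss1 R]_x ((a + c ord0 * x) ^+ 2 +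
    gauss_m2 R * \sum_(i < n) c (lift ord0 i) ^+ 2)%:E).
  apply: eq_integral => x _; rewrite -IH; apply: eq_integral => v _.
  by rewrite linear_form_cons addrA.
under eq_integral do rewrite EFinD.
have msq : measurable_fun [set: R] (fun x => ((a + c ord0 * x) ^+ 2)%:E).
  apply/measurable_EFinP/measurable_funX.
  by apply: measurable_funD => //; exact: measurable_funM.
rewrite (ge0_integralD _ measurableT _ msq _ (measurable_cst _)); last 2 first.
- by move=> x _; rewrite lee_fin sqr_ge0.
- move=> x _; rewrite lee_fin mulr_ge0 ?gauss_m2_ge0// sumr_ge0// => i _.
  exact: sqr_ge0.
rewrite gauss1_sqr_affine integral_prob_cst big_ord_recl -EFinD.
by congr EFin; ring.
Qed.

(** The square is linearised by [exp (b L^2 / 2) = E exp (sqrt b L z)] for a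
    standard normal [z]; the two expectations are then exchanged. *)
Lemma gauss_mgf_sqr n (b : R) (c : 'I_n -> R) : (0 <= b)%R ->
  (b * (\sum_(i < n) c i ^+ 2) < 1)%R ->
  \int[gauss R n]_v (expR (b * (\sum_(i < n) c i * tnth v i) ^+ 2 / 2))%:E =
  ((Num.sqrt (1 - b * (\sum_(i < n) c i ^+ 2)))^-1)%:E.
Proof.
move=> b0 b1.
transitivity (\int[gauss R n]_v \int[gauss1 R]_z
    (expR (Num.sqrt b * z * \sum_(i < n) c i * tnth v i))%:E).
  apply: eq_integral => v _.
  transitivity (\int[gauss1 R]_z
      (expR (Num.sqrt b * (\sum_(i < n) c i * tnth v i) * z))%:E).
    by rewrite gauss1_mgf exprMn sqr_sqrtr.
  by apply: eq_integral => z _; congr (expR _)%:E; rewrite mulrAC.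
rewrite (fubini_tonelli (m1 := gauss R n) (m2 := gauss1 R)
  (fun p : n.-tuple R * R =>
    (expR (Num.sqrt b * p.2 * \sum_(i < n) c i * tnth p.1 i))%:E)) /=.
- under eq_integral do rewrite gauss_mgf exprMn sqr_sqrtr//.
  rewrite -(gauss1_mgf_sqr b1); apply: eq_integral => z _.
  by congr (expR _)%:E; ring.
- apply/measurable_EFinP; apply: measurableT_comp => //.
  apply: measurable_funM; first exact: measurable_funM.
  apply: measurable_sum => i; apply: measurable_funM => //.
  exact: (measurableT_comp (measurable_tnth i)).
- by move=> p; rewrite lee_fin expR_ge0.
Qed.

(** Coordinate by coordinate, from [gauss1_rotation]. *)
Lemma gauss_rotation n (c s : 'I_n -> R) (f : n.-tuple R -> \bar R) :
  (forall i, 0 < c i)%R -> (forall i, 0 <= s i)%R ->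
  (forall i, c i ^+ 2 + s i ^+ 2 = 1)%R ->
  measurable_fun setT f -> (forall v, 0 <= f v) ->
  \int[gauss R n]_u \int[gauss R n]_v
    f [tuple (c i * tnth u i + s i * tnth v i)%R | i < n] =
  \int[gauss R n]_v f v.
Proof.
have mrot m (a b : 'I_m -> R) (g : m.-tuple R -> \bar R) : measurable_fun setT g ->
    measurable_fun setT (fun p : m.-tuple R * m.-tuple R =>
      g [tuple (a i * tnth p.1 i + b i * tnth p.2 i)%R | i < m]).
  move=> mg; apply: (measurableT_comp mg); apply: measurable_mktuple => i.
  apply: measurable_funD; apply: measurable_funM => //.
    exact: (measurableT_comp (measurable_tnth i)).
  exact: (measurableT_comp (measurable_tnth i)).
elim: n c s f => [|n IH] c s f c0 s0 cs mf f0.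
  by rewrite !integral_gauss0; congr f; exact: tuple0.
have mf2 := mrot _ c s _ mf.
rewrite (integral_gaussS _ (fun v => integral_ge0 _ (fun w _ => f0 _))); last first.
  exact: (measurable_fun_fubini_tonelli_F (m2 := gauss R n.+1) _ mf2 (fun=> f0 _)).
pose c' i := c (lift ord0 i); pose s' i := s (lift ord0 i).
pose K x y (u v : n.-tuple R) := f [tuple of (c ord0 * x + s ord0 * y)%R ::
  [tuple (c' i * tnth u i + s' i * tnth v i)%R | i < n]].
transitivity (\int[gauss1 R]_x \int[gauss R n]_u \int[gauss1 R]_y \int[gauss R n]_v
    K x y u v).
  apply: eq_integral => x _; apply: eq_integral => u _.
  have mfu := measurableT_comp mf2 (pair1_measurable [tuple of x :: u]).
  rewrite (integral_gaussS mfu (fun=> f0 _)).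
  apply: eq_integral => y _; apply: eq_integral => v _; congr f.
  apply: eq_from_tnth => i; rewrite tnth_mktuple.
  by case: (unliftP ord0 i) => [j|] ->; rewrite ?tnth0// !tnthS tnth_mktuple.
transitivity (\int[gauss1 R]_x \int[gauss1 R]_y \int[gauss R n]_u \int[gauss R n]_v
    K x y u v).
  apply: eq_integral => x _.
  apply: (fubini_tonelli (m1 := gauss R n) (m2 := gauss1 R)
    (fun p => \int[gauss R n]_v K x p.2 p.1 v)).
    apply: (measurable_fun_fubini_tonelli_F (m2 := gauss R n)
      (fun q : (n.-tuple R * R) * n.-tuple R => K x q.1.2 q.1.1 q.2)) => //.
      apply: (measurableT_comp mf); apply: measurable_cons.
        apply: measurable_funD => //; apply: measurable_funM => //.
        exact: measurableT_comp.
      apply: measurable_mktuple => i.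
      apply: measurable_funD; apply: measurable_funM => //.
        apply: (measurableT_comp (measurable_tnth i)); exact: measurableT_comp.
      exact: (measurableT_comp (measurable_tnth i)).
    by move=> q; exact: f0.
  by move=> p; apply: integral_ge0 => v _; exact: f0.
pose g t := \int[gauss R n]_w f [tuple of t :: w].
transitivity (\int[gauss1 R]_x \int[gauss1 R]_y g (c ord0 * x + s ord0 * y)%R).
  apply: eq_integral => x _; apply: eq_integral => y _.
  exact: (IH c' s' _ (fun=> c0 _) (fun=> s0 _) (fun=> cs _)
    (measurable_fun_cons_section mf _) (fun=> f0 _)).
rewrite gauss1_rotation//; last 2 first.
- exact: measurable_integral_cons_section.
- by move=> t; exact: integral_ge0.
by rewrite integral_gaussS.
Qed.

End gauss_calculus.

(** * Total variation *)

Definition tvle d (T : measurableType d) (R : realType) (p q : set T -> \bar R)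
    (e : R) :=
  forall F, measurable F -> (p F <= q F + e%:E)%E.

Section total_variation.
Local Open Scope ereal_scope.
Context d (T : measurableType d) (R : realType).
Implicit Types (p q r : set T -> \bar R) (e : R).

Lemma tvle_trans q p r e1 e2 :
  tvle p q e1 -> tvle q r e2 -> tvle p r (e1 + e2)%R.
Proof.
move=> pq qr F mF; apply: le_trans (pq F mF) _.
by rewrite EFinD [e1%:E + _]addeC addeA leeD2r// qr.
Qed.

Lemma tvle_sym (P Q : probability T R) e : tvle P Q e -> tvle Q P e.
Proof.
move=> PQ F mF; have := PQ _ (measurableC mF).
rewrite !probability_setC//.
rewrite -[P F]fineK ?fin_num_measure// -[Q F]fineK ?fin_num_measure//.
by rewrite -!EFinB -!EFinD !lee_fin; lra.
Qed.

(** If a density [exp l] is close to [1] in that [l] is small in mean, then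
    [1 <= exp l + |l|] bounds the total variation distance. *)
Lemma tv_log_density (P : probability T R) (l : T -> R) (F : set T) :
  measurable_fun setT l -> measurable F ->
  P F <= \int[P]_x ((\1_F x)%:E * (expR (l x))%:E) + \int[P]_x (`|l x|)%:E.
Proof.
move=> ml mF.
have mel : measurable_fun setT (fun x => (\1_F x)%:E * (expR (l x))%:E).
  apply: emeasurable_funM; apply/measurable_EFinP; first exact: measurable_indic.
  exact: measurableT_comp.
have mal : measurable_fun setT (fun x => (`|l x|)%:E).
  by apply/measurable_EFinP; exact: measurableT_comp.
rewrite -(ge0_integralD _ measurableT _ mel _ mal); last 2 first.
- by move=> x _; rewrite mule_ge0// lee_fin expR_ge0.
- by move=> x _; rewrite lee_fin.
have -> : P F = \int[P]_x (\1_F x)%:E by rewrite integral_indic// setIT.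
apply: ge0_le_integral => //.
- by apply/measurable_EFinP; exact: measurable_indic.
- exact: (emeasurable_funD mel mal).
- move=> x _; rewrite -EFinM -EFinD lee_fin.
  rewrite indicE; case: (x \in F); last by rewrite mulr0n mul0r add0r normr_ge0.
  rewrite mulr1n mul1r; apply: (@le_trans _ _ (1 + l x + `|l x|)%R).
    have := ler_norm (- l x)%R; rewrite normrN => h.
    by rewrite -addrA lerDl -(subrr (l x)) lerD2l.
  by rewrite lerD2r expR_ge1Dx.
Qed.

(** The linear part is bounded by [|a| <= eta / 2 + a ^ 2 / (2 eta)], so that
    only second moments enter; [eta] is left free because [s] is of the order
    of the square of the error. *)
Lemma integral_log_density_le (P : probability T R) (a b : T -> R) (eta k s : R) :
  measurable_fun setT a -> measurable_fun setT b -> (forall x, 0 <= b x)%R ->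
  (0 < eta)%R -> (0 <= k)%R -> \int[P]_x (a x ^+ 2)%:E <= (k * s)%:E ->
  \int[P]_x (b x)%:E <= s%:E ->
  \int[P]_x (`|a x - b x / 2|)%:E <= (eta / 2 + (k / eta + 1) / 2 * s)%:E.
Proof.
move=> ma mb b0 eta0 k0 ia ib.
have mae : measurable_fun setT (fun x => ((2 * eta)^-1)%:E * (a x ^+ 2)%:E).
  by apply: emeasurable_funM => //; apply/measurable_EFinP; exact: measurable_funX.
have mbe : measurable_fun setT (fun x => (2^-1)%:E * (b x)%:E).
  by apply: emeasurable_funM => //; exact/measurable_EFinP.
apply: (@le_trans _ _ (\int[P]_x ((eta / 2)%:E +
   (((2 * eta)^-1)%:E * (a x ^+ 2)%:E + (2^-1)%:E * (b x)%:E)))).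
  apply: ge0_le_integral => //.
  - apply/measurable_EFinP; apply: measurableT_comp => //.
    by apply: measurable_funB => //; exact: measurable_funM.
  - by apply: emeasurable_funD => //; exact: emeasurable_funD.
  - move=> x _; rewrite -!EFinM -!EFinD lee_fin.
    apply: (le_trans (ler_normB _ _)).
    have -> : (`|b x / 2| = 2^-1 * b x)%R by rewrite ger0_norm ?divr_ge0// mulrC.
    rewrite addrA lerD2r; have e2 : (0 < 2 * eta)%R by rewrite mulr_gt0.
    rewrite -(ler_pM2l e2) mulrDr mulrA divff ?lt0r_neq0// mul1r.
    have -> : (2 * eta * (eta / 2) = eta ^+ 2)%R by field.
    rewrite mulrAC -[in (a x ^+ 2)%R]real_normK ?num_real// -subr_ge0.
    by rewrite [X in (0 <= X)%R](_ : _ = (eta - `|a x|) ^+ 2)%R ?sqr_ge0//; ring.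
rewrite ge0_integralD//; first last.
- exact: (emeasurable_funD mae mbe).
- by move=> x _; rewrite adde_ge0// mule_ge0// lee_fin ?sqr_ge0// invr_ge0 mulr_ge0// ltW.
- by rewrite lee_fin divr_ge0// ltW.
rewrite ge0_integralD//; first last.
- by move=> x _; rewrite mule_ge0// lee_fin// invr_ge0.
- by move=> x _; rewrite mule_ge0// lee_fin ?sqr_ge0// invr_ge0 mulr_ge0// ltW.
rewrite integral_prob_cst EFinD leeD2l//.
have -> : ((k / eta + 1) / 2 * s)%:E =
    ((2 * eta)^-1)%:E * (k * s)%:E + (2^-1)%:E * s%:E.
  by rewrite -!EFinM -EFinD; congr EFin; field; exact: lt0r_neq0.
have ma2 : measurable_fun setT (fun x => (a x ^+ 2)%:E).
  by apply/measurable_EFinP; exact: measurable_funX.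
have mb' : measurable_fun setT (fun x => (b x)%:E) by exact/measurable_EFinP.
rewrite (ge0_integralZl _ measurableT ma2)//; last 2 first.
- by move=> x _; rewrite lee_fin sqr_ge0.
- by rewrite lee_fin invr_ge0 mulr_ge0// ltW.
rewrite (ge0_integralZl _ measurableT mb')//; last by move=> x _; rewrite lee_fin.
by apply: leeD; apply: lee_wpmul2l => //; rewrite lee_fin invr_ge0// mulr_ge0// ltW.
Qed.

(** A form of the chi-square bound on total variation. With
    [q = \int_F L] and [p = P F], the Cauchy-Schwarz inequality is used as
    [2 g L <= L^2 + g^2] for the step function [g] equal to
    [1 + c (1 - p)] on [F] and to [1 - c p] elsewhere, where [c = q - p]. *)
Lemma tv_chi2 (P : probability T R) (L : T -> \bar R) (t e : R) (F : set T) :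
  measurable_fun setT L -> (forall x, 0 <= L x) -> \int[P]_x L x = 1 ->
  \int[P]_x (L x * L x) <= (1 + t)%:E -> (0 <= e)%R -> (t <= e ^+ 2)%R ->
  measurable F ->
  P F <= \int[P]_(x in F) L x + e%:E /\ \int[P]_(x in F) L x <= P F + e%:E.
Proof.
move=> mL L0 L1 L2 e0 te mF.
set q1 := \int[P]_(x in F) L x.
have mFc := measurableC mF.
have q12 : q1 + \int[P]_(x in ~` F) L x = 1.
  rewrite -ge0_integral_setU ?setUv//; last by apply/disj_setPCl.
have q1fin : q1 \is a fin_num.
  rewrite ge0_fin_numE ?integral_ge0// (@le_lt_trans _ _ 1) ?ltry//.
  by rewrite -q12 leeDl// integral_ge0.
have pfin : P F \is a fin_num by exact: fin_num_measure.
have p0 : 0 <= P F by [].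
have p1 : P F <= 1 by exact: probability_le1.
have q0 : 0 <= q1 by exact: integral_ge0.
have q11 : q1 <= 1 by rewrite -q12 leeDl// integral_ge0.
have q2E : \int[P]_(x in ~` F) L x = 1 - q1 by rewrite -q12 addeAC subee// add0e.
move: q2E q0 q11 p0 p1.
have mI A : measurable A -> \int[P]_(x in A) L x = \int[P]_x ((\1_A x)%:E * L x).
  move=> mA; rewrite integral_mkcond; apply: eq_integral => x _.
  by rewrite patchE indicE; case: ifP => _; rewrite ?mul1e ?mul0e.
have PcF : P (~` F) = 1 - P F by rewrite probability_setC.
move: PcF; rewrite -(fineK pfin) -(fineK q1fin).
set p := fine (P F); set q := fine q1; rewrite -!EFinB !lee_fin => PcF q2E q0 q11 p0 p1.
pose c := (q - p)%R.
pose a := (1 + c * (1 - p))%R; pose b := (1 - c * p)%R.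
have a0 : (0 <= a)%R by rewrite /a /c; nra.
have b0 : (0 <= b)%R by rewrite /b /c; nra.
have key : (2 * (a * q + b * (1 - q)))%:E <=
   (1 + t)%:E + (a ^+ 2 * p + b ^+ 2 * (1 - p))%:E.
  have mLL A : measurable_fun A (fun x => L x * L x).
    exact: (measurable_funTS (emeasurable_funM mL mL)).
  have LL0 x : 0 <= L x * L x by exact: mule_ge0.
  have half (A : set T) (r : R) : measurable A -> (0 <= r)%R ->
      (2 * r)%:E * \int[P]_(x in A) L x <=
      \int[P]_(x in A) (L x * L x) + (r ^+ 2)%:E * P A.
    move=> mA r0; have r20 : 0 <= (2 * r)%:E by rewrite lee_fin mulr_ge0.
    have rr0 : 0 <= (r ^+ 2)%:E by rewrite lee_fin sqr_ge0.
    rewrite -(ge0_integralZl _ mA (measurable_funTS mL))//.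
    rewrite -integral_cst// -ge0_integralD//.
    apply: ge0_le_integral => //.
    - by move=> x _; exact: mule_ge0.
    - exact: (emeasurable_funM (measurable_cst _) (measurable_funTS mL)).
    - exact: (emeasurable_funD (mLL A) (measurable_cst _)).
    - move=> x _; have := L0 x; case: (L x) => [y||] //; last first.
        by move=> _; rewrite mulyy addye// leey.
      move=> _; rewrite -!EFinM -EFinD lee_fin -subr_ge0.
      by rewrite [X in (0 <= X)%R](_ : _ = (y - r) ^+ 2)%R ?sqr_ge0//; ring.
  apply: (@le_trans _ _ (\int[P]_x (L x * L x) + (a ^+ 2 * p + b ^+ 2 * (1 - p))%:E)); last first.
    by rewrite leeD2r.
  have <- : \int[P]_(x in F) (L x * L x) + \int[P]_(x in ~` F) (L x * L x) =
      \int[P]_x (L x * L x).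
    by rewrite -ge0_integral_setU ?setUv//; apply/disj_setPCl.
  have := leeD (half F a mF a0) (half (~` F) b mFc b0).
  rewrite PcF -/q1 q2E -(fineK q1fin) -(fineK pfin) -/p -/q.
  rewrite -!EFinM -EFinD addeACA -EFinD; apply: le_trans.
  by rewrite lee_fin le_eqVlt; apply/orP; left; apply/eqP; ring.
have ct : (c ^+ 2 <= e ^+ 2)%R.
  apply: le_trans te; move: key; rewrite -EFinD lee_fin /a /b => key.
  suff : (2 * c ^+ 2 - c ^+ 2 * p * (1 - p) <= t)%R by nra.
  move: key; rewrite -subr_ge0 => key; rewrite -subr_ge0.
  by move: key; congr (0 <= _)%R; rewrite /c; ring.
have : (`|c| <= e)%R by rewrite -(ger0_norm e0) -ler_sqr ?nnegrE// !real_normK ?num_real.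
by rewrite ler_norml /c => /andP[? ?]; split; lra.
Qed.

End total_variation.

(** * Deterministic and adaptive shifts of Gaussian vectors *)

Section gauss_tv.
Local Open Scope ereal_scope.
Context (R : realType).
Local Notation kappa := (gauss_m2 R).

Lemma measurable_lin n (c : 'I_n -> R) :
  measurable_fun setT (fun v : n.-tuple R => \sum_(i < n) c i * tnth v i)%R.
Proof.
apply: (eq_measurable_fun (fun v : n.-tuple R => 0 + \sum_(i < n) c i * tnth v i)%R).
  by move=> v _; rewrite add0r.
exact: measurable_linear_form.
Qed.

Lemma measurable_shift n (m : 'I_n -> R) :
  measurable_fun setT (fun v : n.-tuple R => [tuple (tnth v i + m i)%R | i < n]).
Proof.
apply: measurable_mktuple => i.
by apply: measurable_funD => //; exact: measurable_tnth.
Qed.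

Lemma integral_preimage d1 d2 (T1 : measurableType d1) (T2 : measurableType d2)
    (P : probability T1 R) (f : T1 -> T2) (F : set T2) :
  measurable_fun setT f -> measurable F ->
  P [set x | F (f x)] = \int[P]_x (\1_F (f x))%:E.
Proof.
move=> mf mF; have mfF : measurable [set x | F (f x)].
  by rewrite -[X in measurable X]setTI; exact: mf.
rewrite -[LHS]/(P [set x | F (f x)]) -[in LHS](setIT [set x | F (f x)]) -integral_indic//.
Qed.

(** The logarithm of the density in [gauss_shift] is small in mean. *)
Lemma gauss_shift_tv n (m : 'I_n -> R) (eta : R) : (0 < eta)%R ->
  tvle (gauss R n)
    (fun F => gauss R n [set v | F [tuple (tnth v i + m i)%R | i < n]])
    (eta / 2 + (kappa / eta + 1) / 2 * \sum_(i < n) m i ^+ 2).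
Proof.
move=> eta0 F mF.
pose l (v : n.-tuple R) := (\sum_(i < n) m i * tnth v i - (\sum_(i < n) m i ^+ 2) / 2)%R.
have ml : measurable_fun setT l by apply: measurable_funB => //; exact: measurable_lin.
apply: le_trans (tv_log_density (gauss R n) ml mF) _; apply: leeD; last first.
  apply: (integral_log_density_le (k := kappa) (measurable_lin m) (measurable_cst _)) => //.
  - by move=> v /=; apply: sumr_ge0 => i _; exact: sqr_ge0.
  - exact: gauss_m2_ge0.
  - rewrite [leLHS](_ : _ = (0 ^+ 2 + kappa * \sum_(i < n) m i ^+ 2)%:E).
      by rewrite expr0n add0r.
    rewrite -gauss_linear_sqr; apply: eq_integral => v _; by rewrite add0r.
  - by rewrite /= integral_prob_cst.
rewrite (integral_preimage _ (measurable_shift m) mF).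
have := gauss_shift m (f := fun v => (\1_F v)%:E); rewrite /l => ->//.
by apply/measurable_EFinP; exact: measurable_indic.
Qed.

Section feedback.
Variable c : nat -> R.

(** The response of a linear feedback: each new increment is shifted by a
    multiple of the current sum [a] of the previous outputs. *)
Fixpoint feedback k (a : R) (s : seq R) : seq R :=
  if s is x :: s' then
    let y := (x + c k * a)%R in y :: feedback k.+1 (a + y)%R s'
  else [::].

(** The linear and quadratic parts of the logarithm of the density of the
    output of a feedback with respect to its standard Gaussian input. *)
Fixpoint feedback_lin k (a : R) (s : seq R) : R :=
  if s is x :: s' then (c k * a * x + feedback_lin k.+1 (a + x) s')%R else 0%R.

Fixpoint feedback_var k (a : R) (s : seq R) : R :=
  if s is x :: s' then ((c k * a) ^+ 2 + feedback_var k.+1 (a + x) s')%R else 0%R.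

Lemma feedback_var_ge0 k a s : (0 <= feedback_var k a s)%R.
Proof. by elim: s k a => //= x s IH k a; rewrite addr_ge0// sqr_ge0. Qed.

Let tuple_consE n (v : n.+1.-tuple R) : v = tnth v ord0 :: [tuple of behead v] :> seq R.
Proof. by rewrite {1}[v]tuple_eta. Qed.

Let measurable_rec n (h : R -> R -> R) (g : R -> n.-tuple R -> R) :
  measurable_fun setT (fun p : R * R => h p.1 p.2) ->
  measurable_fun setT (fun p : R * n.-tuple R => g p.1 p.2) ->
  measurable_fun setT (fun p : R * n.+1.-tuple R =>
    g (h p.1 (tnth p.2 ord0)) [tuple of behead p.2]).
Proof.
move=> mh mg.
have mt : measurable_fun setT (fun p : R * n.+1.-tuple R => tnth p.2 ord0).
  exact: (measurableT_comp (measurable_tnth ord0)).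
have mb : measurable_fun setT (fun p : R * n.+1.-tuple R => [tuple of behead p.2]).
  exact: (measurableT_comp (@measurable_behead _ _ n)).
have mh' : measurable_fun setT (fun p : R * n.+1.-tuple R => h p.1 (tnth p.2 ord0)).
  exact: (measurableT_comp mh (measurable_fun_pair measurable_fst mt)).
exact: (measurableT_comp mg (measurable_fun_pair mh' mb)).
Qed.

Let mthead n : measurable_fun setT (fun p : R * n.+1.-tuple R => tnth p.2 ord0).
Proof. exact: (measurableT_comp (measurable_tnth ord0)). Qed.

Lemma measurable_feedback_lin n k :
  measurable_fun setT (fun p : R * n.-tuple R => feedback_lin k p.1 p.2).
Proof.
elim: n k => [|n IH] k.
  apply: (eq_measurable_fun (fun=> 0%R : R)) => [p _|]; last exact: measurable_cst.
  by rewrite (tuple0 p.2).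
apply: (eq_measurable_fun (fun p : R * n.+1.-tuple R =>
    (c k * p.1 * tnth p.2 ord0 +
     feedback_lin k.+1 (p.1 + tnth p.2 ord0) [tuple of behead p.2])%R)).
  by move=> p _; rewrite [in RHS](tuple_consE p.2).
apply: measurable_funD.
  apply: measurable_funM; last exact: mthead.
  exact: (measurable_funM (measurable_cst _) measurable_fst).
exact: (measurable_rec (h := fun a x => (a + x)%R)
  (g := fun a (s : n.-tuple R) => feedback_lin k.+1 a s)
  (measurable_funD measurable_fst measurable_snd) (IH k.+1)).
Qed.

Lemma measurable_feedback_var n k :
  measurable_fun setT (fun p : R * n.-tuple R => feedback_var k p.1 p.2).
Proof.
elim: n k => [|n IH] k.
  apply: (eq_measurable_fun (fun=> 0%R : R)) => [p _|]; last exact: measurable_cst.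
  by rewrite (tuple0 p.2).
apply: (eq_measurable_fun (fun p : R * n.+1.-tuple R =>
    ((c k * p.1) ^+ 2 +
     feedback_var k.+1 (p.1 + tnth p.2 ord0) [tuple of behead p.2])%R)).
  by move=> p _; rewrite [in RHS](tuple_consE p.2).
apply: measurable_funD.
  apply: measurable_funX.
  exact: (measurable_funM (measurable_cst _) measurable_fst).
exact: (measurable_rec (h := fun a x => (a + x)%R)
  (g := fun a (s : n.-tuple R) => feedback_var k.+1 a s)
  (measurable_funD measurable_fst measurable_snd) (IH k.+1)).
Qed.

Lemma measurable_feedback n k i :
  measurable_fun setT (fun p : R * n.-tuple R => nth 0%R (feedback k p.1 p.2) i).
Proof.
elim: n k i => [|n IH] k i.
  apply: (eq_measurable_fun (fun=> 0%R : R)) => [p _|]; last exact: measurable_cst.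
  by rewrite (tuple0 p.2)/= nth_nil.
have my : measurable_fun setT (fun p : R * n.+1.-tuple R =>
    tnth p.2 ord0 + c k * p.1)%R.
  apply: measurable_funD; first exact: mthead.
  exact: (measurable_funM (measurable_cst _) measurable_fst).
case: i => [|i].
  apply: (eq_measurable_fun (fun p : R * n.+1.-tuple R => tnth p.2 ord0 + c k * p.1)%R) => //.
  by move=> p _; rewrite [in RHS](tuple_consE p.2).
apply: (eq_measurable_fun (fun p : R * n.+1.-tuple R =>
   nth 0%R (feedback k.+1 (p.1 + (tnth p.2 ord0 + c k * p.1))%R [tuple of behead p.2]) i)).
  by move=> p _; rewrite [in RHS](tuple_consE p.2).
apply: (measurable_rec (h := fun a x => (a + (x + c k * a))%R)
  (g := fun a (s : n.-tuple R) => nth 0%R (feedback k.+1 a s) i) _ (IH k.+1 i)).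
apply: (measurable_funD measurable_fst).
apply: (measurable_funD measurable_snd).
exact: (measurable_funM (measurable_cst _) measurable_fst).
Qed.

Let tuple_feedback n (k : nat) (a : R) (v : n.-tuple R) : n.-tuple R :=
  [tuple nth 0%R (feedback k a v) i | i < n].

Let measurable_tuple_feedback n k a : measurable_fun setT (@tuple_feedback n k a).
Proof.
apply: measurable_mktuple => i.
exact: (measurableT_comp (@measurable_feedback n k i) (pair1_measurable a)).
Qed.

Let tuple_feedback_cons n k a x (v : n.-tuple R) :
  tuple_feedback k a [tuple of x :: v] =
  [tuple of (x + c k * a)%R :: tuple_feedback k.+1 (a + (x + c k * a)) v].
Proof. by rewrite /tuple_feedback mktuple_cons. Qed.

Let log_density k (a : R) (s : seq R) :=
  (feedback_lin k a s - feedback_var k a s / 2)%R.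

Let measurable_log_density n k :
  measurable_fun setT (fun p : R * n.-tuple R => (expR (log_density k p.1 p.2))%:E).
Proof.
apply/measurable_EFinP; apply: measurableT_comp => //.
apply: measurable_funB; first exact: measurable_feedback_lin.
by apply: measurable_funM => //; exact: measurable_feedback_var.
Qed.

(** Each coordinate is shifted by a function of the previous ones, to which
    the shift formula on the line applies in turn. *)
Lemma gauss_feedback n k a (f : n.-tuple R -> \bar R) :
  measurable_fun setT f -> (forall v, 0 <= f v) ->
  \int[gauss R n]_v f [tuple nth 0%R (feedback k a v) i | i < n] =
  \int[gauss R n]_v
    (f v * (expR (feedback_lin k a v - feedback_var k a v / 2))%:E).
Proof.
elim: n k a f => [|n IH] k a f mf f0.
  rewrite !integral_gauss0 /= mul0r subr0 expR0 mule1.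
  by congr f; exact: tuple0.
have mL : measurable_fun setT (fun v => f (tuple_feedback k a v)).
  exact: (measurableT_comp mf (@measurable_tuple_feedback _ k a)).
have mexp := measurableT_comp (@measurable_log_density n.+1 k) (pair1_measurable a).
have fexp0 (v : n.+1.-tuple R) b : 0 <= f v * (expR b)%:E.
  by rewrite mule_ge0// lee_fin expR_ge0.
rewrite (integral_gaussS mL (fun=> f0 _)).
rewrite (integral_gaussS (emeasurable_funM mf mexp) (fun=> fexp0 _ _)).
pose H y := \int[gauss R n]_v f [tuple of y :: tuple_feedback k.+1 (a + y) v].
transitivity (\int[gauss1 R]_x H (x + c k * a)%R).
  by apply: eq_integral => x _; apply: eq_integral => v _; rewrite tuple_feedback_cons.
have HE y : H y = \int[gauss R n]_v (f [tuple of y :: v] *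
    (expR (log_density k.+1 (a + y) v))%:E).
  rewrite /H (IH k.+1 (a + y)%R (fun v => f [tuple of y :: v]))//.
  exact: measurable_fun_cons_section.
have mE : measurable_fun setT (fun p : R * n.-tuple R =>
    f [tuple of p.1 :: p.2] * (expR (log_density k.+1 (a + p.1) p.2))%:E).
  apply: emeasurable_funM.
    exact: (measurableT_comp mf (@measurable_cons_pair R n)).
  apply: (measurableT_comp (@measurable_log_density n k.+1)
    (g := fun p : R * n.-tuple R => ((a + p.1)%R, p.2))).
  by apply: measurable_fun_pair => //; exact: measurable_funD.
have mH : measurable_fun [set: R] H.
  apply: (eq_measurable_fun _ _ (measurable_fun_fubini_tonelli_F
    (m2 := gauss R n) _ mE (fun=> fexp0 _ _))).
  by move=> x _; rewrite HE.
rewrite (gauss1_shift _ mH); last by move=> x; apply: integral_ge0 => v _; exact: f0.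
apply: eq_integral => x _; rewrite HE.
have mEx := measurableT_comp mE (pair1_measurable x).
rewrite -(ge0_integralZr _ measurableT mEx); last 2 first.
- by move=> v _; exact: fexp0.
- by rewrite lee_fin expR_ge0.
apply: eq_integral => v _; rewrite -muleA -EFinM -expRD.
congr (_ * _); congr (expR _)%:E; rewrite /log_density /=; ring.
Qed.

Lemma integral_feedback_var n k a :
  \int[gauss R n]_v (feedback_var k a v)%:E =
  (\sum_(i < n) c (k + i)%N ^+ 2 * (a ^+ 2 + i%:R * kappa))%:E.
Proof.
elim: n k a => [|n IH] k a.
  by rewrite integral_gauss0 big_ord0.
have mv k' a' m := measurableT_comp (@measurable_feedback_var m k') (pair1_measurable a').
have v0 m k' a' (v : m.-tuple R) : (0 <= feedback_var k' a' v)%R.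
  exact: feedback_var_ge0.
rewrite integral_gaussS; last 2 first.
- apply/measurable_EFinP; exact: (mv k a n.+1).
- by move=> v; rewrite lee_fin; exact: v0.
pose S1 := (\sum_(i < n) c (k.+1 + i)%N ^+ 2)%R.
pose S0 := (\sum_(i < n) c (k.+1 + i)%N ^+ 2 * (i%:R * kappa))%R.
have SE b : (\sum_(i < n) c (k.+1 + i)%N ^+ 2 * (b + i%:R * kappa) = S1 * b + S0)%R.
  rewrite /S1 /S0 mulr_suml -big_split/=; apply: eq_bigr => i _; ring.
have S10 : (0 <= S1)%R by apply: sumr_ge0 => i _; exact: sqr_ge0.
have S00 : (0 <= S0)%R.
  apply: sumr_ge0 => i _; apply: mulr_ge0; first exact: sqr_ge0.
  by apply: mulr_ge0 => //; exact: gauss_m2_ge0.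
transitivity (\int[gauss1 R]_x (((c k * a) ^+ 2 + S0)%:E + S1%:E * ((a + 1 * x) ^+ 2)%:E)).
  apply: eq_integral => x _.
  transitivity (\int[gauss R n]_v (((c k * a) ^+ 2)%:E + (feedback_var k.+1 (a + x) v)%:E)).
    by apply: eq_integral => v _.
  rewrite (ge0_integralD _ measurableT _ (measurable_cst _) _ _); last 3 first.
  - by move=> v _; rewrite lee_fin sqr_ge0.
  - by move=> v _; rewrite lee_fin; exact: v0.
  - apply/measurable_EFinP; exact: (mv k.+1 (a + x)%R n).
  rewrite integral_prob_cst IH SE -EFinM -!EFinD; congr EFin; ring.
have msq : measurable_fun [set: R] (fun x => ((a + 1 * x) ^+ 2)%:E).
  apply/measurable_EFinP/measurable_funX.
  by apply: measurable_funD => //; exact: measurable_funM.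
rewrite (ge0_integralD _ measurableT _ (measurable_cst _) _ _); last 3 first.
- by move=> v _; rewrite lee_fin addr_ge0// sqr_ge0.
- by move=> v _; rewrite mule_ge0// lee_fin// sqr_ge0.
- exact: (emeasurable_funM (measurable_cst _) msq).
rewrite integral_prob_cst (ge0_integralZl _ measurableT msq); last 2 first.
- by move=> v _; rewrite lee_fin sqr_ge0.
- by rewrite lee_fin.
rewrite gauss1_sqr_affine -EFinM -EFinD; congr EFin.
rewrite big_ord_recl addn0 mul0r addr0 exprMn -addrA; congr (_ + _)%R.
transitivity (S1 * (a ^+ 2 + kappa) + S0)%R; first by ring.
rewrite -SE; apply: eq_bigr => i _; rewrite /= /bump leq0n add1n addnS addSn.
by rewrite -[in RHS]natr1; ring.
Qed.

(** The terms of the linear part are martingale increments, hence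
    orthogonal. *)
Lemma integral_feedback_lin n k a b :
  \int[gauss R n]_v ((b + feedback_lin k a v) ^+ 2)%:E =
  (b ^+ 2 + kappa * \sum_(i < n) c (k + i)%N ^+ 2 * (a ^+ 2 + i%:R * kappa))%:E.
Proof.
elim: n k a b => [|n IH] k a b.
  by rewrite integral_gauss0 big_ord0 mulr0 !addr0.
rewrite integral_gaussS; last 2 first.
- apply/measurable_EFinP/measurable_funX; apply: measurable_funD => //.
  exact: (measurableT_comp (@measurable_feedback_lin n.+1 k) (pair1_measurable a)).
- by move=> v; rewrite lee_fin sqr_ge0.
pose S1 := (\sum_(i < n) c (k.+1 + i)%N ^+ 2)%R.
pose S0 := (\sum_(i < n) c (k.+1 + i)%N ^+ 2 * (i%:R * kappa))%R.
have SE d : (\sum_(i < n) c (k.+1 + i)%N ^+ 2 * (d + i%:R * kappa) = S1 * d + S0)%R.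
  rewrite /S1 /S0 mulr_suml -big_split/=; apply: eq_bigr => i _; ring.
have S10 : (0 <= S1)%R by apply: sumr_ge0 => i _; exact: sqr_ge0.
have S00 : (0 <= S0)%R.
  apply: sumr_ge0 => i _; apply: mulr_ge0; first exact: sqr_ge0.
  by apply: mulr_ge0 => //; exact: gauss_m2_ge0.
have k0 := gauss_m2_ge0 R.
have msq d e : measurable_fun [set: R] (fun x => ((d + e * x) ^+ 2)%:E).
  apply/measurable_EFinP/measurable_funX.
  by apply: measurable_funD => //; exact: measurable_funM.
have msqc d e t : measurable_fun [set: R] (fun x => t%:E * ((d + e * x) ^+ 2)%:E).
  exact: (emeasurable_funM (measurable_cst _) (msq d e)).
transitivity (\int[gauss1 R]_x (((b + (c k * a) * x) ^+ 2)%:E +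
    ((kappa * S0)%:E + (kappa * S1)%:E * ((a + 1 * x) ^+ 2)%:E))).
  apply: eq_integral => x _.
  transitivity (\int[gauss R n]_v ((b + c k * a * x + feedback_lin k.+1 (a + x) v) ^+ 2)%:E).
    by apply: eq_integral => v _; rewrite /= addrA.
  by rewrite IH SE -EFinM -!EFinD; congr EFin; ring.
rewrite (ge0_integralD _ measurableT _ (msq _ _) _ _); last 3 first.
- by move=> v _; rewrite lee_fin sqr_ge0.
- move=> v _; apply: adde_ge0; first by rewrite lee_fin mulr_ge0.
  by apply: mule_ge0; rewrite lee_fin; [exact: mulr_ge0|exact: sqr_ge0].
- exact: (emeasurable_funD (measurable_cst _) (msqc _ _ _)).
rewrite (ge0_integralD _ measurableT _ (measurable_cst _) _ (msqc _ _ _)); last 2 first.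
- by move=> v _; rewrite lee_fin mulr_ge0.
- by move=> v _; apply: mule_ge0; rewrite lee_fin; [exact: mulr_ge0|exact: sqr_ge0].
rewrite integral_prob_cst (ge0_integralZl _ measurableT (msq _ _)); last 2 first.
- by move=> v _; rewrite lee_fin sqr_ge0.
- by rewrite lee_fin mulr_ge0.
rewrite !gauss1_sqr_affine -EFinM -!EFinD; congr EFin.
rewrite big_ord_recl addn0 mul0r addr0 exprMn -!addrA; congr (_ + _)%R.
transitivity (kappa * (c k ^+ 2 * a ^+ 2 + (S1 * (a ^+ 2 + kappa) + S0)))%R; first by ring.
congr (_ * (_ + _))%R.
rewrite -SE; apply: eq_bigr => i _; rewrite /= /bump leq0n add1n addnS addSn.
by rewrite -[in RHS]natr1; ring.
Qed.

(** The adaptive analogue of [gauss_shift_tv]: the energy of the shift is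
    random, and only its mean enters the bound. *)
Lemma gauss_feedback_tv n (eta : R) : (0 < eta)%R ->
  tvle (gauss R n)
    (fun F => gauss R n [set v | F [tuple nth 0%R (feedback 0 0 v) i | i < n]])
    (eta / 2 + (kappa / eta + 1) / 2 *
       \sum_(i < n) c i ^+ 2 * (i%:R * kappa)).
Proof.
move=> eta0 F mF.
have ml := measurableT_comp (@measurable_feedback_lin n 0) (pair1_measurable (0%R : R)).
have mv := measurableT_comp (@measurable_feedback_var n 0) (pair1_measurable (0%R : R)).
have mld : measurable_fun setT (fun v : n.-tuple R => log_density 0 0 v).
  by apply: measurable_funB => //; exact: measurable_funM.
apply: le_trans (tv_log_density (gauss R n) mld mF) _; apply: leeD; last first.
  apply: (integral_log_density_le (k := kappa) ml mv) => //.
  - by move=> v; exact: feedback_var_ge0.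
  - exact: gauss_m2_ge0.
  - rewrite [leLHS](_ : _ = (0 ^+ 2 + kappa *
        \sum_(i < n) c (0 + i)%N ^+ 2 * (0 ^+ 2 + i%:R * kappa))%:E).
      by rewrite expr0n add0r lee_fin; under eq_bigr do rewrite add0r.
    rewrite -integral_feedback_lin; apply: eq_integral => v _; by rewrite add0r.
  - rewrite integral_feedback_var lee_fin expr0n.
    by under eq_bigr do rewrite add0n add0r.
rewrite (integral_preimage _ (@measurable_tuple_feedback n 0 0) mF).
rewrite (gauss_feedback _ _ (f := fun v => (\1_F v)%:E))//.
by apply/measurable_EFinP; exact: measurable_indic.
Qed.

End feedback.

End gauss_tv.

(** * Random shifts of Gaussian vectors *)

Section gauss_mixture.
Local Open Scope ereal_scope.
Context (R : realType).

(** Jensen's inequality: the exponential lies above its tangent at the mean. *)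
Lemma expR_convex_sum (I : finType) (w x : I -> R) :
  (forall i, 0 <= w i)%R -> (\sum_i w i = 1)%R ->
  (expR (\sum_i w i * x i) <= \sum_i w i * expR (x i))%R.
Proof.
move=> w0 w1; set y := (\sum_i w i * x i)%R.
have -> : expR y = (\sum_i w i * (expR y * (1 + (x i - y))))%R.
  under eq_bigr do rewrite mulrCA mulrDr mulr1 mulrBr.
  rewrite -mulr_sumr big_split/= sumrB w1 -mulr_suml w1 -/y.
  by rewrite mul1r subrr addr0 mulr1.
apply: ler_sum => i _; apply: ler_wpM2l => //.
have -> : (expR (x i) = expR y * expR (x i - y))%R by rewrite -expRD addrC subrK.
by apply: ler_wpM2l; [exact: expR_ge0|exact: expR_ge1Dx].
Qed.

Lemma inv_sqrt_le (t : R) : (0 <= t)%R -> (t <= 2^-1)%R ->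
  ((Num.sqrt (1 - t))^-1 <= 1 + t)%R.
Proof.
move=> t0 t1; have s0 : (0 < Num.sqrt (1 - t))%R by rewrite sqrtr_gt0; lra.
have p0 : (0 < 1 + t)%R by lra.
rewrite -[leLHS]mul1r ler_pdivrMr// -(@ler_sqr _ 1%R) ?nnegrE//; last first.
  by rewrite mulr_ge0// ltW.
by rewrite expr1n exprMn sqr_sqrtr; nra.
Qed.

(** No diagonalisation is needed: the exponent is a convex combination of
    squares of single Gaussian variables, each rescaled so that the bound is
    the same for all of them. *)
Lemma gauss_quadratic_mgf n (G : 'I_n -> 'I_n -> R) :
  let t := (\sum_j \sum_k G j k ^+ 2)%R in (t < 1)%R ->
  \int[gauss R n]_v (expR ((\sum_j (\sum_k G j k * tnth v k) ^+ 2) / 2))%:E <=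
  ((Num.sqrt (1 - t))^-1)%:E.
Proof.
move=> t t1.
pose s j := (\sum_k G j k ^+ 2)%R.
have s0 j : (0 <= s j)%R by apply: sumr_ge0 => k _; exact: sqr_ge0.
have t0 : (0 <= t)%R by apply: sumr_ge0 => j _; exact: s0.
have ms (j : 'I_n) (b : R) : measurable_fun setT (fun v : n.-tuple R =>
    (expR (b * (\sum_k G j k * tnth v k) ^+ 2 / 2))%:E).
  apply/measurable_EFinP; apply: measurableT_comp => //.
  apply: measurable_funM => //; apply: measurable_funM => //; apply: measurable_funX.
  apply: measurable_sum => k.
  by apply: measurable_funM => //; exact: measurable_tnth.
have Gs0 j : s j = 0%R -> forall k, G j k = 0%R.
  move=> /eqP; rewrite psumr_eq0 => [/allP h k|k _]; last exact: sqr_ge0.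
  by have /eqP := h k (mem_index_enum _); move/eqP; rewrite sqrf_eq0 => /eqP.
have [tE|tn0] := eqVneq t 0%R.
  have G0 j k : G j k = 0%R.
    apply: Gs0; apply/eqP; rewrite eq_le s0 andbT -tE /t.
    by rewrite (bigD1 j)//= lerDl; apply: sumr_ge0 => k' _; exact: s0.
  rewrite [leLHS](_ : _ = 1).
    by rewrite tE subr0 sqrtr1 invr1.
  rewrite -[RHS](integral_prob_cst (gauss R n)); apply: eq_integral => v _.
  rewrite big1 ?mul0r ?expR0// => j _; rewrite big1 ?expr0n// => k _.
  by rewrite G0 mul0r.
(* weights for which the rescaled squares [b j * _] all have the parameter [t] *)
pose w j := (s j / t)%R; pose b j := (t / s j)%R.
have w0 j : (0 <= w j)%R by rewrite divr_ge0.
have w1 : (\sum_j w j = 1)%R by rewrite -mulr_suml divff.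
have wb j (v : n.-tuple R) : (w j * (b j * (\sum_k G j k * tnth v k) ^+ 2 / 2) =
    (\sum_k G j k * tnth v k) ^+ 2 / 2)%R.
  have [sj|sj] := eqVneq (s j) 0%R.
    by rewrite big1 ?expr0n ?mulr0 ?mul0r ?mulr0// => k _; rewrite Gs0// mul0r.
  by rewrite /w /b; field; rewrite sj.
apply: (@le_trans _ _ (\int[gauss R n]_v
   \sum_j ((w j)%:E * (expR (b j * (\sum_k G j k * tnth v k) ^+ 2 / 2))%:E))).
  apply: ge0_le_integral => //.
  - apply/measurable_EFinP; apply: measurableT_comp => //.
    apply: measurable_funM => //; apply: measurable_sum => j; apply: measurable_funX.
    apply: measurable_sum => k.
    by apply: measurable_funM => //; exact: measurable_tnth.
  - by apply: emeasurable_sum => j; apply: emeasurable_funM.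
  - move=> v _; rewrite [leRHS](_ : _ = (\sum_j w j *
        expR (b j * (\sum_k G j k * tnth v k) ^+ 2 / 2))%:E); last first.
      by rewrite -sumEFin; apply: eq_bigr => j _; rewrite EFinM.
    rewrite lee_fin mulr_suml.
    rewrite [X in (expR X <= _)%R](eq_bigr _ (fun j _ => esym (wb j v))).
    exact: expR_convex_sum.
rewrite ge0_integral_sum//; last 2 first.
- by move=> j; apply: emeasurable_funM.
- by move=> j v _; rewrite mule_ge0// lee_fin ?expR_ge0.
rewrite (_ : ((Num.sqrt (1 - t))^-1)%:E = \sum_j ((w j)%:E * ((Num.sqrt (1 - t))^-1)%:E)); last first.
  by under eq_bigr do rewrite -EFinM; rewrite sumEFin -mulr_suml w1 mul1r.
apply: lee_sum => j _; rewrite (ge0_integralZl _ measurableT (ms j _)); last 2 first.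
- by move=> v _; rewrite lee_fin expR_ge0.
- by rewrite lee_fin.
have [sj|sj] := eqVneq (s j) 0%R; first by rewrite /w sj mul0r !mul0e.
have bs : (b j * s j = t)%R by rewrite /b mulfVK.
rewrite gauss_mgf_sqr; last 2 first.
- by rewrite divr_ge0.
- by rewrite bs.
by rewrite -/(s j) bs.
Qed.

(** Shifting a standard Gaussian vector by an independent Gaussian vector
    changes its law by at most the Hilbert-Schmidt norm of the Gram matrix
    of the shift. *)
Lemma gauss_mixture_tv n J (m : 'I_n -> 'I_J -> R) (e : R) (F : set (n.-tuple R)) :
  let t := (\sum_j \sum_k (\sum_i m i j * m i k) ^+ 2)%R in
  (t <= 2^-1)%R -> (0 <= e)%R -> (t <= e ^+ 2)%R -> measurable F ->
  let q := \int[gauss R J]_v gauss R n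
    [set z | F [tuple (tnth z i + \sum_j m i j * tnth v j)%R | i < n]] in
  gauss R n F <= q + e%:E /\ q <= gauss R n F + e%:E.
Proof.
move=> t t1 e0 te mF q.
pose M (v : J.-tuple R) i := (\sum_j m i j * tnth v j)%R.
pose l (z : n.-tuple R) (v : J.-tuple R) :=
  (\sum_i M v i * tnth z i - (\sum_i M v i ^+ 2) / 2)%R.
have ml2 : measurable_fun setT (fun p : n.-tuple R * J.-tuple R => (expR (l p.1 p.2))%:E).
  have mM i : measurable_fun setT (fun p : n.-tuple R * J.-tuple R => M p.2 i).
    exact: (measurableT_comp (measurable_lin (m i))).
  apply/measurable_EFinP; apply: measurableT_comp => //; apply: measurable_funB.
    apply: measurable_sum => i; apply: measurable_funM => //.
    exact: (measurableT_comp (measurable_tnth i)).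
  apply: measurable_funM => //; apply: measurable_sum => i; exact: measurable_funX.
have el0 z v : 0 <= (expR (l z v))%:E by rewrite lee_fin expR_ge0.
(* the density of the shifted law: a mixture of Cameron-Martin densities *)
pose L z := \int[gauss R J]_v (expR (l z v))%:E.
have mL : measurable_fun setT L.
  exact: (measurable_fun_fubini_tonelli_F (m2 := gauss R J) _ ml2 (fun=> el0 _ _)).
have L0 z : 0 <= L z by exact: integral_ge0.
have lawE (A : set (n.-tuple R)) : measurable A -> \int[gauss R J]_v gauss R n
    [set z | A [tuple (tnth z i + M v i)%R | i < n]] = \int[gauss R n]_(z in A) L z.
  move=> mA.
  have mA1 : measurable_fun setT (fun z : n.-tuple R => (\1_A z)%:E : \bar R).
    by apply/measurable_EFinP; exact: measurable_indic.
  have mAl : measurable_fun setT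
      (fun p : n.-tuple R * J.-tuple R => (\1_A p.1)%:E * (expR (l p.1 p.2))%:E).
    exact: (emeasurable_funM (measurableT_comp mA1 measurable_fst) ml2).
  rewrite [RHS]integral_mkcond.
  transitivity (\int[gauss R J]_v \int[gauss R n]_z ((\1_A z)%:E * (expR (l z v))%:E)).
    apply: eq_integral => v _.
    transitivity (\int[gauss R n]_z (\1_A [tuple (tnth z i + M v i)%R | i < n])%:E).
      exact: (integral_preimage _ (measurable_shift (M v)) mA).
    by rewrite (gauss_shift (M v) (f := fun z => (\1_A z)%:E)).
  rewrite -(fubini_tonelli (m1 := gauss R n) (m2 := gauss R J) _ mAl); last first.
    by move=> p; rewrite mule_ge0.
  apply: eq_integral => z _ /=.
  rewrite (ge0_integralZl _ measurableT (measurableT_comp ml2 (pair1_measurable z)));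
    last 2 first.
  - by move=> v _; exact: el0.
  - by rewrite lee_fin.
  by rewrite patchE indicE; case: ifP => _; rewrite ?mul1e ?mul0e.
have qE : q = \int[gauss R n]_(z in F) L z by exact: lawE.
rewrite qE; apply: (tv_chi2 mL L0 _ _ e0 te mF).
  rewrite -lawE//; rewrite -[RHS](integral_prob_cst (gauss R J)).
  apply: eq_integral => v _; exact: probability_setT.
have t0 : (0 <= t)%R by do 2 (apply: sumr_ge0 => ? _); exact: sqr_ge0.
apply: (@le_trans _ _ ((Num.sqrt (1 - t))^-1)%:E); last by rewrite lee_fin inv_sqrt_le.
have tlt : (t < 1)%R by lra.
apply: le_trans (gauss_quadratic_mgf tlt).
pose g (w : J.-tuple R) (z : n.-tuple R) v := (expR (l z w))%:E * (expR (l z v))%:E.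
have g0 w z v : 0 <= g w z v by exact: mule_ge0.
rewrite le_eqVlt; apply/orP; left; apply/eqP.
transitivity (\int[gauss R n]_z \int[gauss R J]_w \int[gauss R J]_v g w z v).
  apply: eq_integral => z _.
  have mz := measurableT_comp ml2 (pair1_measurable z).
  rewrite -(ge0_integralZr _ measurableT mz (fun v _ => el0 _ _) (L0 z)).
  apply: eq_integral => w _.
  by rewrite -(ge0_integralZl _ measurableT mz (fun v _ => el0 _ _) (el0 _ _)).
have mg : measurable_fun setT (fun p : (n.-tuple R * J.-tuple R) * J.-tuple R =>
    g p.1.2 p.1.1 p.2).
  apply: emeasurable_funM.
    exact: (measurableT_comp ml2 measurable_fst).
  apply: (measurableT_comp ml2 (g := fun p : (n.-tuple R * J.-tuple R) * J.-tuple R =>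
    (p.1.1, p.2))).
  by apply: measurable_fun_pair => //; exact: measurableT_comp.
rewrite (fubini_tonelli (m1 := gauss R n) (m2 := gauss R J)
  (fun p => \int[gauss R J]_v g p.2 p.1 v)) /=; last 2 first.
- exact: (measurable_fun_fubini_tonelli_F (m2 := gauss R J) _ mg (fun=> g0 _ _ _)).
- by move=> p; exact: integral_ge0.
apply: eq_integral => w _.
have mgw : measurable_fun setT (fun p : n.-tuple R * J.-tuple R => g w p.1 p.2).
  apply: (measurableT_comp mg (g := fun p : n.-tuple R * J.-tuple R => ((p.1, w), p.2))).
  by apply: measurable_fun_pair => //; exact: measurable_fun_pair.
rewrite (fubini_tonelli (m1 := gauss R n) (m2 := gauss R J) _ mgw (fun=> g0 _ _ _)) /=.
transitivity (\int[gauss R J]_v (expR (1 * \sum_k (\sum_i M w i * m i k) * tnth v k))%:E).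
  apply: eq_integral => v _.
  pose a := ((\sum_i M w i ^+ 2) / 2 + (\sum_i M v i ^+ 2) / 2)%R.
  transitivity (\int[gauss R n]_z ((expR (- a))%:E *
      (expR (1 * \sum_i (M w i + M v i) * tnth z i))%:E)).
    apply: eq_integral => z _; rewrite /g -!EFinM -!expRD; congr (expR _)%:E.
    have -> : (\sum_i (M w i + M v i) * tnth z i =
        \sum_i M w i * tnth z i + \sum_i M v i * tnth z i)%R.
      by rewrite -big_split/=; apply: eq_bigr => i _; rewrite mulrDl.
    by rewrite /l /a; ring.
  have ms : measurable_fun setT (fun z : n.-tuple R =>
      (expR (1 * \sum_i (M w i + M v i) * tnth z i))%:E).
    apply/measurable_EFinP; apply: measurableT_comp => //; apply: measurable_funM => //.
    exact: measurable_lin.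
  rewrite (ge0_integralZl _ measurableT ms); last 2 first.
  - by move=> z _; rewrite lee_fin expR_ge0.
  - by rewrite lee_fin expR_ge0.
  rewrite gauss_mgf -EFinM -expRD expr1n !mul1r; congr (expR _)%:E.
  have -> : (\sum_i (M w i + M v i) ^+ 2 = \sum_i M w i ^+ 2 +
      \sum_i M v i ^+ 2 + 2 * \sum_i M w i * M v i)%R.
    by rewrite mulr_sumr -!big_split/=; apply: eq_bigr => i _; ring.
  have -> : (\sum_k (\sum_i M w i * m i k) * tnth v k = \sum_i M w i * M v i)%R.
    under eq_bigr do rewrite mulr_suml.
    rewrite exchange_big/=; apply: eq_bigr => i _; rewrite /M mulr_sumr.
    by apply: eq_bigr => k _; rewrite mulrA.
  by rewrite /a; field.
rewrite gauss_mgf expr1n mul1r; congr (expR (_ / 2))%:E.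
apply: eq_bigr => k _; congr (_ ^+ 2)%R.
under eq_bigr do rewrite /M mulr_suml.
rewrite exchange_big/=; apply: eq_bigr => j _; rewrite mulr_suml.
by apply: eq_bigr => i _; ring.
Qed.

End gauss_mixture.

(** * Random walks observed with noise *)

Section gauss_cat.
Local Open Scope ereal_scope.
Context (R : realType).

Lemma measurable_cat J n : measurable_fun setT
  (fun p : J.-tuple R * n.-tuple R => [tuple of p.1 ++ p.2]).
Proof.
apply/measurable_fun_tnthP => i; case: (split_ordP i) => j ->.
  apply: (eq_measurable_fun (fun p : J.-tuple R * n.-tuple R => tnth p.1 j)).
    by move=> p _ /=; rewrite tnth_lshift.
  exact: (measurableT_comp (measurable_tnth j)).
apply: (eq_measurable_fun (fun p : J.-tuple R * n.-tuple R => tnth p.2 j)).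
  by move=> p _ /=; rewrite tnth_rshift.
exact: (measurableT_comp (measurable_tnth j)).
Qed.

Lemma gauss_cat J n (f : (J + n).-tuple R -> \bar R) :
  measurable_fun setT f -> (forall z, 0 <= f z) ->
  \int[gauss R (J + n)]_z f z =
  \int[gauss R J]_x \int[gauss R n]_e f [tuple of x ++ e].
Proof.
elim: J f => [|J IH] f mf f0.
  rewrite integral_gauss0; apply: eq_integral => e _.
  by congr f; apply/val_inj.
have mfc := measurableT_comp mf (@measurable_cat J.+1 n).
rewrite (integral_gaussS mf f0) integral_gaussS; last 2 first.
- exact: (measurable_fun_fubini_tonelli_F (m2 := gauss R n) _ mfc (fun=> f0 _)).
- by move=> x; exact: integral_ge0.
apply: eq_integral => x _.
rewrite (IH (fun z => f [tuple of x :: z]) (measurable_fun_cons_section mf _) (fun=> f0 _)).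
apply: eq_integral => u _; apply: eq_integral => e _.
by congr f; exact/val_inj.
Qed.

Lemma gauss_rotation_swap n (c s : 'I_n -> R) (f : n.-tuple R -> \bar R) :
  (forall i, 0 < c i)%R -> (forall i, 0 <= s i)%R ->
  (forall i, c i ^+ 2 + s i ^+ 2 = 1)%R ->
  measurable_fun setT f -> (forall v, 0 <= f v) ->
  \int[gauss R n]_v \int[gauss R n]_u
    f [tuple (c i * tnth u i + s i * tnth v i)%R | i < n] =
  \int[gauss R n]_v f v.
Proof.
move=> c0 s0 cs mf f0; rewrite -(gauss_rotation c0 s0 cs mf f0).
apply/esym; apply: (fubini_tonelli (m1 := gauss R n) (m2 := gauss R n)
  (fun p => f [tuple (c i * tnth p.1 i + s i * tnth p.2 i)%R | i < n])) => //.
apply: (measurableT_comp mf); apply: measurable_mktuple => i.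
apply: measurable_funD; apply: measurable_funM => //.
  exact: (measurableT_comp (measurable_tnth i)).
exact: (measurableT_comp (measurable_tnth i)).
Qed.

End gauss_cat.

Section blocks.
Local Open Scope nat_scope.

Lemma card_block_le (n a m q : nat) : 0 < m ->
  #|[pred i : 'I_n | (i + a) %/ m == q]| <= m.
Proof.
move=> m0; pose f (i : 'I_n) : 'I_m := Ordinal (ltn_pmod (i + a) m0).
rewrite -[leqRHS]card_ord -(card_in_image (f := f)); first exact: max_card.
move=> i j; rewrite !inE => /eqP iq /eqP jq [] ij; apply/val_inj/(@addIn a) => /=.
by rewrite (divn_eq (i + a) m) (divn_eq (j + a) m) iq jq ij.
Qed.

Lemma card_block_full (J B q : nat) : 0 < B -> q.+1 * B <= J ->
  #|[pred j : 'I_J | j %/ B == q]| = B.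
Proof.
move=> B0 qBJ; apply/eqP; rewrite eqn_leq; apply/andP; split.
  rewrite (@eq_card _ _ [pred j : 'I_J | (j + 0) %/ B == q]) ?card_block_le// => j.
  by rewrite !inE addn0.
have h (i : 'I_B) : q * B + i < J.
  by apply: leq_trans qBJ; rewrite mulSn addnC ltn_add2r.
pose f (i : 'I_B) : 'I_J := Ordinal (h i).
have fI : injective f by move=> i j [] /addnI ij; exact/val_inj.
rewrite -[leqLHS]card_ord -(card_codom fI); apply: subset_leq_card.
apply/fintype.subsetP => _ /codomP[i ->]; rewrite inE /=.
by rewrite divnMDl// divn_small// addn0.
Qed.

End blocks.

Section canonical_model.
Local Open Scope ereal_scope.
Context (R : realType).

(** The observations in a model that is driven by [J] independent
    increments with standard deviations [s], of which [N] fall between two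
    consecutive observations. *)
Definition observe (n J N : nat) (tau : R) (s : 'I_J -> R) (x : J.-tuple R)
    (e : n.-tuple R) : n.-tuple R :=
  [tuple (\sum_(j < J | (j < i.+1 * N)%N) s j * tnth x j + tau * tnth e i)%R
  | i < n].

Definition observe_law n J N tau (v : 'I_J -> R) (F : set (n.-tuple R)) :=
  \int[gauss R J]_x
    gauss R n [set e | F (observe N tau (fun j => Num.sqrt (v j)) x e)].

Lemma measurable_observe n J N tau (s : 'I_J -> R) :
  measurable_fun setT
    (fun p : J.-tuple R * n.-tuple R => observe N tau s p.1 p.2).
Proof.
apply: measurable_mktuple => i; apply: measurable_funD.
  under eq_fun do rewrite big_mkcond.
  apply: measurable_sum => j; case: (j < i.+1 * N)%N => //.
  apply: measurable_funM => //; exact: (measurableT_comp (measurable_tnth j)).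
apply: measurable_funM => //; exact: (measurableT_comp (measurable_tnth i)).
Qed.

Section adjacent.
Variables (n J N m : nat) (tau : R).
Hypotheses (N0 : (0 < N)%N) (m0 : (0 < m)%N) (tau0 : (0 < tau)%R).
Hypothesis nNJ : (n * N <= J)%N.
Local Notation B := (m * N)%N.
Local Notation p i := (i.+1 * N)%N.

Let B0 : (0 < B)%N. Proof. by rewrite muln_gt0 m0. Qed.

Let B0R : (0 < B%:R :> R)%R. Proof. by rewrite ltr0n. Qed.

Let same (j k : nat) : bool := (j %/ B == k %/ B)%N.

Let filled (i : 'I_n) (k : 'I_J) : R :=
  ((\sum_(j < J | (j < p i)%N && same j k) 1) / B%:R)%R.

(** A unit step of the signal at the increment [k] is realised in part by the
    increments of the block of [k], spread evenly over it, and in part by the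
    noise, which makes up for the difference inside the block. *)
Let beta (i : 'I_n) (k : 'I_J) : R := (((k < p i)%N%:R - filled i k) / tau)%R.

Let sum1_card_real (P : pred 'I_J) : (\sum_(j < J | P j) (1 : R) = #|P|%:R)%R.
Proof. by rewrite -sum1_card natr_sum. Qed.

Let card_same k : (#|[pred j : 'I_J | same j k]| <= B)%N.
Proof.
have := @card_block_le J 0 B (k %/ B) B0; congr (_ <= _)%N; apply: eq_card => j.
by rewrite !inE addn0.
Qed.

Let filled_ge0 i k : (0 <= filled i k)%R.
Proof. by rewrite /filled sum1_card_real divr_ge0. Qed.

Let filled_le1 i k : (filled i k <= 1)%R.
Proof.
rewrite /filled ler_pdivrMr// mul1r sum1_card_real ler_nat.
apply: leq_trans (card_same k); apply: subset_leq_card; apply/fintype.subsetP => j.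
by rewrite !inE => /andP[].
Qed.

Let p_leJ (i : 'I_n) : (p i <= J)%N.
Proof. by rewrite (leq_trans _ nNJ)// leq_mul2r ltn_ord orbT. Qed.

Let beta_supp (i : 'I_n) (k : 'I_J) : beta i k != 0%R -> (i.+1 %/ m == k %/ B)%N.
Proof.
rewrite -(divnMr N0); apply: contraNT; rewrite neq_ltn => /orP[pk|kp].
  have pB : (p i < k %/ B * B)%N by rewrite -ltn_divLR.
  have kp : (k < p i)%N = false.
    by apply/negbTE; rewrite -leqNgt (leq_trans (ltnW pB))// leq_divM.
  rewrite /beta /filled kp big_pred0 ?mul0r ?subr0 ?mul0r//= => j.
  apply/negP => /andP[jp /eqP jk].
  by move: (leq_ltn_trans (leq_divM j B) jp); rewrite jk ltnNge (ltnW pB).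
have pB : ((k %/ B).+1 * B <= p i)%N by rewrite -leq_divRL.
have kB : (k < (k %/ B).+1 * B)%N by rewrite -ltn_divLR.
rewrite /beta /filled (leq_trans kB pB) sum1_card_real.
rewrite (@eq_card _ _ [pred j : 'I_J | j %/ B == k %/ B]%N).
  by rewrite card_block_full// ?(leq_trans pB)// divff ?subrr ?mul0r// lt0r_neq0.
move=> j; rewrite !inE; apply/andb_idl => /eqP jk.
by rewrite (leq_trans _ pB)// -jk -ltn_divLR.
Qed.

Let beta_le i k : (`|beta i k| <= tau^-1)%R.
Proof.
rewrite /beta normrM [(`|tau^-1|)%R]gtr0_norm ?invr_gt0//.
apply: ler_piMl; first by rewrite invr_ge0 ltW.
have := filled_ge0 i k; have := filled_le1 i k => f1 f0.
by rewrite ler_norml; case: (k < p i)%N; rewrite /=; apply/andP; split; lra.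
Qed.

Section gram.
Variables (lo : R) (v0 : 'I_J -> R).
Hypotheses (lo0 : (0 < lo)%R) (lov : forall j, (lo <= v0 j)%R).

Let alpha (j k : 'I_J) : R := ((same j k)%:R / (B%:R * Num.sqrt (v0 j)))%R.

Let gram (j k : 'I_J) : R :=
  (\sum_j' alpha j' j * alpha j' k + \sum_i beta i j * beta i k)%R.

Let bound : R := ((B%:R * lo)^-1 + m%:R / tau ^+ 2)%R.

Let gram_off (j k : 'I_J) : ~~ same j k -> gram j k = 0%R.
Proof.
move=> njk; rewrite /gram big1 => [|j' _]; last first.
  rewrite /alpha; have [j'j|] := boolP (same j' j); last by rewrite !mul0r.
  have [j'k|] := boolP (same j' k); last by rewrite mulrC !mul0r.
  by move: njk; rewrite /same -(eqP j'j) (eqP j'k) eqxx.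
rewrite add0r big1// => i _.
have [->|/beta_supp/eqP ij] := eqVneq (beta i j) 0%R; first by rewrite mul0r.
have [->|/beta_supp/eqP ik] := eqVneq (beta i k) 0%R; first by rewrite mulr0.
by move: njk; rewrite /same -ij -ik eqxx.
Qed.

Let gram_le j k : (`|gram j k| <= bound)%R.
Proof.
have v00 j' : (0 < v0 j')%R by exact: lt_le_trans (lov j').
apply: (le_trans (ler_normD _ _)); apply: lerD.
  apply: (le_trans (ler_norm_sum _ _ _)).
  apply: (@le_trans _ _ (\sum_(j' < J | same j' j) (B%:R ^+ 2 * lo)^-1)%R).
    rewrite [leRHS]big_mkcond/=; apply: ler_sum => j' _; rewrite /alpha.
    case: ifP => j'j; last by rewrite !mul0r normr0.
    have a0 : (0 <= B%:R * Num.sqrt (v0 j'))%R by rewrite mulr_ge0// sqrtr_ge0.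
    rewrite ger0_norm; last by rewrite !mulr_ge0 ?invr_ge0.
    apply: (@le_trans _ _ ((B%:R * Num.sqrt (v0 j'))^-1 * (B%:R * Num.sqrt (v0 j'))^-1)%R).
      by rewrite mul1r ler_wpM2l ?invr_ge0// ler_piMl ?invr_ge0//; case: (same j' k).
    rewrite -invfM -expr2 exprMn sqr_sqrtr; last exact: ltW.
    rewrite lef_pV2 ?posrE ?mulr_gt0//.
    by rewrite ler_pM2l ?mulr_gt0.
  rewrite sumr_const -[leLHS]mulr_natl.
  have -> : ((B%:R ^+ 2 * lo)^-1 = B%:R^-1 * (B%:R * lo)^-1 :> R)%R.
    by rewrite expr2 -mulrA invfM.
  rewrite mulrA; apply: ler_piMl.
    by rewrite invr_ge0 mulr_ge0 ?(ltW lo0).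
  by rewrite ler_pdivrMr// mul1r ler_nat card_same.
apply: (le_trans (ler_norm_sum _ _ _)).
apply: (@le_trans _ _ (\sum_(i < n | ((i + 1) %/ m == j %/ B)%N) tau ^- 2)%R).
  rewrite [leRHS]big_mkcond/=; apply: ler_sum => i _; rewrite addn1.
  case: ifP => ij; last first.
    have [->|/beta_supp] := eqVneq (beta i j) 0%R; first by rewrite mul0r normr0.
    by rewrite ij.
  by rewrite normrM -exprVn expr2 ler_pM.
rewrite sumr_const -[leLHS]mulr_natl ler_wpM2r ?invr_ge0 ?sqr_ge0// ler_nat.
exact: card_block_le.
Qed.

Variables (v1 : 'I_J -> R) (del : R) (K : nat).
Hypotheses (v01 : forall j, (v0 j <= v1 j)%R).
Hypothesis (v1del : forall j, (v1 j - v0 j <= del)%R).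
Hypothesis (cardK : (#|[pred j | v0 j != v1 j]| <= K)%N).

Let root j := Num.sqrt (v1 j - v0 j).

(** The coordinates of [J + n] are the increments followed by the noise. *)
Let shift (d : 'I_(J + n)) (k : 'I_J) : R :=
  (root k * match fintype.split d with inl j => alpha j k | inr i => beta i k end)%R.

Let shift_gram j k :
  (\sum_d shift d j * shift d k = root j * root k * gram j k)%R.
Proof.
rewrite big_split_ord/= /gram mulrDr !mulr_sumr; congr (_ + _)%R.
  by apply: eq_bigr => j' _; rewrite /shift (unsplitK (inl _ j')); ring.
by apply: eq_bigr => i _; rewrite /shift (unsplitK (inr _ i)); ring.
Qed.

Let shift_sqr_le :
  (\sum_j \sum_k (\sum_d shift d j * shift d k) ^+ 2 <=
   K%:R * B%:R * del ^+ 2 * bound ^+ 2)%R.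
Proof.
have d0 j : (0 <= v1 j - v0 j)%R by rewrite subr_ge0.
have b0 : (0 <= bound)%R.
  by rewrite addr_ge0//; [rewrite invr_ge0 mulr_ge0// ltW|rewrite divr_ge0// sqr_ge0].
apply: (@le_trans _ _ (\sum_j (v1 j - v0 j) * (B%:R * (del * bound ^+ 2)))%R).
  apply: ler_sum => j _.
  apply: (@le_trans _ _ (\sum_(k < J | same k j) (v1 j - v0 j) * (del * bound ^+ 2))%R).
    rewrite [leRHS]big_mkcond/=; apply: ler_sum => k _; rewrite shift_gram.
    case: ifPn => kj; last first.
      by rewrite gram_off ?mulr0 ?expr0n// /same eq_sym.
    rewrite !exprMn !sqr_sqrtr// -mulrA ler_wpM2l//.
    apply: ler_pM => //; first exact: sqr_ge0.
    by rewrite -[(gram j k ^+ 2)%R]real_normK ?num_real// ler_sqr ?nnegrE// gram_le.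
  rewrite sumr_const -[leLHS]mulr_natl mulrCA ler_wpM2l// ler_wpM2r ?ler_nat ?card_same//.
  by rewrite mulr_ge0 ?sqr_ge0// (le_trans (d0 j)).
rewrite -mulr_suml.
have [J0|J0] := posnP J.
  rewrite big1 ?mul0r; last by move=> j; have := ltn_ord j; rewrite {2}J0.
  by rewrite mulr_ge0 ?sqr_ge0// mulr_ge0 ?sqr_ge0.
have del0 : (0 <= del)%R by exact: le_trans (v1del (Ordinal J0)).
have -> : (K%:R * B%:R * del ^+ 2 * bound ^+ 2 =
  K%:R * del * (B%:R * (del * bound ^+ 2)))%R by ring.
apply: ler_wpM2r; first by rewrite mulr_ge0// mulr_ge0 ?sqr_ge0.
rewrite (bigID [pred j | v0 j != v1 j])/= [X in (_ + X)%R]big1 ?addr0; last first.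
  by move=> j; rewrite negbK => /eqP ->; rewrite subrr.
apply: (@le_trans _ _ (\sum_(j < J | v0 j != v1 j) del)%R); first exact: ler_sum.
by rewrite sumr_const -[leLHS]mulr_natl ler_wpM2r// ler_nat.
Qed.

Let obs_cat (s : 'I_J -> R) (z : (J + n).-tuple R) : n.-tuple R :=
  [tuple (\sum_(j < J | (j < p i)%N) s j * tnth z (lshift n j) +
          tau * tnth z (rshift J i))%R | i < n].

Let obs_catE s (x : J.-tuple R) (e : n.-tuple R) : obs_cat s [tuple of x ++ e] = observe N tau s x e.
Proof.
apply: eq_mktuple => i; rewrite tnth_rshift; congr (_ + _)%R.
by apply: eq_bigr => j _; rewrite tnth_lshift.
Qed.

Let measurable_obs_cat s : measurable_fun setT (obs_cat s).
Proof.
apply: measurable_mktuple => i; apply: measurable_funD.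
  under eq_fun do rewrite big_mkcond.
  apply: measurable_sum => j; case: (j < p i)%N => //.
  by apply: measurable_funM => //; exact: measurable_tnth.
by apply: measurable_funM => //; exact: measurable_tnth.
Qed.

Let sd0 j := Num.sqrt (v0 j).

Let obs_cat_shift z (w : J.-tuple R) :
  obs_cat sd0 [tuple (tnth z d + \sum_k shift d k * tnth w k)%R | d < J + n] =
  [tuple (tnth (obs_cat sd0 z) i +
     \sum_(k < J | (k < p i)%N) root k * tnth w k)%R | i < n].
Proof.
apply: eq_mktuple => i; rewrite !tnth_mktuple.
under eq_bigr do rewrite tnth_mktuple mulrDr.
rewrite big_split/= mulrDr addrACA; congr (_ + _)%R.
under eq_bigr do rewrite mulr_sumr.
rewrite exchange_big/= mulr_sumr -big_split/= [RHS]big_mkcond/=.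
apply: eq_bigr => k _; rewrite /shift (unsplitK (inr _ i)).
transitivity (root k * tnth w k * (filled i k + tau * beta i k))%R.
  rewrite mulrDr; congr (_ + _)%R; last by ring.
  rewrite /filled mulr_suml mulr_sumr big_mkcondr/=.
  apply: eq_bigr => j _; rewrite (unsplitK (inl _ j)) /alpha.
  have s0 : sd0 j != 0%R.
    by rewrite sqrtr_eq0 -ltNge (lt_le_trans lo0).
  case: (same j k); last by rewrite !mul0r !mulr0 mul0r !mulr0.
  rewrite -/(sd0 j) mulr1n; move: (lt0r_neq0 B0R) s0.
  by move: (B%:R)%R (sd0 j) => b q b0 q0; field; rewrite b0.
rewrite /beta mulrCA divff ?lt0r_neq0// mulr1 addrC subrK.
by case: (k < p i)%N; rewrite ?mulr1 ?mulr0.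
Qed.

(** Adding the independent variances [v1 - v0] to the increments amounts to
    adding an independent Gaussian path to the signal, which is in turn a
    random shift of the increments and of the noise. *)
Lemma observe_law_tv (e : R) (F : set (n.-tuple R)) :
  (K%:R * B%:R * del ^+ 2 * bound ^+ 2 <= 2^-1)%R -> (0 <= e)%R ->
  (K%:R * B%:R * del ^+ 2 * bound ^+ 2 <= e ^+ 2)%R -> measurable F ->
  observe_law N tau v0 F <= observe_law N tau v1 F + e%:E /\
  observe_law N tau v1 F <= observe_law N tau v0 F + e%:E.
Proof.
move=> t1 e0 te mF.
have mF' : measurable [set z | F (obs_cat sd0 z)].
  by rewrite -[X in measurable X]setTI; exact: measurable_obs_cat.
have mFi : measurable_fun setT (fun y : n.-tuple R => (\1_F y)%:E : \bar R).
  by apply/measurable_EFinP; exact: measurable_indic.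
have ind0 y : 0 <= (\1_F y)%:E :> \bar R by rewrite lee_fin.
have mobs s := @measurable_observe n J N tau s.
have law0 : observe_law N tau v0 F = gauss R (J + n) [set z | F (obs_cat sd0 z)].
  rewrite (integral_preimage _ (measurable_obs_cat sd0) mF).
  rewrite (gauss_cat (measurableT_comp mFi (measurable_obs_cat sd0)) (fun=> ind0 _)).
  apply: eq_integral => x _.
  have mx := measurableT_comp (mobs sd0) (pair1_measurable x).
  rewrite (integral_preimage _ mx mF); apply: eq_integral => e' _.
  by rewrite /= obs_catE.
have law1 : observe_law N tau v1 F = \int[gauss R J]_w gauss R (J + n)
    [set z | F (obs_cat sd0 [tuple (tnth z d + \sum_k shift d k * tnth w k)%R | d < J + n])].
  pose s1 j := Num.sqrt (v1 j).
  pose H (x : J.-tuple R) := gauss R n [set e | F (observe N tau s1 x e)].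
  have v1p j : (0 < v1 j)%R.
    by rewrite (lt_le_trans _ (v01 j))// (lt_le_trans lo0).
  have s1p j : (0 < s1 j)%R by rewrite sqrtr_gt0.
  have HE x : H x = \int[gauss R n]_e (\1_F (observe N tau s1 x e))%:E.
    have mx := measurableT_comp (mobs s1) (pair1_measurable x).
    exact: (integral_preimage _ mx mF).
  have mF2 := measurableT_comp mFi (mobs s1).
  have mH : measurable_fun setT H.
    apply: (eq_measurable_fun (fun x => \int[gauss R n]_e (\1_F (observe N tau s1 x e))%:E)).
      by move=> x _; rewrite HE.
    exact: (measurable_fun_fubini_tonelli_F (m2 := gauss R n) _ mF2 (fun=> ind0 _)).
  (* an increment of variance [v1 j] is split into independent increments of
     variances [v0 j] and [v1 j - v0 j] *)
  pose c j := (sd0 j / s1 j)%R; pose r j := (root j / s1 j)%R.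
  have c0 j : (0 < c j)%R by rewrite divr_gt0// sqrtr_gt0 (lt_le_trans lo0).
  have r0 j : (0 <= r j)%R by rewrite divr_ge0 ?sqrtr_ge0// ltW.
  have cr j : (c j ^+ 2 + r j ^+ 2 = 1)%R.
    rewrite !exprMn -mulrDl !sqr_sqrtr ?subr_ge0//; last by rewrite (le_trans (ltW lo0)).
    by rewrite addrC subrK exprVn sqr_sqrtr ?ltW// divff// lt0r_neq0.
  rewrite -[LHS]/(\int[gauss R J]_x H x).
  rewrite -(gauss_rotation_swap c0 r0 cr mH); last by move=> x; exact: measure_ge0.
  apply: eq_integral => w _.
  pose V (y : n.-tuple R) := [tuple (tnth y i +
     \sum_(k < J | (k < p i)%N) root k * tnth w k)%R | i < n].
  have mV : measurable_fun setT V by exact: measurable_shift.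
  have mVo := measurableT_comp mV (measurable_obs_cat sd0).
  transitivity (gauss R (J + n) [set z | F (V (obs_cat sd0 z))]); last first.
    by congr (gauss R (J + n) _); apply/seteqP; split=> z /=; rewrite obs_cat_shift.
  rewrite (integral_preimage _ mVo mF).
  rewrite (gauss_cat (measurableT_comp mFi mVo) (fun=> ind0 _)).
  apply: eq_integral => u _; rewrite HE; apply: eq_integral => e' _ /=.
  rewrite obs_catE; congr (\1_F _)%:E.
  apply: eq_mktuple => i; rewrite tnth_mktuple addrAC; congr (_ + _)%R.
  rewrite -big_split/=; apply: eq_bigr => j _; rewrite tnth_mktuple /c /r -/(sd0 j).
  by field; rewrite lt0r_neq0.
rewrite law0 law1.
apply: (gauss_mixture_tv _ e0 _ mF').
  exact: le_trans shift_sqr_le t1.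
exact: le_trans shift_sqr_le te.
Qed.

End gram.

End adjacent.

End canonical_model.

(** * Laws of random elements and Brownian increments *)

Section transfer.
Local Open Scope ereal_scope.
Context (R : realType) d (T : measurableType d) (P : probability T R).

Lemma measurable_preimage d' (T' : measurableType d') (f : T -> T') (F : set T') :
  measurable_fun setT f -> measurable F -> measurable [set w | F (f w)].
Proof. by move=> mf mF; rewrite -[X in measurable X]setTI; exact: mf. Qed.

Section image_law.
Context d' (T' : measurableType d') (X : T -> T').
Hypothesis mX : measurable_fun setT X.

Definition law_of (f : T -> T') : measurable_fun setT f -> probability T' R :=
  fun mf => distribution P (HB.pack_for {mfun T >-> T'} f
    (isMeasurableFun.Build _ _ _ _ f mf)).

Lemma law_ofE F : law_of mX F = P [set w | F (X w)].
Proof. by []. Qed.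

Lemma integral_law_of (f : T' -> \bar R) : measurable_fun setT f ->
  (forall x, 0 <= f x) -> \int[law_of mX]_x f x = \int[P]_w f (X w).
Proof. by move=> mf f0; rewrite ge0_integral_distribution. Qed.

End image_law.

Definition tv_close d' (T' : measurableType d') (X Y : T -> T') (e : R) :=
  tvle (fun F => P [set w | F (X w)]) (fun F => P [set w | F (Y w)]) e.

Lemma tv_close_sym d' (T' : measurableType d') (X Y : T -> T') e :
  measurable_fun setT X -> measurable_fun setT Y ->
  tv_close X Y e -> tv_close Y X e.
Proof.
move=> mX mY XY F mF.
exact: (@tvle_sym _ _ _ (law_of mX) (law_of mY) e XY F mF).
Qed.

Lemma tv_close_trans d' (T' : measurableType d') (Y X Z : T -> T') e1 e2 :
  tv_close X Y e1 -> tv_close Y Z e2 -> tv_close X Z (e1 + e2)%R.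
Proof. exact: tvle_trans. Qed.

Lemma tv_close_ae d' (T' : measurableType d') (X Y : T -> T') :
  measurable_fun setT X -> measurable_fun setT Y ->
  {ae P, forall w, X w = Y w} -> tv_close X Y 0.
Proof.
move=> mX mY XY F mF; rewrite adde0 -!(law_ofE mX) -!(law_ofE mY).
have mI Z (mZ : measurable_fun setT Z) :
    law_of mZ F = \int[P]_w (\1_F (Z w) : R)%:E.
  exact: (integral_preimage P mZ mF).
have mindic : measurable_fun setT (fun y : T' => (\1_F y : R)%:E).
  by apply/measurable_EFinP; exact: measurable_indic.
rewrite !mI le_eqVlt; apply/orP; left; apply/eqP.
apply: ae_eq_integral => //.
- exact: (measurableT_comp mindic mX).
- exact: (measurableT_comp mindic mY).
- by apply: filterS XY => w -> _.
Qed.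

Lemma iid_law n (X : 'I_n -> T -> R) : (forall i, measurable_fun setT (X i)) ->
  (forall i A, measurable A -> P [set w | A (X i w)] = gauss1 R A) ->
  mutually_independent P X ->
  forall F, measurable F -> P [set w | F [tuple X i w | i < n]] = gauss R n F.
Proof.
move=> mX nX iX F mF.
have mXt : measurable_fun setT (fun w => [tuple X i w | i < n]).
  exact: measurable_mktuple.
apply: (gauss_unique (m := law_of mXt)) => // B mB.
transitivity (P (\bigcap_i [set w | B i (X i w)])).
  congr (P _); apply/seteqP; split=> [w Bw i _|w Bw i].
    by have := Bw i; rewrite tnth_mktuple.
  by rewrite tnth_mktuple; exact: Bw.
by rewrite (iX B mB); apply: eq_bigr => i _; exact: nX.
Qed.

(** The law of the pair is the product of the laws. *)
Lemma independent_pair d' (T' : measurableType d') n (U : T -> T')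
    (E : T -> n.-tuple R) (F : set (T' * n.-tuple R)) :
  measurable_fun setT U -> measurable_fun setT E ->
  (forall A, measurable A -> P [set w | A (E w)] = gauss R n A) ->
  (forall A C, measurable A -> measurable C ->
     P ([set w | A (U w)] `&` [set w | C (E w)]) =
     P [set w | A (U w)] * P [set w | C (E w)]) ->
  measurable F ->
  P [set w | F (U w, E w)] = \int[P]_w gauss R n [set e | F (U w, e)].
Proof.
move=> mU mE lE indep mF.
have mUE : measurable_fun setT (fun w => (U w, E w)) by exact: measurable_fun_pair.
transitivity (law_of mUE F); first by [].
transitivity ((law_of mU \x gauss R n) F).
  apply/esym; apply: (product_measure_unique (m' := law_of mUE)) => // A C mA mC.
  rewrite -[LHS]/(P ([set w | A (U w)] `&` [set w | C (E w)])) indep//.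
  by congr (_ * _); exact: lE.
rewrite /product_measure1 integral_law_of//.
- apply: eq_integral => w _ /=; congr (gauss R n _).
  by rewrite /xsection; apply/seteqP; split=> e /=; rewrite inE.
- exact: measurable_fun_xsection.
Qed.

End transfer.

Section brownian.
Local Open Scope ereal_scope.
Context (R : realType) d (T : measurableType d) (P : probability T R).
Variable W : R -> {RV P >-> R}.
Hypothesis bm : brownian_motion01 W.

Definition increment (t : nat -> R) (i : nat) (w : T) : R :=
  ((W (t i.+1) w - W (t i) w) / Num.sqrt (t i.+1 - t i))%R.

Lemma measurable_increment t i : measurable_fun setT (increment t i).
Proof. by apply: measurable_funM => //; exact: measurable_funB. Qed.

Lemma increments_law m (t : nat -> R) :
  {homo t : i j / (i <= j)%N >-> (i <= j)%R} ->
  (forall i, (i < m)%N -> (t i < t i.+1)%R) -> (0 <= t 0%N)%R -> (t m <= 1)%R ->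
  forall F, measurable F ->
  P [set w | F [tuple increment t i w | i < m]] = gauss R m F.
Proof.
move=> t_nd t_incr t0 tm.
have [_ normW indepW _] := bm.
have sd0 (i : 'I_m) : (0 < Num.sqrt (t i.+1 - t i))%R.
  by rewrite sqrtr_gt0 subr_gt0 t_incr.
have mscale (i : 'I_m) (A : set R) : measurable A ->
    measurable [set y : R | A (y / Num.sqrt (t i.+1 - t i))%R].
  move=> mA; rewrite -[X in measurable X]setTI.
  exact: (measurable_funM (@measurable_id _ _ _) (measurable_cst _)).
apply: (iid_law (X := fun (i : 'I_m) w => increment t i w)).
- by move=> i; exact: measurable_increment.
- move=> i A mA.
  have := normW (t i) (t i.+1); rewrite /is_normal => h.
  have ti0 : (0 <= t i)%R by rewrite (le_trans t0)// t_nd.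
  have ti1 : (t i.+1 <= 1)%R by rewrite (le_trans _ tm)// t_nd.
  have := h ti0 (t_incr i (ltn_ord i)) ti1 _ (mscale i A mA).
  rewrite gauss1_scale//; last exact: mscale.
  rewrite /pushforward => e.
  transitivity (P ((W (t i.+1) \- W (t i))%R @^-1`
      [set y : R | A (y / Num.sqrt (t i.+1 - t i))%R])); first by [].
  rewrite e; congr (gauss1 R _); apply/seteqP; split=> x /=.
    by rewrite mulrAC divff ?mul1r// lt0r_neq0.
  by rewrite mulrAC divff ?mul1r// lt0r_neq0.
- move=> B mB.
  exact: (indepW m t t_nd t0 tm (fun i => [set y : R | B i (y / Num.sqrt (t i.+1 - t i))%R])
    (fun i => mscale i _ (mB i))).
Qed.

End brownian.

(** * Noise that is independent of the path *)

Section noisy_observation.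
Local Open Scope ereal_scope.
Context (R : realType) d (T : measurableType d) (P : probability T R).
Variables (W : R -> {RV P >-> R}) (n : nat) (eps : 'I_n -> {RV P >-> R}).
Hypothesis bm : brownian_motion01 W.
Hypothesis eps_normal : forall i, is_normal P (eps i) 0 1.
Hypothesis eps_indep : mutually_independent P (fun i => eps i).
Hypothesis W_eps : independent_systems P (sigma_generated `[0%R, 1%R] (fun t => W t))
  (sigma_generated setT (fun i => eps i)).

(** A measurable function on this space is a function of the path, hence
    independent of the noise. *)
Definition path_space : measurableType _ :=
  g_sigma_algebraType
    (\bigcup_(t in `[0%R, 1%R]) preimage_set_system setT (W t) measurable).

Let noise_space : measurableType _ :=
  g_sigma_algebraType
    (\bigcup_(i in [set: 'I_n]) preimage_set_system setT (eps i) measurable).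

Let noise (w : T) : n.-tuple R := [tuple eps i w | i < n].

Let measurable_noise : measurable_fun setT noise.
Proof. by apply: measurable_mktuple. Qed.

Let noise_event C : measurable C ->
  sigma_generated setT (fun i => eps i) [set w | C (noise w)].
Proof.
move=> mC.
have : measurable_fun (T := noise_space) setT (noise : noise_space -> _).
  apply: measurable_mktuple => i _ A mA; apply: sub_sigma_algebra.
  by exists i => //; exists A.
by move=> /(_ measurableT _ mC); rewrite setTI.
Qed.

Lemma path_measurable t : t \in `[0%R, 1%R] ->
  measurable_fun (T := path_space) setT (W t : path_space -> R).
Proof.
move=> t01 _ A mA; apply: sub_sigma_algebra.
by exists t => //; exists A.
Qed.

Lemma path_measurableW d' (T' : measurableType d') (U : T -> T') :
  measurable_fun (T := path_space) setT (U : path_space -> T') ->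
  measurable_fun setT U.
Proof.
move=> mU _ A mA; have := mU measurableT A mA.
move: (setT `&` _) => B; apply: smallest_sub; first exact: sigma_algebra_measurable.
by move=> _ [t _ [C mC <-]]; exact: measurable_funP.
Qed.

Lemma noise_pair d' (T' : measurableType d') (U : T -> T')
    (F : set (T' * n.-tuple R)) :
  measurable_fun (T := path_space) setT (U : path_space -> T') ->
  measurable F ->
  P [set w | F (U w, [tuple eps i w | i < n])] =
  \int[P]_w gauss R n [set e | F (U w, e)].
Proof.
move=> mU mF; apply: independent_pair => //.
- exact: path_measurableW.
- by apply: iid_law => // i A mA; exact: eps_normal.
- move=> A C mA mC; apply: W_eps; last exact: noise_event.
  by have := mU measurableT A mA; rewrite setTI.
Qed.

Section perturbation.
Variables (tau : R) (U V : T -> n.-tuple R).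
Hypotheses (tau0 : (0 < tau)%R).
Hypotheses (mU : measurable_fun (T := path_space) setT (U : path_space -> _)).
Hypotheses (mV : measurable_fun (T := path_space) setT (V : path_space -> _)).

Let noisy (p : n.-tuple R * n.-tuple R) : n.-tuple R :=
  [tuple (tnth p.1 i + tau * tnth p.2 i)%R | i < n].

Let measurable_noisy : measurable_fun setT noisy.
Proof.
apply: measurable_mktuple => i; apply: measurable_funD.
  exact: (measurableT_comp (measurable_tnth i)).
by apply: measurable_funM => //; exact: (measurableT_comp (measurable_tnth i)).
Qed.

Let noisy_event (Z : T -> n.-tuple R) F : measurable F ->
  measurable_fun (T := path_space) setT (Z : path_space -> _) ->
  P [set w | F [tuple (tnth (Z w) i + tau * eps i w)%R | i < n]] =
  \int[P]_w gauss R n [set e | F (noisy (Z w, e))].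
Proof.
move=> mF mZ.
have mF' : measurable [set p | F (noisy p)].
  by rewrite -[X in measurable X]setTI; exact: measurable_noisy.
rewrite -(noise_pair mZ mF'); congr (P _); apply/seteqP; split=> w /=.
  rewrite (_ : noisy _ = [tuple (tnth (Z w) i + tau * eps i w)%R | i < n])//.
  by apply: eq_mktuple => i; rewrite tnth_mktuple.
rewrite (_ : noisy _ = [tuple (tnth (Z w) i + tau * eps i w)%R | i < n])//.
by apply: eq_mktuple => i; rewrite tnth_mktuple.
Qed.

(** For each path the two observations differ by a deterministic shift of the
    noise; [gauss_shift_tv] is averaged over the path, and the mean of its bound
    involves the signals only through their mean square distance. *)
Lemma noisy_tv (eta s : R) : (0 < eta)%R ->
  (forall i, \int[P]_w ((tnth (U w) i - tnth (V w) i) ^+ 2)%:E <= s%:E) ->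
  tv_close P (fun w => [tuple (tnth (U w) i + tau * eps i w)%R | i < n])
    (fun w => [tuple (tnth (V w) i + tau * eps i w)%R | i < n])
    (eta / 2 + (gauss_m2 R / eta + 1) / 2 * (n%:R * (s / tau ^+ 2))).
Proof.
move=> eta0 Us F mF; rewrite !noisy_event//.
have mU' := path_measurableW mU; have mV' := path_measurableW mV.
pose D w := (\sum_(i < n) (tnth (U w) i - tnth (V w) i) ^+ 2)%R.
pose k := ((gauss_m2 R / eta + 1) / 2)%R.
have k0 : (0 <= k)%R by rewrite divr_ge0// addr_ge0// divr_ge0 ?gauss_m2_ge0// ltW.
have mdi i : measurable_fun setT (fun w => ((tnth (U w) i - tnth (V w) i) ^+ 2)%:E).
  apply/measurable_EFinP/measurable_funX/measurable_funB.
    exact: (measurableT_comp (measurable_tnth i)).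
  exact: (measurableT_comp (measurable_tnth i)).
have mD : measurable_fun setT (fun w => (D w)%:E).
  by apply/measurable_EFinP/measurable_sum => i; apply/measurable_EFinP; exact: mdi.
have D0 w : (0 <= D w)%R by apply: sumr_ge0 => i _; exact: sqr_ge0.
have ID : \int[P]_w (D w)%:E <= (n%:R * s)%:E.
  under eq_integral do rewrite -sumEFin.
  rewrite ge0_integral_sum//; last by move=> i w _; rewrite lee_fin sqr_ge0.
  apply: (@le_trans _ _ (\sum_(i < n) s%:E)); first exact: lee_sum.
  by rewrite sumEFin sumr_const card_ord mulr_natl.
have mg (Z : T -> n.-tuple R) : measurable_fun setT Z ->
    measurable_fun setT (fun w => gauss R n [set e | F (noisy (Z w, e))]).
  move=> mZ.
  have mF' : measurable [set p | F (noisy p)].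
    by rewrite -[X in measurable X]setTI; exact: measurable_noisy.
  apply: (eq_measurable_fun (fun w => (gauss R n \o xsection [set p | F (noisy p)]) (Z w))).
    move=> w _ /=; congr (gauss R n _).
    by rewrite /xsection; apply/seteqP; split=> e /=; rewrite inE.
  exact: (measurableT_comp (measurable_fun_xsection _ mF') mZ).
pose c := (k / tau ^+ 2)%R.
have c0 : (0 <= c)%R by rewrite divr_ge0// sqr_ge0.
apply: (@le_trans _ _ (\int[P]_w (gauss R n [set e | F (noisy (V w, e))] +
    ((eta / 2)%:E + c%:E * (D w)%:E)))).
  apply: ge0_le_integral => //.
  - exact: mg.
  - apply: emeasurable_funD; first exact: mg.
    by apply: emeasurable_funD => //; exact: emeasurable_funM.
  - move=> w _.
    pose m i := ((tnth (V w) i - tnth (U w) i) / tau)%R.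
    have mFw : measurable [set e | F (noisy (U w, e))].
      rewrite -[X in measurable X]setTI.
      exact: (measurableT_comp measurable_noisy (pair1_measurable (U w))).
    apply: (le_trans (gauss_shift_tv m eta0 mFw)); apply: leeD.
      rewrite le_eqVlt; apply/orP; left; apply/eqP; congr (gauss R n _).
      have e1 e : noisy (U w, [tuple (tnth e i + m i)%R | i < n]) = noisy (V w, e).
        by apply: eq_mktuple => i; rewrite /= tnth_mktuple /m; field; exact: lt0r_neq0.
      by apply/seteqP; split=> e /=; rewrite e1.
    rewrite -EFinM -EFinD lee_fin lerD2l -/k /c.
    have -> : (\sum_(i < n) m i ^+ 2 = D w / tau ^+ 2)%R.
      rewrite /D mulr_suml; apply: eq_bigr => i _; rewrite /m.
      by field; exact: lt0r_neq0.
    by rewrite [leRHS]mulrAC mulrA.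
have mcD : measurable_fun setT (fun w => c%:E * (D w)%:E).
  exact: (emeasurable_funM (measurable_cst _) mD).
have cD0 w : 0 <= c%:E * (D w)%:E by rewrite mule_ge0// lee_fin.
have e20 : 0 <= (eta / 2)%:E by rewrite lee_fin divr_ge0// ltW.
rewrite (ge0_integralD _ measurableT _ (mg _ mV')) => //; last 2 first.
- by move=> w _; exact: adde_ge0.
- exact: (emeasurable_funD (measurable_cst _) mcD).
apply: leeD => //.
rewrite (ge0_integralD _ measurableT (fun _ _ => e20) (measurable_cst _) (fun _ _ => cD0 _) mcD).
rewrite integral_prob_cst (ge0_integralZl _ measurableT mD (fun _ _ => D0 _)) ?lee_fin//.
rewrite EFinD; apply: leeD => //.
apply: (@le_trans _ _ (c%:E * (n%:R * s)%:E)).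
  by apply: lee_wpmul2l => //; rewrite lee_fin.
rewrite -EFinM lee_fin -/k /c.
by rewrite [leRHS](_ : _ = k / tau ^+ 2 * (n%:R * s))%R //; field; exact: lt0r_neq0.
Qed.

End perturbation.

(** With standardised increments in place of its Gaussian input, the model of
    [observe] is the one of the observations of a step volatility. *)
Lemma observe_increments N J (tau : R) (t : nat -> R) (v : 'I_J -> R) F :
  {homo t : i j / (i <= j)%N >-> (i <= j)%R} ->
  (forall i, (i < J)%N -> (t i < t i.+1)%R) -> (0 <= t 0%N)%R -> (t J <= 1)%R ->
  measurable F ->
  P [set w | F [tuple (\sum_(j < J | (j < i.+1 * N)%N)
       Num.sqrt (v j) * increment W t j w + tau * eps i w)%R | i < n]] =
  observe_law N tau v F.
Proof.
move=> t_nd t_incr t0 tJ mF.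
pose U w := [tuple increment W t j w | j < J].
have t01 j : (j <= J)%N -> (t j \in `[0%R, 1%R]).
  by move=> jJ; rewrite in_itv/= (le_trans t0 (t_nd _ _ (leq0n _))) (le_trans (t_nd _ _ jJ)).
have mU : measurable_fun (T := path_space) setT (U : path_space -> _).
  apply: measurable_mktuple => j; apply: measurable_funM => //.
  by apply: measurable_funB; apply: path_measurable; apply: t01 => //; exact: ltnW.
pose s j := Num.sqrt (v j).
have mob := @measurable_observe R n J N tau s.
have mF' : measurable [set p : J.-tuple R * n.-tuple R | F (observe N tau s p.1 p.2)].
  by rewrite -[X in measurable X]setTI; exact: mob.
transitivity (P [set w | F (observe N tau s (U w) [tuple eps i w | i < n])]).
  congr (P _); apply/seteqP; split=> w /=; congr F; apply: eq_mktuple => i.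
    rewrite tnth_mktuple; congr (_ + _)%R; apply: eq_bigr => j _.
    by rewrite tnth_mktuple.
  rewrite tnth_mktuple; congr (_ + _)%R; apply: eq_bigr => j _.
  by rewrite tnth_mktuple.
rewrite (noise_pair mU mF').
have mUT := path_measurableW mU.
pose g x := gauss R n [set e | F (observe N tau s x e)].
have mg : measurable_fun setT g.
  apply: (eq_measurable_fun (gauss R n \o xsection
      [set p : J.-tuple R * n.-tuple R | F (observe N tau s p.1 p.2)])).
    move=> x _ /=; congr (gauss R n _).
    by rewrite /xsection; apply/seteqP; split=> e /=; rewrite inE.
  exact: (measurable_fun_xsection _ mF').
rewrite -[LHS]/(\int[P]_w g (U w)) -(integral_law_of P mUT mg)//.
apply: eq_measure_integral => A mA _.
exact: (increments_law bm).
Qed.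

End noisy_observation.

(** * The product model as an adaptive shift of a random walk *)

Section product_model_tv.
Local Open Scope ereal_scope.
Context (R : realType).

Lemma gauss_swap J n (G : set (J.-tuple R * n.-tuple R)) : measurable G ->
  \int[gauss R J]_x gauss R n [set e | G (x, e)] =
  \int[gauss R n]_e gauss R J [set x | G (x, e)].
Proof.
move=> mG.
have mI : measurable_fun setT (fun p : J.-tuple R * n.-tuple R => (\1_G p : R)%:E).
  by apply/measurable_EFinP; exact: measurable_indic.
transitivity (\int[gauss R J]_x \int[gauss R n]_e (\1_G (x, e) : R)%:E).
  apply: eq_integral => x _.
  exact: (integral_preimage _ (pair1_measurable x) mG).
rewrite (fubini_tonelli (m1 := gauss R J) (m2 := gauss R n) _ mI); last first.
  by move=> p; rewrite lee_fin.
apply: eq_integral => e _; apply/esym.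
exact: (integral_preimage _ (pair2_measurable e) mG).
Qed.

(** A feedback with these coefficients turns a random walk multiplied by [g]
    into the walk whose increments are multiplied by [g]. *)
Lemma feedback_walk (g : nat -> R) k a (s : seq R) i :
  (forall k, 0 < g k)%R -> (i < size s)%N ->
  (g (k + i).+1 * (a + \sum_(j < i.+1)
      nth 0 (feedback (fun k => g k / g k.+1 - 1) k a s) j) =
   g k * a + \sum_(j < i.+1) g (k + j).+1 * nth 0 s j)%R.
Proof.
move=> g0; have gn0 j : g j != 0%R by exact: lt0r_neq0.
elim: s k a i => //= x s IH k a [|i] is_.
  by rewrite addn0 !big_ord1/= addn0; field.
rewrite big_ord_recl/= addrA [in RHS]big_ord_recl/= addn0 -addSnnS IH//.
rewrite [RHS]addrA; congr (_ + _)%R; first by field.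
by apply: eq_bigr => j _; rewrite /bump/= add1n -addSnnS.
Qed.

Context d (T : measurableType d) (P : probability T R).
Variables (W : R -> {RV P >-> R}) (n : nat) (eps : 'I_n -> {RV P >-> R}).
Hypothesis bm : brownian_motion01 W.
Hypothesis eps_normal : forall i, is_normal P (eps i) 0 1.
Hypothesis eps_indep : mutually_independent P (fun i => eps i).
Hypothesis W_eps : independent_systems P (sigma_generated `[0%R, 1%R] (fun t => W t))
  (sigma_generated setT (fun i => eps i)).
Hypothesis n0 : (0 < n)%N.
Variables (tau : R) (sg : R -> R).
Hypothesis sg0 : forall x, x \in `[0%R, 1%R] -> (0 < sg x)%R.

Let grid (j : nat) : R := (j%:R / n%:R)%R.

Let grid_nd : {homo grid : i j / (i <= j)%N >-> (i <= j)%R}.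
Proof. by move=> i j ij; rewrite /grid ler_wpM2r ?invr_ge0// ler_nat. Qed.

Let n0R : (0 < n%:R :> R)%R. Proof. by rewrite ltr0n. Qed.

Let grid_step j : (grid j.+1 - grid j = n%:R^-1)%R.
Proof. by rewrite /grid -mulrBl -natr1 addrC addKr mul1r. Qed.

Let grid_incr j : (j < n)%N -> (grid j < grid j.+1)%R.
Proof. by move=> _; rewrite -subr_gt0 grid_step invr_gt0. Qed.

Let grid0 : grid 0 = 0%R. Proof. by rewrite /grid mul0r. Qed.

Let gridn : grid n = 1%R. Proof. by rewrite /grid divff// lt0r_neq0. Qed.

Let grid01 j : (j <= n)%N -> grid j \in `[0%R, 1%R].
Proof.
move=> jn; have := grid_nd jn; have := grid_nd (leq0n j).
by rewrite grid0 gridn in_itv/= => -> ->.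
Qed.

Let xi (w : T) : n.-tuple R := [tuple increment W grid j w | j < n].

Let g (k : nat) : R := sg (grid (minn k n)).

Let g0 k : (0 < g k)%R.
Proof. by apply/sg0/grid01; exact: geq_minr. Qed.

Let c (k : nat) : R := (g k / g k.+1 - 1)%R.

Let r : R := Num.sqrt n%:R^-1.

Let prod_obs (p : n.-tuple R * n.-tuple R) : n.-tuple R :=
  [tuple (g i.+1 * (0 + \sum_(j < i.+1) nth 0 p.1 j) * r + tau * tnth p.2 i)%R | i < n].

Let step_obs (p : n.-tuple R * n.-tuple R) : n.-tuple R :=
  observe 1 tau (fun j : 'I_n => Num.sqrt (g j.+1 ^+ 2 / n%:R)) p.1 p.2.

Let step_prod x e :
  step_obs (x, e) = prod_obs ([tuple nth 0%R (feedback c 0 0 x) i | i < n], e).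
Proof.
apply: eq_mktuple => i; congr (_ + _)%R => /=.
have e1 : (g i.+1 * (0 + \sum_(j < i.+1) nth 0 (feedback c 0 0 x) j) =
    \sum_(j < i.+1) g (0 + j).+1 * nth 0 x j)%R.
  rewrite -{1}[i : nat]add0n feedback_walk// ?size_tuple// mulr0.
  by rewrite [LHS]add0r.
transitivity ((\sum_(j < i.+1) g (0 + j).+1 * nth 0 x j) * r)%R.
  rewrite muln1 (big_ord_widen_cond _ (fun=> true) (fun j => g (0 + j).+1 * nth 0 x j)%R (ltn_ord i)).
  rewrite mulr_suml; apply: eq_bigr => j _.
  rewrite sqrtrM ?sqr_ge0// sqrtr_sqr gtr0_norm// (tnth_nth 0%R) /r.
  by rewrite add0n; ring.
rewrite -e1; congr (_ * _ * _)%R; congr (_ + _)%R.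
apply: eq_bigr => j _; have jn : (j < n)%N by rewrite (leq_trans (ltn_ord j)).
exact/esym/(nth_mktuple _ 0%R (Ordinal jn)).
Qed.

Let measurable_prod_obs : measurable_fun setT prod_obs.
Proof.
apply: measurable_mktuple => i; apply: measurable_funD; last first.
  by apply: measurable_funM => //; exact: (measurableT_comp (measurable_tnth i)).
apply: measurable_funM => //; apply: measurable_funM => //; apply: measurable_funD => //.
apply: measurable_sum => j; have jn : (j < n)%N by rewrite (leq_trans (ltn_ord j)).
apply: (eq_measurable_fun (fun p : n.-tuple R * n.-tuple R => tnth p.1 (Ordinal jn))).
  by move=> p _; rewrite (tnth_nth 0%R).
exact: (measurableT_comp (measurable_tnth _)).
Qed.

Let mxi : measurable_fun (T := path_space W) setT (xi : path_space W -> _).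
Proof.
apply: measurable_mktuple => j; apply: measurable_funM => //.
by apply: measurable_funB; apply: path_measurable; apply: grid01 => //; exact: ltnW.
Qed.

Let xi_law A : measurable A -> P [set w | A (xi w)] = gauss R n A.
Proof.
by apply: (increments_law bm grid_nd) => //; rewrite ?grid0 ?gridn.
Qed.

Let event_law (h : n.-tuple R * n.-tuple R -> n.-tuple R) F :
  measurable_fun setT h -> measurable F ->
  P [set w | F (h (xi w, [tuple eps i w | i < n]))] =
  \int[gauss R n]_e gauss R n [set x | F (h (x, e))].
Proof.
move=> mh mF; have mhF : measurable [set p | F (h p)].
  by rewrite -[X in measurable X]setTI; exact: mh.
rewrite -(gauss_swap mhF) (noise_pair eps_normal eps_indep W_eps mxi mhF).
have mG : measurable_fun setT (fun x => gauss R n [set e | F (h (x, e))]).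
  apply: (eq_measurable_fun (gauss R n \o xsection [set p | F (h p)])).
    move=> x _ /=; congr (gauss R n _).
    by rewrite /xsection; apply/seteqP; split=> e /=; rewrite inE.
  exact: measurable_fun_xsection.
rewrite -(integral_law_of P (path_measurableW mxi) mG)//.
by apply: eq_measure_integral => A mA _; exact: xi_law.
Qed.

(** By [feedback_walk] the observed products form, given the noise, the image of a
    feedback under the map that gives the observed walk, so that
    [gauss_feedback_tv] applies for each value of the noise. *)
Lemma product_model_tv (eta : R) : (0 < eta)%R ->
  tv_close P
    (fun w => [tuple (sg (grid_point i) * W (grid_point i) w + tau * eps i w)%R | i < n])
    (fun w => [tuple (\sum_(j < n | (j < i.+1 * 1)%N)
       Num.sqrt (sg (grid_point j) ^+ 2 / n%:R) *
         increment W (fun k => k%:R / n%:R) j w + tau * eps i w)%R | i < n])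
    (eta / 2 + (gauss_m2 R / eta + 1) / 2 *
       \sum_(i < n) (sg (i%:R / n%:R) / sg (grid_point i) - 1) ^+ 2 *
         (i%:R * gauss_m2 R)).
Proof.
move=> eta0.
have gE (i : 'I_n) : g i.+1 = sg (grid_point i) by rewrite /g (minn_idPl _).
have gE' (i : 'I_n) : g i = sg (i%:R / n%:R) by rewrite /g (minn_idPl _)// ltnW.
have beta : (\sum_(i < n) (sg (i%:R / n%:R) / sg (grid_point i) - 1) ^+ 2 *
    (i%:R * gauss_m2 R) = \sum_(i < n) c i ^+ 2 * (i%:R * gauss_m2 R))%R.
  by apply: eq_bigr => i _; rewrite /c gE gE'.
rewrite beta => F mF.
have [W0 _ _ _] := bm.
have mnoise : measurable_fun setT (fun w => [tuple eps i w | i < n]).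
  exact: measurable_mktuple.
have mpair := measurable_fun_pair (path_measurableW mxi) mnoise.
have mprod := measurableT_comp measurable_prod_obs mpair.
have mW : measurable_fun setT (fun w =>
    [tuple (sg (grid_point i) * W (grid_point i) w + tau * eps i w)%R | i < n]).
  apply: measurable_mktuple => i; apply: measurable_funD; exact: measurable_funM.
apply: (@le_trans _ _ (P [set w | F (prod_obs (xi w, [tuple eps i w | i < n]))])).
  have h : {ae P, forall w, [tuple (sg (grid_point i) * W (grid_point i) w +
      tau * eps i w)%R | i < n] = prod_obs (xi w, [tuple eps i w | i < n])}.
    apply: filterS W0 => w W0w; apply: eq_mktuple => i /=.
    rewrite tnth_mktuple gE add0r -mulrA; congr (_ * _ + _)%R.
    transitivity (\sum_(j < i.+1) (W (grid j.+1) w - W (grid j) w))%R.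
      have := telescope_sumr (fun j => W (grid j) w) (leq0n i.+1).
      by rewrite big_mkord => ->; rewrite grid0 W0w subr0.
    rewrite mulr_suml; apply: eq_bigr => j _.
    have jn : (j < n)%N by rewrite (leq_trans (ltn_ord j)).
    have -> : nth 0%R (xi w) j = increment W grid j w.
      exact: (nth_mktuple _ 0%R (Ordinal jn)).
    rewrite /increment grid_step.
    by rewrite divfK// gt_eqF// sqrtr_gt0 invr_gt0.
  by have := tv_close_ae mW mprod h mF; rewrite adde0.
rewrite (event_law measurable_prod_obs mF).
have mstep : measurable_fun setT step_obs by exact: measurable_observe.
rewrite [X in _ <= X + _](_ : _ = P [set w | F (step_obs (xi w, [tuple eps i w | i < n]))]);
    last first.
  congr (P _); apply/seteqP; split=> w /=; congr F; apply: eq_mktuple => i;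
    rewrite tnth_mktuple; congr (_ + _)%R; apply: eq_bigr => j _;
    by rewrite tnth_mktuple gE.
rewrite (event_law mstep mF).
pose K := (eta / 2 + (gauss_m2 R / eta + 1) / 2 *
  \sum_(i < n) c i ^+ 2 * (i%:R * gauss_m2 R))%R.
have K0 : (0 <= K)%R.
  have k0 := gauss_m2_ge0 R; rewrite addr_ge0 ?divr_ge0//; first exact: ltW.
  rewrite mulr_ge0//; first by rewrite divr_ge0// addr_ge0// divr_ge0// ltW.
  by apply: sumr_ge0 => i _; rewrite mulr_ge0 ?sqr_ge0// mulr_ge0.
have mlaw (h : n.-tuple R * n.-tuple R -> n.-tuple R) : measurable_fun setT h ->
    measurable_fun setT (fun e => gauss R n [set x | F (h (x, e))]).
  move=> mh; have mhF : measurable [set p | F (h p)].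
    by rewrite -[X in measurable X]setTI; exact: mh.
  apply: (eq_measurable_fun (gauss R n \o ysection [set p | F (h p)])).
    move=> e _ /=; congr (gauss R n _).
    by rewrite /ysection; apply/seteqP; split=> x /=; rewrite inE.
  exact: measurable_fun_ysection.
apply: (@le_trans _ _ (\int[gauss R n]_e (gauss R n [set x | F (step_obs (x, e))] + K%:E))).
  apply: ge0_le_integral => //.
  - exact: mlaw.
  - by apply: emeasurable_funD => //; exact: mlaw.
  - move=> e _; have mFe : measurable [set x | F (prod_obs (x, e))].
      rewrite -[X in measurable X]setTI.
      exact: (measurableT_comp measurable_prod_obs (pair2_measurable e)).
    apply: le_trans (gauss_feedback_tv c eta0 mFe) _.
    rewrite leeD2r// le_eqVlt; apply/orP; left; apply/eqP; congr (gauss R n _).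
    by apply/seteqP; split=> x /=; rewrite step_prod.
rewrite (ge0_integralD _ measurableT _ (mlaw _ mstep) _ (measurable_cst _))//.
by rewrite integral_prob_cst.
Qed.

End product_model_tv.

(** * The isometry for step integrals *)

Section stationary_increments.
Local Open Scope ereal_scope.
Context (R : realType) d (T : measurableType d) (mu : {measure set T -> \bar R}).
Variables (D : set T) (S : set R) (phi : R -> T -> R) (gamma : R).
Hypothesis mD : measurable D.
Hypothesis mphi : forall t, S t -> measurable_fun D (phi t).
Hypothesis phi_sqr : forall s t, S s -> S t ->
  \int[mu]_(x in D) ((phi t x - phi s x) ^+ 2)%:E = (gamma * `|t - s|)%:E.

(** The covariance of two increments in terms of the distances of times. *)
Definition increment_cov (p q : R * R * R) : R :=
  ((`|p.2 - q.1.2| + `|p.1.2 - q.2| - `|p.2 - q.2| - `|p.1.2 - q.1.2|) / 2)%R.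

Let sqr_integrable s t : S s -> S t ->
  mu.-integrable D (fun x => ((phi t x - phi s x) ^+ 2)%:E).
Proof.
move=> Ss St; apply/integrableP; split.
  apply/measurable_EFinP; apply: measurable_funX.
  by apply: measurable_funB; exact: mphi.
under eq_integral do rewrite gee0_abs ?lee_fin ?sqr_ge0//.
by rewrite phi_sqr// ltry.
Qed.

Lemma increment_product p q : S p.1.2 -> S p.2 -> S q.1.2 -> S q.2 ->
  mu.-integrable D (fun x => (p.1.1 * (phi p.2 x - phi p.1.2 x) *
    (q.1.1 * (phi q.2 x - phi q.1.2 x)))%:E) /\
  \int[mu]_(x in D) (p.1.1 * (phi p.2 x - phi p.1.2 x) *
    (q.1.1 * (phi q.2 x - phi q.1.2 x)))%:E =
  (gamma * (p.1.1 * q.1.1 * increment_cov p q))%:E.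
Proof.
move=> Sa Sb Sa' Sb'.
pose k := (p.1.1 * q.1.1 / 2)%R.
pose f s t x := ((phi t x - phi s x) ^+ 2)%:E.
have E x : (p.1.1 * (phi p.2 x - phi p.1.2 x) *
    (q.1.1 * (phi q.2 x - phi q.1.2 x)))%:E =
  k%:E * (((f q.1.2 p.2 x + f q.2 p.1.2 x) - f q.2 p.2 x) - f q.1.2 p.1.2 x).
  rewrite -[RHS]/((k * ((phi p.2 x - phi q.1.2 x) ^+ 2 +
    (phi p.1.2 x - phi q.2 x) ^+ 2 - (phi p.2 x - phi q.2 x) ^+ 2 -
    (phi p.1.2 x - phi q.1.2 x) ^+ 2))%:E).
  by congr EFin; rewrite /k; field.
have i1 : mu.-integrable D (f q.1.2 p.2) by exact: sqr_integrable.
have i2 : mu.-integrable D (f q.2 p.1.2) by exact: sqr_integrable.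
have i3 : mu.-integrable D (f q.2 p.2) by exact: sqr_integrable.
have i4 : mu.-integrable D (f q.1.2 p.1.2) by exact: sqr_integrable.
have i12 : mu.-integrable D (fun x => f q.1.2 p.2 x + f q.2 p.1.2 x).
  exact: (integrableD mD i1 i2).
have i123 : mu.-integrable D (fun x => (f q.1.2 p.2 x + f q.2 p.1.2 x) - f q.2 p.2 x).
  exact: (integrableB mD i12 i3).
have i1234 : mu.-integrable D (fun x =>
    ((f q.1.2 p.2 x + f q.2 p.1.2 x) - f q.2 p.2 x) - f q.1.2 p.1.2 x).
  exact: (integrableB mD i123 i4).
split.
  rewrite (funext E); exact: (integrableZl mD k i1234).
under eq_integral do rewrite E.
rewrite (integralZl mD i1234) (integralB mD i123 i4) (integralB mD i12 i3).
rewrite (integralD mD i1 i2) /f !phi_sqr//.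
rewrite -[LHS]/((k * (gamma * `|p.2 - q.1.2| + gamma * `|p.1.2 - q.2| -
  gamma * `|p.2 - q.2| - gamma * `|p.1.2 - q.1.2|))%:E).
by congr EFin; rewrite /k /increment_cov; field.
Qed.

(** Expanding the square leaves products of increments, and polarization
   rewrites each of them with squared increments. *)
Lemma increment_sum_sqr (s : seq (R * R * R)) :
  (forall p, p \in s -> S p.1.2 /\ S p.2) ->
  \int[mu]_(x in D)
    ((\sum_(p <- s) p.1.1 * (phi p.2 x - phi p.1.2 x)) ^+ 2)%R%:E =
  (gamma * \sum_(p <- s) \sum_(q <- s) p.1.1 * q.1.1 * increment_cov p q)%R%:E.
Proof.
move=> sS; pose p0 : R * R * R := (0, 0, 0)%R.
pose g i x := (p0.1.1 + (nth p0 s i).1.1 *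
  (phi (nth p0 s i).2 x - phi (nth p0 s i).1.2 x))%R.
have h (i j : 'I_(size s)) := increment_product
  (sS _ (mem_nth p0 (ltn_ord i))).1 (sS _ (mem_nth p0 (ltn_ord i))).2
  (sS _ (mem_nth p0 (ltn_ord j))).1 (sS _ (mem_nth p0 (ltn_ord j))).2.
have E x : ((\sum_(p <- s) p.1.1 * (phi p.2 x - phi p.1.2 x)) ^+ 2)%R%:E =
    \sum_(i < size s) \sum_(j < size s) ((nth p0 s i).1.1 *
  (phi (nth p0 s i).2 x - phi (nth p0 s i).1.2 x) * ((nth p0 s j).1.1 *
  (phi (nth p0 s j).2 x - phi (nth p0 s j).1.2 x)))%:E.
  under [RHS]eq_bigr do rewrite sumEFin.
  rewrite sumEFin; congr EFin.
  by rewrite (big_nth p0) big_mkord expr2 big_distrlr.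
under eq_integral do rewrite E.
rewrite integral_sum//; last first.
  by move=> i; apply: integrable_sum => // j _; exact: (h i j).1.
under eq_bigr => i _.
  rewrite integral_sum//; last by move=> j; exact: (h i j).1.
  under eq_bigr do rewrite (h i _).2.
  rewrite sumEFin -mulr_sumr; over.
rewrite sumEFin -mulr_sumr; congr (_ * _)%:E.
rewrite [RHS](big_nth p0) big_mkord; apply: eq_bigr => i _.
by rewrite [RHS](big_nth p0) big_mkord.
Qed.

End stationary_increments.

Section wiener_isometry.
Local Open Scope ereal_scope.
Context (R : realType) d (T : measurableType d) (P : probability T R).
Variables (W : R -> {RV P >-> R}).
Hypothesis bm : brownian_motion01 W.

Lemma brownian_increment_sqr s t : s \in `[0%R, 1%R] -> t \in `[0%R, 1%R] ->
  \int[P]_w ((W t w - W s w) ^+ 2)%:E = (gauss_m2 R * `|t - s|)%:E.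
Proof.
wlog st : s t / (s < t)%R => [hw s01 t01|].
  have [?|ts|->] := ltgtP s t; first exact: hw.
    under eq_integral do rewrite -sqrrN opprB.
    by rewrite distrC hw.
  rewrite subrr normr0 mulr0; under eq_integral do rewrite subrr expr0n.
  by rewrite integral0.
rewrite !in_itv/= => /andP[s0 s1] /andP[t0 t1].
pose tt i := if i is 0%N then s else (t + (i.-1)%:R)%R.
have tt_nd : {homo tt : i j / (i <= j)%N >-> (i <= j)%R}.
  case=> [|i] [|j]//= ij; last by rewrite lerD2l ler_nat.
  by rewrite (le_trans (ltW st))// lerDl.
have law := increments_law bm (m := 1) tt_nd.
have {}law : forall F, measurable F ->
    P [set w | F [tuple increment W tt i w | i < 1]] = gauss R 1 F.
  by apply: law => //= [[]//|]; rewrite /= ?addr0.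
have mX : measurable_fun setT (fun w => [tuple increment W tt i w | i < 1]).
  by apply: measurable_mktuple => i; exact: measurable_increment.
have st0 : (0 < t - s)%R by rewrite subr_gt0.
pose f (v : 1.-tuple R) : R :=
  ((0 + \sum_(i < 1) (fun=> Num.sqrt (t - s)) i * tnth v i) ^+ 2)%R.
have mf : measurable_fun setT (fun v => (f v)%:E).
  by apply/measurable_EFinP/measurable_funX; exact: measurable_linear_form.
transitivity (\int[P]_w (f [tuple increment W tt i w | i < 1])%:E).
  apply: eq_integral => w _; congr ((_ ^+ 2)%:E).
  rewrite big_ord1 add0r tnth_mktuple /increment /= addr0.
  by rewrite mulrCA divff ?mulr1// lt0r_neq0 ?sqrtr_gt0.
rewrite -(integral_law_of P mX mf); last by move=> v; rewrite lee_fin sqr_ge0.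
rewrite (eq_measure_integral (gauss R 1)); last by move=> A mA _; exact: law.
rewrite gauss_linear_sqr big_ord1 expr0n add0r sqr_sqrtr ?(ltW st0)//.
by rewrite gtr0_norm.
Qed.

Lemma indicator_increment_sqr (t0 s t : R) :
  s \in `[0%R, t0] -> t \in `[0%R, t0] ->
  \int[@lebesgue_measure R]_(x in `[0%R, t0])
    ((\1_(`]0%R, t]) x - \1_(`]0%R, s]) x) ^+ 2)%:E = (1 * `|t - s|)%:E.
Proof.
wlog st : s t / (s <= t)%R => [hw s01 t01|].
  have [?|ts] := leP s t; first exact: hw.
  under eq_integral do rewrite -sqrrN opprB.
  by rewrite distrC hw// ltW.
rewrite !in_itv/= => /andP[s0 s1] /andP[t00 t1].
transitivity (\int[@lebesgue_measure R]_(x in `[0%R, t0]) (\1_(`]s, t]) x)%:E).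
  apply: eq_integral => x _; congr EFin; rewrite !indicE !mem_setE !in_itv/=.
  have [x0|x0] /= := ltP 0%R x; last first.
    by rewrite subrr expr0n/= ltNge (le_trans x0).
  have [xs|xs]/= := leP x s.
    by rewrite (le_trans xs st) subrr expr0n.
  by rewrite subr0; case: (x <= t)%R; rewrite /= ?expr1n ?expr0n.
rewrite integral_indic// setIidl; last first.
  move=> x /=; rewrite !in_itv/= => /andP[sx xt].
  by rewrite (le_trans s0 (ltW sx)) (le_trans xt).
transitivity (lebesgue_measure (`]s, t]%classic : set R)); first by [].
rewrite lebesgue_measure_itv/= lte_fin mul1r.
have [_|ts] := ltP s t; first by rewrite -EFinB ger0_norm ?subr_ge0.
have -> : t = s by apply/eqP; rewrite eq_le ts st.
by rewrite subrr normr0.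
Qed.

Lemma step_funE (t : R) s x : step_within t s -> step_fun s x =
  (\sum_(p <- s) p.1.1 * (\1_(`]0%R, p.2]) x - \1_(`]0%R, p.1.2]) x))%R.
Proof.
move=> /allP sw; rewrite /step_fun [LHS]big_seq [RHS]big_seq.
apply: eq_bigr => p /sw /andP[/andP[a0 ab] _]; congr (_ * _)%R.
rewrite !indicE !mem_setE !in_itv/=.
have [ax|xa] /= := ltP p.1.2 x.
  by rewrite (le_lt_trans a0 ax)/= subr0.
by rewrite (le_trans xa ab) subrr.
Qed.

(** Brownian motion and the family of the indicators of [ ]0, t] ] have
    increments of proportional norms, and by [increment_sum_sqr] these norms
    determine those of all linear combinations of increments. *)
Lemma step_isometry (t : R) s : (t <= 1)%R -> step_within t s ->
  \int[P]_w (step_integral W s w ^+ 2)%:E =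
  (gauss_m2 R)%:E *
  \int[@lebesgue_measure R]_(x in `[0%R, t]) (step_fun s x ^+ 2)%:E.
Proof.
move=> t1 sw.
have st p : p \in s -> `[0%R, t]%classic p.1.2 /\ `[0%R, t]%classic p.2.
  move=> /(allP sw) /andP[/andP[a0 ab] bt]; rewrite /= !in_itv/= a0 bt.
  by rewrite (le_trans ab bt) (le_trans a0 ab).
have sub (a : R) : (`[0%R, t]%classic a -> a \in `[0%R, 1%R])%R.
  by rewrite /= !in_itv/= => /andP[-> /le_trans]; exact.
rewrite /step_integral.
rewrite (@increment_sum_sqr _ _ _ P setT `[0%R, t]%classic (fun t => W t) (gauss_m2 R))//; last first.
  by move=> a b /sub a1 /sub b1; exact: brownian_increment_sqr.
under eq_integral do rewrite (step_funE _ sw).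
rewrite (@increment_sum_sqr _ _ _ lebesgue_measure `[0%R, t]%classic `[0%R, t]%classic
  (fun t => \1_(`]0%R, t])) 1)//; last by move=> a b; exact: indicator_increment_sqr.
by rewrite mul1r EFinM.
Qed.

End wiener_isometry.

(** * Wiener integrals and random walks *)

Section almost_sure_limit.
Local Open Scope ereal_scope.
Context (R : realType) d (T : measurableType d) (P : probability T R).
Variables (X : T -> R) (S : nat -> T -> R) (C : R).
Hypothesis mX : measurable_fun setT X.
Hypothesis mS : forall k, measurable_fun setT (S k).
Hypothesis C0 : (0 <= C)%R.
Hypothesis SX : forall k,
  \int[P]_w ((X w - S k w) ^+ 2)%:E <= (C / (2 ^ k.+1)%:R)%:E.

(** The squared errors have a finite sum in the mean, hence almost surely. *)
Lemma fast_L2_cvg_ae : {ae P, forall w, S ^~ w @ \oo --> X w}.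
Proof.
pose f k w := ((X w - S k w) ^+ 2)%:E.
have mf k : measurable_fun setT (f k).
  by apply/measurable_EFinP/measurable_funX; exact: measurable_funB.
have f0 k w : 0 <= f k w by rewrite lee_fin sqr_ge0.
have int_f : P.-integrable setT (fun w => \sum_(0 <= k <oo) f k w).
  apply/integrableP; split; first exact: ge0_emeasurable_sum.
  under eq_integral do rewrite gee0_abs ?nneseries_ge0//.
  rewrite integral_nneseries//.
  apply: (@le_lt_trans _ _ C%:E); last by rewrite ltry.
  apply: le_trans (epsilon_trick0 xpredT C0).
  apply: lee_nneseries => [k _ _|k _]; first exact: integral_ge0.
  by rewrite /f SX.
have := integrable_ae measurableT int_f.
apply: filterS => w /(_ Logic.I) fw.
have : cvgn (series (fun k => ((X w - S k w) ^+ 2)%R)).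
  apply: nnseries_is_cvg; first by move=> k; exact: sqr_ge0.
  by have := fw; rewrite ge0_fin_numE// nneseries_ge0.
move=> /cvg_series_cvg_0 /(cvg_comp _ _)/(_ (@sqrt_continuous R 0%R)).
rewrite sqrtr0 => h.
have {}h : (`|X w - S k w| @[k --> \oo] --> (0 : R))%R.
  by apply: cvg_trans h; apply: near_eq_cvg; near=> k; rewrite /= sqrtr_sqr.
apply/cvgrPdist_lt => e e0.
move/cvgrPdist_lt : h => /(_ e e0); apply: filterS => k.
by rewrite sub0r normrN normr_id.
Unshelve. all: by end_near.
Qed.

(** The upper limit of the approximations is measurable for every family of
    events for which they are, and almost surely it is the limit. *)
Lemma fast_L2_version d' (Q : measurableType d') (q : Q -> T) (p : T -> Q) :
  cancel p q -> (forall k, measurable_fun setT (S k \o q)) ->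
  exists2 X' : Q -> R, measurable_fun setT X' &
    {ae P, forall w, X' (p w) = X w}.
Proof.
move=> pq mSq.
exists (fun w => fine (limn_esup (fun k => (S k (q w))%:E))).
  apply: measurableT_comp => //.
  by apply: measurable_fun_limn_esup => k; apply/measurable_EFinP; exact: mSq.
apply: filterS fast_L2_cvg_ae => w Sw; rewrite pq.
have /cvg_limn_einf_sup[_ ->//] : (S k w)%:E @[k --> \oo] --> (X w)%:E.
by apply: cvg_EFin => //; near=> k.
Unshelve. all: by end_near.
Qed.

End almost_sure_limit.

Section grid_steps.
Context (R : realType).

(** The steps take the value of [f] at the right end of each cell, as does the
    product model at the times of observation. *)
Definition grid_steps (f : R -> R) (m J : nat) : seq (R * R * R) :=
  [seq (f (j.+1%:R / m%:R), j%:R / m%:R, j.+1%:R / m%:R)%R | j <- iota 0 J].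

Lemma grid_steps_within f m J : step_within (J%:R / m%:R) (grid_steps f m J).
Proof.
rewrite /step_within /grid_steps all_map; apply/allP => j.
rewrite mem_iota/= add0n => jJ; rewrite divr_ge0//=.
by rewrite !ler_wpM2r ?ler_nat// ?invr_ge0.
Qed.

(** The indicators of the cells add up to one, so that the error is a convex
    combination of the oscillations of [f] on the cells. *)
Lemma grid_steps_dist f m J (lam x : R) : (0 < m)%N -> (0 <= lam)%R ->
  {in `[0%R, 1%R] &, forall x y, `|f x - f y| <= lam * `|x - y|}%R ->
  (J <= m)%N -> x \in `]0%R, J%:R / m%:R] ->
  (`|f x - step_fun (grid_steps f m J) x| <= lam / m%:R)%R.
Proof.
move=> m0 lam0 flip Jm.
have m0R : (0 < m%:R :> R)%R by rewrite ltr0n.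
rewrite in_itv/= => /andP[x0 xJ].
pose c j := (\1_(`](j%:R / m%:R), (j.+1%:R / m%:R)]%classic) x : R)%R.
have sum1 : (\sum_(j <- iota 0 J) c j = 1)%R.
  have -> : (1 = \1_(`]0, (J%:R / m%:R)]%classic) x :> R)%R.
    by rewrite indicE mem_setE in_itv/= x0 xJ.
  elim: (J) => [|k IH].
    rewrite big_nil mul0r set_itv_ge ?indic0//.
    by rewrite -leNgt bnd_simp.
  rewrite -addn1 iotaD big_cat/= big_seq1 add0n IH addn1 /c.
  rewrite !indicE !mem_setE !in_itv/=.
  have kk : (k%:R / m%:R <= k.+1%:R / m%:R :> R)%R by rewrite ler_pM2r ?invr_gt0// ler_nat.
  rewrite x0/=; have [xk|kx]/= := leP x (k%:R / m%:R)%R.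
    by rewrite (le_trans xk kk) addr0.
  by rewrite add0r.
have dec a : a = (\sum_(j <- iota 0 J) a * c j)%R by rewrite -mulr_sumr sum1 mulr1.
rewrite [X in (X - _)%R]dec /step_fun big_map -sumrB.
apply: (le_trans (ler_norm_sum _ _ _)).
rewrite [X in (_ <= X)%R]dec big_seq [X in (_ <= X)%R]big_seq.
apply: ler_sum => j; rewrite mem_iota add0n /= => jJ.
rewrite -/(c j) -mulrBl normrM {2}/c /c indicE mem_setE in_itv/=.
have [/andP[jx xj]|_] := boolP (_ && _); last by rewrite normr0 !mulr0.
rewrite normr1 !mulr1.
have J1 : (J%:R / m%:R <= 1 :> R)%R by rewrite ler_pdivrMr// mul1r ler_nat.
have jJR : (j.+1%:R / m%:R <= J%:R / m%:R :> R)%R by rewrite ler_pM2r ?invr_gt0// ler_nat.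
apply: (le_trans (flip _ _ _ _)).
- by rewrite in_itv/= (ltW x0) (le_trans xJ).
- by rewrite in_itv/= divr_ge0//= (le_trans jJR).
apply: ler_wpM2l => //; rewrite distrC ger0_norm ?subr_ge0//.
by move: jx; rewrite -natr1 mulrDl mul1r; lra.
Qed.

End grid_steps.

Section square_of_a_sum.
Local Open Scope ereal_scope.
Context (R : realType) d (T : measurableType d) (mu : {measure set T -> \bar R}).
Variables (D : set T) (f g : T -> R).
Hypotheses (mD : measurable D) (mf : measurable_fun D f) (mg : measurable_fun D g).

(** Young's inequality. The first weight may be taken close to one, which is
    what shows that balls defined by a seminorm are open. *)
Lemma integral_sqrD_weighted (delta : R) (a b : \bar R) : (0 < delta)%R ->
  \int[mu]_(x in D) (f x ^+ 2)%:E <= a -> \int[mu]_(x in D) (g x ^+ 2)%:E <= b ->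
  \int[mu]_(x in D) ((f x + g x) ^+ 2)%:E <=
    (1 + delta)%:E * a + (1 + delta^-1)%:E * b.
Proof.
move=> delta0 fa gb.
have delta1 : (0 <= 1 + delta)%R by rewrite addr_ge0// ltW.
have delta2 : (0 <= 1 + delta^-1)%R by rewrite addr_ge0// invr_ge0 ltW.
have mf2 : measurable_fun D (fun x => (f x ^+ 2)%:E).
  by apply/measurable_EFinP; exact: measurable_funX.
have mg2 : measurable_fun D (fun x => (g x ^+ 2)%:E).
  by apply/measurable_EFinP; exact: measurable_funX.
have mZ (k : R) (h : T -> \bar R) : measurable_fun D h -> measurable_fun D (fun x => k%:E * h x).
  by move=> mh; exact: measurable_funeM.
have pZ (k : R) (h : T -> R) x : (0 <= k)%R -> 0 <= k%:E * (h x ^+ 2)%:E.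
  by move=> k0; rewrite -EFinM lee_fin mulr_ge0// sqr_ge0.
apply: (@le_trans _ _ (\int[mu]_(x in D)
    ((1 + delta)%:E * (f x ^+ 2)%:E + (1 + delta^-1)%:E * (g x ^+ 2)%:E))).
  apply: ge0_le_integral => //.
  - by move=> x _; rewrite lee_fin sqr_ge0.
  - by apply/measurable_EFinP; apply: measurable_funX; exact: measurable_funD.
  - by apply: emeasurable_funD; exact: mZ.
  - move=> x _; rewrite -!EFinM -EFinD lee_fin -subr_ge0.
    have -> : ((1 + delta) * f x ^+ 2 + (1 + delta^-1) * g x ^+ 2 - (f x + g x) ^+ 2 =
      delta^-1 * (delta * f x - g x) ^+ 2)%R by field; rewrite gt_eqF.
    by rewrite mulr_ge0 ?sqr_ge0// invr_ge0 ltW.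
rewrite (ge0_integralD _ mD (fun x _ => pZ _ f x delta1) (mZ _ _ mf2)
  (fun x _ => pZ _ g x delta2) (mZ _ _ mg2)).
have s0 (h : T -> R) x : D x -> 0 <= (h x ^+ 2)%:E.
  by move=> _; rewrite lee_fin sqr_ge0.
rewrite (ge0_integralZl _ mD mf2 (s0 f)) ?lee_fin//.
rewrite (ge0_integralZl _ mD mg2 (s0 g)) ?lee_fin//.
by apply: leeD; apply: lee_wpmul2l => //; rewrite lee_fin.
Qed.

Lemma integral_sqrD (a b : \bar R) :
  \int[mu]_(x in D) (f x ^+ 2)%:E <= a -> \int[mu]_(x in D) (g x ^+ 2)%:E <= b ->
  \int[mu]_(x in D) ((f x + g x) ^+ 2)%:E <= 2%:E * a + 2%:E * b.
Proof.
by move=> fa gb; have := integral_sqrD_weighted ltr01 fa gb; rewrite invr1.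
Qed.

End square_of_a_sum.

Section wiener_integral.
Local Open Scope ereal_scope.
Context (R : realType) d (T : measurableType d) (P : probability T R).
Variables (W : R -> {RV P >-> R}).
Hypothesis bm : brownian_motion01 W.

Let opp_step (s : seq (R * R * R)) : seq (R * R * R) :=
  [seq (- p.1.1, p.1.2, p.2)%R | p <- s].

Let measurable_step_fun D s : measurable_fun D (step_fun s : R -> R).
Proof. by apply: measurable_sum => p; apply: measurable_funM. Qed.

Let measurable_step_integral s : measurable_fun setT (step_integral W s).
Proof.
apply: measurable_sum => p; apply: measurable_funM => //.
exact: measurable_funB.
Qed.

(** The isometry for the difference between [s] and the step functions that
    define the integral; two uses of [(a + b) ^ 2 <= 2 a ^ 2 + 2 b ^ 2] give the
    factor 4. *)
Lemma wiener_integral_dist f (t C : R) X s : (t <= 1)%R ->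
  is_wiener_integral W f t X -> step_within t s ->
  measurable_fun `[0%R, t] f ->
  \int[lebesgue_measure]_(x in `[0%R, t]) ((f x - step_fun s x) ^+ 2)%:E
    <= C%:E ->
  \int[P]_w ((X w - step_integral W s w) ^+ 2)%:E
    <= (4 * gauss_m2 R * C)%:E.
Proof.
move=> t1 [sk [sk_t sk_f sk_X]] s_t mf fs.
pose a k := \int[P]_w ((step_integral W (sk k) w - X w) ^+ 2)%:E.
pose b k := \int[lebesgue_measure]_(x in `[0%R, t]) ((step_fun (sk k) x - f x) ^+ 2)%:E.
have bound k : \int[P]_w ((X w - step_integral W s w) ^+ 2)%:E <=
    2%:E * a k + 2%:E * ((gauss_m2 R)%:E * (2%:E * b k + 2%:E * C%:E)).
  pose J := sk k ++ opp_step s.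
  have Jw : step_within t J.
    by rewrite /step_within all_cat [all _ (sk k)]sk_t /opp_step all_map.
  have -> : (fun w => ((X w - step_integral W s w) ^+ 2)%:E) =
      (fun w => (((X w - step_integral W (sk k) w) + step_integral W J w) ^+ 2)%:E).
    apply/funext => w; congr ((_ ^+ 2)%:E).
    rewrite /step_integral /J big_cat /opp_step big_map/=.
    rewrite [X in (_ + (_ + X))%R](_ : _ = (- step_integral W s w)%R).
      by rewrite addrA subrK.
    by rewrite /step_integral -sumrN; apply: eq_bigr => p _; rewrite mulNr.
  apply: integral_sqrD => //; first exact: measurable_funB.
    by rewrite /a; under eq_integral do rewrite -sqrrN opprB.
  rewrite (step_isometry bm t1 Jw).
  apply: lee_wpmul2l; first by rewrite lee_fin gauss_m2_ge0.
  have -> : (fun x => (step_fun J x ^+ 2)%:E) =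
      (fun x => (((step_fun (sk k) x - f x) + (f x - step_fun s x)) ^+ 2)%:E).
    apply/funext => x; congr ((_ ^+ 2)%:E).
    rewrite addrA subrK /step_fun /J big_cat /opp_step big_map/=; congr (_ + _)%R.
    by rewrite -sumrN; apply: eq_bigr => p _; rewrite mulNr.
  have m1 : measurable_fun `[0%R, t] (fun x => step_fun (sk k) x - f x)%R.
    exact: (measurable_funB (@measurable_step_fun _ _) mf).
  have m2 : measurable_fun `[0%R, t] (fun x => f x - step_fun s x)%R.
    exact: (measurable_funB mf (@measurable_step_fun _ _)).
  exact: integral_sqrD.
apply: (@cvge_to_ge _ \oo _ _
  (fun k => 2%:E * a k + 2%:E * ((gauss_m2 R)%:E * (2%:E * b k + 2%:E * C%:E)))); last first.
  by apply: nearW => k; exact: bound.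
have -> : (4 * gauss_m2 R * C)%:E =
    2%:E * 0 + 2%:E * ((gauss_m2 R)%:E * (2%:E * 0 + 2%:E * C%:E)).
  by rewrite !mule0 !add0e -!EFinM; congr EFin; ring.
apply: cvgeD; first by rewrite mule0.
  exact: cvgeZl.
apply: cvgeZl => //; apply: cvgeZl => //; apply: cvgeD; first by rewrite mule0.
  exact: cvgeZl.
exact: cvg_cst.
Qed.

Lemma wiener_integral_grid (f : R -> R) m J (lam : R) X : (0 < m)%N -> (0 <= lam)%R ->
  measurable_fun setT f ->
  {in `[0%R, 1%R] &, forall x y, `|f x - f y| <= lam * `|x - y|}%R ->
  (J <= m)%N -> is_wiener_integral W f (J%:R / m%:R) X ->
  \int[P]_w ((X w - step_integral W (grid_steps f m J) w) ^+ 2)%:E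
    <= (4 * gauss_m2 R * (lam / m%:R) ^+ 2)%:E.
Proof.
move=> m0 lam0 mf flip Jm fX.
have m0R : (0 < m%:R :> R)%R by rewrite ltr0n.
have J1 : (J%:R / m%:R <= 1 :> R)%R by rewrite ler_pdivrMr// mul1r ler_nat.
have J0 : (0 <= J%:R / m%:R :> R)%R by rewrite divr_ge0.
apply: (wiener_integral_dist J1 fX (grid_steps_within f m J)).
  exact: (measurable_funS measurableT).
have mg : measurable_fun setT (fun x => ((f x - step_fun (grid_steps f m J) x) ^+ 2)%:E).
  by apply/measurable_EFinP/measurable_funX; exact: measurable_funB.
rewrite -integral_itv_obnd_cbnd; last exact: (measurable_funS measurableT).
apply: (@le_trans _ _ (\int[@lebesgue_measure R]_(x in `]0%R, (J%:R / m%:R)%R])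
    ((lam / m%:R) ^+ 2)%:E)).
  apply: ge0_le_integral => //.
  - by move=> x _; rewrite lee_fin sqr_ge0.
  - exact: (measurable_funS measurableT).
  - move=> x /(grid_steps_dist m0 lam0 flip Jm) xd.
    rewrite lee_fin -real_normK ?num_real// lerXn2r ?nnegrE//.
    by rewrite divr_ge0.
rewrite integral_cst//.
have lm : lebesgue_measure (`]0%R, (J%:R / m%:R)%R]%classic : set R) =
    (J%:R / m%:R : R)%:E.
  rewrite lebesgue_measure_itv/= lte_fin oppr0 adde0.
  by case: ltP => // j0; congr EFin; apply/eqP; rewrite eq_le J0 j0.
rewrite [X in _ * X]lm.
by rewrite -EFinM lee_fin -[X in (_ <= X)%R]mulr1 ler_wpM2l ?sqr_ge0.
Qed.

Lemma grid_steps_increments (f : R -> R) m J w : (J <= m)%N ->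
  (forall x, 0 <= f x)%R ->
  step_integral W (grid_steps f m J) w =
  (\sum_(j < m | (j < J)%N) Num.sqrt (f (j.+1%:R / m%:R) ^+ 2 / m%:R) *
     increment W (fun k => k%:R / m%:R) j w)%R.
Proof.
move=> Jm f0; rewrite /step_integral /grid_steps big_map/=.
rewrite -(big_ord_widen_cond _ xpredT (fun j => Num.sqrt (f (j.+1%:R / m%:R) ^+ 2 / m%:R) *
     increment W (fun k => k%:R / m%:R) j w)%R Jm).
rewrite -[in LHS](subn0 J) -/(index_iota 0 J) big_mkord.
apply: eq_bigr => j _; have m0 : (0 < m)%N := leq_trans (leq_ltn_trans (leq0n j) (ltn_ord j)) Jm.
have m0R : (0 < m%:R :> R)%R by rewrite ltr0n.
rewrite /increment.
have -> : (j.+1%:R / m%:R - j%:R / m%:R = m%:R^-1 :> R)%R.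
  by rewrite -mulrBl -natr1 addrAC subrr add0r mul1r.
rewrite sqrtrM ?sqr_ge0// sqrtr_sqr (ger0_norm (f0 _)).
have s0 : (Num.sqrt m%:R^-1 != 0 :> R)%R by rewrite gt_eqF// sqrtr_gt0 invr_gt0.
by field.
Qed.

End wiener_integral.

Section integral_model_approximation.
Local Open Scope ereal_scope.
Context (R : realType) d (T : measurableType d) (P : probability T R).
Variables (W : R -> {RV P >-> R}) (n : nat) (eps : 'I_n -> {RV P >-> R}).
Hypothesis bm : brownian_motion01 W.
Hypothesis eps_normal : forall i, is_normal P (eps i) 0 1.
Hypothesis eps_indep : mutually_independent P (fun i => eps i).
Hypothesis W_eps : independent_systems P (sigma_generated `[0%R, 1%R] (fun t => W t))
  (sigma_generated setT (fun i => eps i)).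
Variables (tau lam eta : R) (sg : R -> R) (X : 'I_n -> {RV P >-> R}).
Hypothesis tau0 : (0 < tau)%R.
Hypothesis lam0 : (0 <= lam)%R.
Hypothesis eta0 : (0 < eta)%R.
Hypothesis n0 : (0 < n)%N.
Hypothesis sg0 : forall x, (0 <= sg x)%R.
Hypothesis msg : measurable_fun setT sg.
Hypothesis sg_lip :
  {in `[0%R, 1%R] &, forall x y, `|sg x - sg y| <= lam * `|x - y|}%R.
Hypothesis sgX : forall i, is_wiener_integral W sg (grid_point i) (X i).

Let steps N (i : 'I_n) w : R :=
  step_integral W (grid_steps sg (n * N) (i.+1 * N)) w.

Let steps_dist N (i : 'I_n) : (0 < N)%N ->
  \int[P]_w ((X i w - steps N i w) ^+ 2)%:E <=
  (4 * gauss_m2 R * (lam / (n * N)%:R) ^+ 2)%:E.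
Proof.
move=> N0; apply: wiener_integral_grid => //.
- by rewrite muln_gt0 n0.
- by rewrite leq_mul2r ltn_ord orbT.
- rewrite !natrM -mulf_div divff ?mulr1; first exact: sgX.
  by rewrite pnatr_eq0 -lt0n.
Qed.

Let V N (i : 'I_n) w : R :=
  (\sum_(j < n * N | (j < i.+1 * N)%N)
     Num.sqrt (sg (j.+1%:R / (n * N)%:R) ^+ 2 / (n * N)%:R) *
     increment W (fun k => k%:R / (n * N)%:R) j w)%R.

Let steps_V N i w : steps N i w = V N i w.
Proof. by apply: grid_steps_increments => //; rewrite leq_mul2r ltn_ord orbT. Qed.

Let measurable_V N i : (0 < N)%N ->
  measurable_fun (T := path_space W) setT (V N i : path_space W -> R).
Proof.
move=> N0; rewrite (_ : V N i = (fun w => \sum_(j < n * N)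
   if (j < i.+1 * N)%N then
     Num.sqrt (sg (j.+1%:R / (n * N)%:R) ^+ 2 / (n * N)%:R) *
     increment W (fun k => k%:R / (n * N)%:R) j w else 0)%R); last first.
  by apply/funext => w; rewrite /V big_mkcond.
have m0 : (0 < (n * N)%:R :> R)%R by rewrite ltr0n muln_gt0 n0.
have mW (k : nat) : (k <= n * N)%N -> measurable_fun (T := path_space W) setT
    (W (k%:R / (n * N)%:R)%R : path_space W -> R).
  move=> kn; apply: path_measurable; rewrite in_itv/= divr_ge0//=.
  by rewrite ler_pdivrMr// mul1r ler_nat.
apply: measurable_sum => j; case: (j < i.+1 * N)%N; last exact: measurable_cst.
apply: measurable_funM => //; apply: measurable_funM => //.
by apply: measurable_funB; apply: mW; rewrite // ltnW.
Qed.

Let mesh_sqr k : (4 * gauss_m2 R * (lam / (n * 2 ^ k.+1)%:R) ^+ 2 <=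
  4 * gauss_m2 R * lam ^+ 2 / (2 ^ k.+1)%:R)%R.
Proof.
rewrite -[leRHS]mulrA ler_wpM2l ?mulr_ge0 ?gauss_m2_ge0//.
rewrite exprMn ler_wpM2l ?sqr_ge0// exprVn lef_pV2 ?posrE.
- rewrite -natrX ler_nat; apply: (@leq_trans (n * 2 ^ k.+1)).
    by rewrite leq_pmull.
  by rewrite leq_pmulr// muln_gt0 n0 expn_gt0.
- by rewrite exprn_gt0// ltr0n muln_gt0 n0 expn_gt0.
- by rewrite ltr0n expn_gt0.
Qed.

(** The observed Wiener integrals may be replaced by step integrals: the noise
   turns a small mean square error into a small distance of laws. *)
Lemma integral_model_tv N : (0 < N)%N ->
  tv_close P (fun w => [tuple (X i w + tau * eps i w)%R | i < n])
    (fun w => [tuple (\sum_(j < n * N | (j < i.+1 * N)%N)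
       Num.sqrt (sg (j.+1%:R / (n * N)%:R) ^+ 2 / (n * N)%:R) *
       increment W (fun k => k%:R / (n * N)%:R) j w + tau * eps i w)%R | i < n])
    (eta / 2 + (gauss_m2 R / eta + 1) / 2 *
       (n%:R * ((4 * gauss_m2 R * (lam / (n * N)%:R) ^+ 2) / tau ^+ 2))).
Proof.
move=> N0.
have version (i : 'I_n) : exists2 X' : path_space W -> R,
    measurable_fun setT X' & {ae P, forall w, X' w = X i w}.
  apply: (@fast_L2_version R d T P (X i) (fun k => V (2 ^ k.+1) i)
    (4 * gauss_m2 R * lam ^+ 2) _ _ _ _ _ (path_space W) id id) => //.
  - by move=> k; apply: path_measurableW; apply: measurable_V; rewrite expn_gt0.
  - by rewrite mulr_ge0 ?sqr_ge0// mulr_ge0 ?gauss_m2_ge0.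
  - move=> k; under eq_integral do rewrite -steps_V.
    by apply: le_trans (steps_dist _ _) _; rewrite ?expn_gt0// lee_fin mesh_sqr.
  - by move=> k; apply: measurable_V; rewrite expn_gt0.
pose X' i := s2val (cid2 (version i)).
have mX' i : measurable_fun (T := path_space W) setT (X' i) := s2valP (cid2 (version i)).
have X'X i : {ae P, forall w, X' i w = X i w} := s2valP' (cid2 (version i)).
have mX'W i : measurable_fun setT (X' i : T -> R) := path_measurableW (mX' i).
have mY (Z : 'I_n -> T -> R) : (forall i, measurable_fun setT (Z i)) ->
    measurable_fun setT (fun w => [tuple (Z i w + tau * eps i w)%R | i < n]).
  move=> mZ; apply: measurable_mktuple => i.
  by apply: measurable_funD => //; apply: measurable_funM.
have close0 : tv_close P (fun w => [tuple (X i w + tau * eps i w)%R | i < n])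
    (fun w => [tuple (X' i w + tau * eps i w)%R | i < n]) 0.
  apply: tv_close_ae; [exact: mY|exact: mY|].
  have all_X' : {ae P, forall w, forall i : 'I_n, X' i w = X i w}.
    exact: (@filter_forall T 'I_n (fun i => [set w | X' i w = X i w]) (almost_everywhere P) _ X'X).
  apply: (@filterS _ _ (ae_filter_ringOfSetsType P) _ _ _ all_X') => w Xw.
  by apply: eq_mktuple => i; rewrite Xw.
rewrite -[X in tv_close _ _ _ X]add0r.
apply: (tv_close_trans close0).
pose U w := [tuple X' i w | i < n].
pose V' w := [tuple V N i w | i < n].
have -> : (fun w => [tuple (X' i w + tau * eps i w)%R | i < n]) =
    (fun w => [tuple (tnth (U w) i + tau * eps i w)%R | i < n]).
  by apply/funext => w; apply: eq_mktuple => i; rewrite tnth_mktuple.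
have -> : (fun w => [tuple (\sum_(j < n * N | (j < i.+1 * N)%N)
       Num.sqrt (sg (j.+1%:R / (n * N)%:R) ^+ 2 / (n * N)%:R) *
       increment W (fun k => k%:R / (n * N)%:R) j w + tau * eps i w)%R | i < n]) =
    (fun w => [tuple (tnth (V' w) i + tau * eps i w)%R | i < n]).
  by apply/funext => w; apply: eq_mktuple => i; rewrite tnth_mktuple.
apply: (noisy_tv eps_normal eps_indep W_eps tau0) => //.
- exact: measurable_mktuple.
- by apply: measurable_mktuple => i; exact: measurable_V.
move=> i; apply: le_trans (steps_dist i N0).
rewrite le_eqVlt; apply/orP; left; apply/eqP.
have mVW : measurable_fun setT (V N i) := path_measurableW (measurable_V i N0).
apply: ae_eq_integral => //.
- apply/measurable_EFinP/measurable_funX/measurable_funB.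
  + by apply: eq_measurable_fun (mX'W i) => w _; rewrite tnth_mktuple.
  + by apply: eq_measurable_fun mVW => w _; rewrite tnth_mktuple.
- apply/measurable_EFinP/measurable_funX/measurable_funB => //.
  by apply: eq_measurable_fun mVW => w _; rewrite steps_V.
- apply: (@filterS _ _ (ae_filter_ringOfSetsType P) _ _ _ (X'X i)) => w Xw _.
  by rewrite !tnth_mktuple Xw steps_V.
Qed.
End integral_model_approximation.

(** * Smooth bumps *)

Section polynomial_bounds.
Context {R : realType}.
Implicit Types (Q S : {poly R}) (x y : R).

(** Induction on the Horner form. *)
Lemma poly_lipschitz01 Q : exists2 B : R, 0 <= B &
  {in `[0, 1] &, forall x y, `|Q.[x]| <= B /\ `|Q.[y] - Q.[x]| <= B * `|y - x|}.
Proof.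
elim/poly_ind: Q => [|Q c [B B0 IH]].
  by exists 0 => // x y _ _; rewrite !horner0 subrr normr0 mul0r.
exists (B + B + `|c|) => [|x y x01 y01]; first by rewrite !addr_ge0.
have [Qx Qxy] := IH x y x01 y01.
rewrite !hornerMXaddC; move: x01 y01; rewrite !in_itv/= => /andP[x0 x1] /andP[y0 y1].
have xn : `|x| <= 1 by rewrite ger0_norm.
have yn : `|y| <= 1 by rewrite ger0_norm.
split.
  rewrite (le_trans (ler_normD _ _))// lerD2r normrM.
  by rewrite (@le_trans _ _ (B * 1)) ?ler_pM// mulr1 lerDr.
have -> : Q.[y] * y + c - (Q.[x] * x + c) = (Q.[y] - Q.[x]) * y + Q.[x] * (y - x).
  by ring.
rewrite (le_trans (ler_normD _ _))// !normrM -addrA mulrDl lerD//.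
  by rewrite -[leRHS]mulr1 ler_pM// mulr_ge0.
by rewrite ler_wpM2r// (le_trans Qx)// lerDl.
Qed.

Lemma poly_taylor01 Q : exists2 B : R, 0 <= B &
  {in `[0, 1] &, forall x y,
    `|Q.[y] - Q.[x] - Q^`().[x] * (y - x)| <= B * `|y - x| ^+ 2}.
Proof.
elim/poly_ind: Q => [|Q c [B B0 IH]].
  by exists 0 => // x y _ _; rewrite deriv0 !horner0 subrr mul0r subrr normr0 mul0r.
have [D D0 Q'D] := poly_lipschitz01 Q^`().
exists (B + D) => [|x y x01 y01]; first by rewrite addr_ge0.
have := IH x y x01 y01; have [] := Q'D x y x01 y01.
rewrite derivMXaddC !hornerMXaddC hornerD hornerM hornerX => Dx _ hB.
move: x01 y01; rewrite !in_itv/= => /andP[x0 x1] /andP[y0 y1].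
have -> : Q.[y] * y + c - (Q.[x] * x + c) - (Q.[x] + Q^`().[x] * x) * (y - x) =
  (Q.[y] - Q.[x] - Q^`().[x] * (y - x)) * y + Q^`().[x] * (y - x) ^+ 2 by ring.
rewrite (le_trans (ler_normD _ _))// !normrM mulrDl lerD//.
  by rewrite -[leRHS]mulr1 ler_pM// ger0_norm.
by rewrite expr2 ler_wpM2r// mulr_ge0.
Qed.

(** As the polynomials in question vanish at 0 and 1, composing them with this
    projection onto [0, 1] extends them by zero, with no case distinction. *)
Definition clamp x := Num.max 0 (Num.min 1 x).

Lemma clamp01 x : clamp x \in `[0, 1].
Proof.
rewrite in_itv/= /clamp le_max lexx/= ge_max ler01/=.
by rewrite ge_min lexx.
Qed.

Lemma clamp_id x : 0 <= x <= 1 -> clamp x = x.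
Proof. by move=> /andP[x0 x1]; rewrite /clamp (min_idPr x1) (max_idPr x0). Qed.

Lemma clamp_le0 x : x <= 0 -> clamp x = 0.
Proof.
by move=> x0; rewrite /clamp (min_idPr (le_trans x0 ler01)) (max_idPl x0).
Qed.

Lemma clamp_ge1 x : 1 <= x -> clamp x = 1.
Proof. by move=> x1; rewrite /clamp (min_idPl x1) (max_idPr ler01). Qed.

Lemma clamp_dist x y : `|clamp y - clamp x| <= `|y - x|.
Proof.
wlog xy : x y / x <= y => [hw|].
  have [?|/ltW ?] := leP x y; first exact: hw.
  by rewrite distrC [leRHS]distrC hw.
rewrite [leRHS]ger0_norm ?subr_ge0//.
have [x0|x0] := leP x 0; have [y0|y0] := leP y 0;
  have [x1|x1] := leP x 1; have [y1|y1] := leP y 1; try lra;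
  rewrite ?(clamp_le0 x0) ?(clamp_le0 y0) ?(clamp_ge1 (ltW x1)) ?(clamp_ge1 (ltW y1));
  rewrite ?(clamp_id (x := x)) ?(clamp_id (x := y)) ?(ltW x0) ?(ltW y0) ?x1 ?y1//;
  rewrite ler_norml; lra.
Qed.

(** As the derivative vanishes at 0 and 1, the points at which [clamp] is not
    differentiable do no harm. *)
Lemma poly_clamp_taylor Q : Q^`().[0] = 0 -> Q^`().[1] = 0 ->
  exists2 B : R, 0 <= B & forall x y,
    `|Q.[clamp y] - Q.[clamp x] - Q^`().[clamp x] * (y - x)| <= B * `|y - x| ^+ 2.
Proof.
move=> Q0 Q1; have [B B0 hB] := poly_taylor01 Q.
have [D D0 hD] := poly_lipschitz01 Q^`().
exists (B + D) => [|x y]; first by rewrite addr_ge0.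
have -> : Q.[clamp y] - Q.[clamp x] - Q^`().[clamp x] * (y - x) =
  (Q.[clamp y] - Q.[clamp x] - Q^`().[clamp x] * (clamp y - clamp x)) +
  Q^`().[clamp x] * ((clamp y - clamp x) - (y - x)) by ring.
rewrite (le_trans (ler_normD _ _))// mulrDl lerD//.
  rewrite (le_trans (hB _ _ (clamp01 x) (clamp01 y)))// ler_wpM2l//.
  by rewrite lerXn2r ?nnegrE// clamp_dist.
have D2 : 0 <= D * `|y - x| ^+ 2 by rewrite mulr_ge0// exprn_ge0.
have [x0|x0] := leP x 0; first by rewrite (clamp_le0 x0) Q0 mul0r normr0.
have [x1|x1] := leP 1 x; first by rewrite (clamp_ge1 x1) Q1 mul0r normr0.
have x01 : x \in `[0, 1] by rewrite in_itv/= !ltW.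
have cx : clamp x = x by apply: clamp_id; rewrite !ltW.
rewrite cx normrM expr2 mulrA.
have D_le e : e \in `[0, 1] -> Q^`().[e] = 0 ->
    `|x - e| <= `|y - x| -> `|e - y| <= `|y - x| ->
    `|Q^`().[x]| * `|e - x - (y - x)| <= D * `|y - x| * `|y - x|.
  move=> e01 Qe xe ye; have := (hD e x e01 x01).2; rewrite Qe subr0 => Qx.
  have -> : e - x - (y - x) = e - y by ring.
  by rewrite ler_pM// (le_trans Qx)// ler_wpM2l.
have [y0|y0] := leP y 0.
  rewrite (clamp_le0 y0); apply: D_le => //.
  - by rewrite in_itv/= lexx ler01.
  - by rewrite subr0 distrC !ger0_norm; lra.
  - by rewrite sub0r normrN !ler0_norm; lra.
have [y1|y1] := leP 1 y.
  rewrite (clamp_ge1 y1); apply: D_le => //.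
  - by rewrite in_itv/= lexx ler01.
  - by rewrite distrC !ger0_norm; lra.
  - by rewrite distrC !ger0_norm; lra.
rewrite clamp_id ?(ltW y0) ?(ltW y1)// subrr normr0 mulr0.
by rewrite !mulr_ge0.
Qed.

End polynomial_bounds.

Section bump.
Context {R : realType}.
Variable p : nat.

Definition bump_poly : {poly R} := ('X * (1 - 'X)) ^+ p.+1.

(** The [j]-th derivative of the bump that is [(x (1 - x)) ^ p.+1] on [0, 1] and
   vanishes elsewhere. *)
Definition cell_bump (j : nat) (x : R) : R := (bump_poly^`(j)).[clamp x].

(** A derivative lowers the order of the zeros at 0 and 1 by at most one. *)
Lemma derivn_bump_poly j : (j <= p)%N ->
  exists S : {poly R}, bump_poly^`(j) = ('X * (1 - 'X)) ^+ (p.+1 - j) * S.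
Proof.
elim: j => [|j IH] jp; first by exists 1; rewrite mulr1 subn0 derivn0.
have [S hS] := IH (ltnW jp).
rewrite derivnS hS (_ : (p.+1 - j = (p.+1 - j.+1).+1)%N); last by lia.
set D := 'X * _; set m := (p.+1 - j.+1)%N.
exists (D^`() *+ m.+1 * S + D * S^`()).
by rewrite derivM deriv_exp /= mulrDr exprSr; ring.
Qed.

Lemma derivn_bump_poly0 j : (j <= p)%N ->
  (bump_poly^`(j)).[0] = 0 /\ (bump_poly^`(j)).[1] = 0.
Proof.
move=> jp; have [S ->] := derivn_bump_poly jp.
rewrite !hornerM !horner_exp !hornerM !hornerD !hornerN !hornerX !hornerC.
by rewrite !mul0r subrr mulr0 expr0n subn_eq0 ltnNge jp/= !mul0r.
Qed.

Lemma bump_out j x : (j <= p)%N -> ~~ (0 < x < 1) -> cell_bump j x = 0.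
Proof.
move=> jp; have [P0 P1] := derivn_bump_poly0 jp.
rewrite negb_and -!leNgt => /orP[/clamp_le0|/clamp_ge1]; by rewrite /cell_bump => ->.
Qed.

Lemma bump_lipschitz j : exists2 B : R, 0 <= B &
  forall x y, `|cell_bump j y - cell_bump j x| <= B * Num.min 1 `|y - x|.
Proof.
have [B B0 hB] := poly_lipschitz01 bump_poly^`(j).
exists (B + B) => [|x y]; first by rewrite addr_ge0.
have [Bx Bxy] := hB _ _ (clamp01 x) (clamp01 y).
have [By _] := hB _ _ (clamp01 y) (clamp01 x).
rewrite /Num.min; case: ifP => _.
  by rewrite mulr1 (le_trans (ler_normB _ _))// lerD.
rewrite (le_trans Bxy)// (le_trans (ler_wpM2l B0 (clamp_dist x y)))//.
by rewrite ler_wpM2r// lerDl.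
Qed.

Lemma bump_taylor j : (j < p)%N -> exists2 B : R, 0 <= B &
  forall x y, `|cell_bump j y - cell_bump j x - cell_bump j.+1 x * (y - x)| <= B * `|y - x| ^+ 2.
Proof.
move=> jp; have [P0 P1] := derivn_bump_poly0 jp.
by have := @poly_clamp_taylor R bump_poly^`(j); rewrite -derivnS; exact.
Qed.

Lemma bump0E x : cell_bump 0 x = (clamp x * (1 - clamp x)) ^+ p.+1.
Proof. by rewrite /cell_bump derivn0 horner_exp !hornerE. Qed.

Lemma bump0_ge0_le1 x : 0 <= cell_bump 0 x <= 1.
Proof.
rewrite bump0E; have := clamp01 x; rewrite in_itv/= => /andP[x0 x1].
have x10 : 0 <= 1 - clamp x by rewrite subr_ge0.
rewrite exprn_ge0 ?mulr_ge0//= exprn_ile1 ?mulr_ge0// mulr_ile1//.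
by rewrite lerBlDr lerDl.
Qed.

Lemma bump0_middle x : 4^-1 <= x <= 3 / 4 -> (3 / 16) ^+ p.+1 <= cell_bump 0 x.
Proof.
move=> /andP[x0 x1]; rewrite bump0E clamp_id; last by apply/andP; split; lra.
by rewrite lerXn2r ?nnegrE; nra.
Qed.

End bump.

Section bump_train.
Context {R : realType}.
Variables (p M : nat).
Implicit Types (th : 'I_M -> bool) (x y : R).

Definition bump_train th (j : nat) (x : R) : R :=
  \sum_(k < M) (th k)%:R * cell_bump p j (M%:R * x - k%:R).

Lemma sum_unit_interval x :
  \sum_(k < M) ((0 < x - k%:R < 1)%R : nat)%:R <= 1 :> R.
Proof.
case: (pickP [pred k : 'I_M | 0 < x - k%:R < 1]) => [k /= xk|no]; last first.
  by rewrite big1 ?ler01// => k _; have := no k => /= ->.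
rewrite (bigD1 k)//= xk big1 ?addr0// => i ik.
rewrite (_ : (_ < _ < _) = false)//; apply: contraNF ik => xi.
apply/eqP/val_inj/eqP; rewrite -(eqr_nat R); apply/eqP.
have : i%:R < k%:R + 1 :> R by lra.
have : k%:R < i%:R + 1 :> R by lra.
rewrite !natr1 !ltr_nat !ltnS => ki ik'.
by congr (_%:R); apply/eqP; rewrite eqn_leq ki ik'.
Qed.

Lemma bump_train_ge0_le1 th x : 0 <= bump_train th 0 x <= 1.
Proof.
apply/andP; split.
  apply: sumr_ge0 => k _; rewrite mulr_ge0//.
  by have /andP[] := bump0_ge0_le1 p (M%:R * x - k%:R).
apply: le_trans (sum_unit_interval (M%:R * x)); apply: ler_sum => k _.
have /andP[b0 b1] := bump0_ge0_le1 p (M%:R * x - k%:R).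
have [_|out] := boolP (0 < M%:R * x - k%:R < 1).
  by rewrite mulr_ile1 ?ler0n//; case: (th k); rewrite ?lexx ?ler01.
by rewrite bump_out ?mulr0.
Qed.

End bump_train.

Section bump_train_regularity.
Context {R : realType}.
Variable p : nat.

(** At any point at most one bump is active, so that the increments of a train
   of bumps involve at most two bumps. *)
Lemma bump_train_lipschitz j : (j <= p)%N -> exists2 B : R, 0 < B &
  forall M (th : 'I_M -> bool) x y, `|bump_train p th j y - bump_train p th j x| <=
    B * Num.min 1 (M%:R * `|y - x|).
Proof.
move=> jp; have [B B0 hB] := @bump_lipschitz R p j.
exists (B + B + 1) => [|M th x y]; first by rewrite ltr_wpDl// addr_ge0.
set X := M%:R * x; set Y := M%:R * y.
have mE : M%:R * `|y - x| = `|Y - X|.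
  by rewrite /X /Y -mulrBr normrM ger0_norm.
rewrite mE; set m := Num.min 1 _.
have m0 : 0 <= m by rewrite /m le_min ler01 normr_ge0.
have term (k : 'I_M) : `|(th k)%:R * cell_bump p j (Y - k%:R) - (th k)%:R * cell_bump p j (X - k%:R)| <=
    B * m * (((0 < Y - k%:R < 1)%R : nat)%:R + ((0 < X - k%:R < 1)%R : nat)%:R).
  have main : `|(th k)%:R * cell_bump p j (Y - k%:R) - (th k)%:R * cell_bump p j (X - k%:R)| <= B * m.
    rewrite -mulrBr normrM.
    have := hB (X - k%:R) (Y - k%:R).
    have -> : Y - k%:R - (X - k%:R) = Y - X by ring.
    rewrite -/m => h; rewrite -[leRHS]mul1r ler_pM//.
    by case: (th k); rewrite ?normr1 ?normr0.
  have Bm : 0 <= B * m by rewrite mulr_ge0.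
  have [Yk|Yk] := boolP (0 < Y - k%:R < 1).
    by apply: (le_trans main); rewrite ler_peMr//= lerDl.
  have [Xk|Xk] := boolP (0 < X - k%:R < 1).
    by apply: (le_trans main); rewrite ler_peMr//= lerDr.
  by rewrite (bump_out jp Yk) (bump_out jp Xk) subrr normr0 addr0 mulr0.
rewrite /bump_train -sumrB (le_trans (ler_norm_sum _ _ _))//.
rewrite (le_trans (ler_sum _ (fun k _ => term k)))// -mulr_sumr big_split/=.
apply: (@le_trans _ _ (B * m * (1 + 1))).
  by rewrite ler_wpM2l ?mulr_ge0// lerD// sum_unit_interval.
by rewrite mulrDr mulr1 -mulrDl ler_wpM2r// lerDl.
Qed.

Lemma bump_train_taylor j M (th : 'I_M -> bool) : (j < p)%N -> exists2 B : R, 0 <= B &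
  forall x y, `|bump_train p th j y - bump_train p th j x -
    M%:R * bump_train p th j.+1 x * (y - x)| <= B * `|y - x| ^+ 2.
Proof.
move=> jp; have [B B0 hB] := @bump_taylor R p j jp.
exists (M%:R * (B * M%:R ^+ 2)) => [|x y]; first by rewrite !mulr_ge0// exprn_ge0.
rewrite /bump_train -sumrB mulr_sumr mulr_suml -sumrB.
rewrite (le_trans (ler_norm_sum _ _ _))//.
have -> : M%:R * (B * M%:R ^+ 2) * `|y - x| ^+ 2 =
    \sum_(k < M) (B * (M%:R * `|y - x|) ^+ 2).
  by rewrite sumr_const card_ord -[RHS]mulr_natl; ring.
apply: ler_sum => k _.
have := hB (M%:R * x - k%:R) (M%:R * y - k%:R).
have -> : M%:R * y - k%:R - (M%:R * x - k%:R) = M%:R * (y - x) by ring.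
rewrite normrM (ger0_norm (ler0n R M)) => h.
case: (th k); last by rewrite !mul0r mulr0 mul0r !subrr normr0 mulr_ge0// sqr_ge0.
by rewrite !mul1r; apply: le_trans h; rewrite mulrA [_ * M%:R]mulrC.
Qed.

Lemma is_deriv01_taylor (f g : R -> R) B : 0 <= B ->
  (forall x y, `|f y - f x - g x * (y - x)| <= B * `|y - x| ^+ 2) ->
  is_deriv01 f g.
Proof.
move=> B0 fg x x01; apply/cvgrPdist_lt => e e0.
have B1 : 0 < B + 1 by rewrite ltr_wpDl.
have near_x : \forall y \near x, `|y - x| < e / (B + 1).
  have : nbhs x (ball x (e / (B + 1))) by apply: nbhsx_ballx; rewrite divr_gt0.
  by apply: filterS => y; rewrite /ball/= distrC.
rewrite near_withinE; near=> y => _.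
have yx0 : y - x != 0 by rewrite subr_eq0; near: y; exact: nbhs_dnbhs_neq.
rewrite distrC.
have -> : (f y - f x) / (y - x) - g x = (f y - f x - g x * (y - x)) / (y - x).
  by field.
rewrite normrM normfV ltr_pdivrMr ?normr_gt0//.
apply: (le_lt_trans (fg x y)).
rewrite expr2 mulrA ltr_pM2r ?normr_gt0//.
apply: (@le_lt_trans _ _ ((B + 1) * `|y - x|)); first by rewrite ler_wpM2r// lerDl.
rewrite mulrC -ltr_pdivlMr//; near: y; exact: (nbhs_dnbhs near_x).
Unshelve. all: by end_near.
Qed.

Lemma is_nderiv01_chain (F : nat -> R -> R) q i :
  (forall j, (i <= j < i + q)%N -> is_deriv01 (F j) (F j.+1)) ->
  is_nderiv01 q (F i) (F (i + q)%N).
Proof.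
elim: q i => [|q IH] i hF /=; first by rewrite addn0.
exists (F i.+1); first by apply: hF; rewrite leqnn/= addnS ltnS leq_addr.
rewrite addnS -addSn; apply: IH => j /andP[ij jq]; apply: hF.
by rewrite (ltnW ij)/= addnS -addSn.
Qed.

End bump_train_regularity.

(** * The hypercube of volatilities *)

Lemma divn_window (M J kJ j : nat) : (0 < M)%N -> (kJ < M * j.+1)%N ->
  (M * j.+1 < J + kJ)%N -> (kJ %/ M <= j < kJ %/ M + (J %/ M).+1)%N.
Proof.
move=> M0 h1 h2; rewrite -ltnS -(ltn_pmul2l M0).
rewrite -[(j < _)%N]ltnS -[(j.+1 < _)%N](ltn_pmul2l M0).
have := divn_eq J M; have := divn_eq kJ M.
have := ltn_pmod J M0; have := ltn_pmod kJ M0.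
move: (J %/ M)%N (J %% M)%N (kJ %/ M)%N (kJ %% M)%N => a b c e.
by move=> eM bM hkJ hJ; apply/andP; split; lia.
Qed.

(** Adding [j0 * m.-1] to the indices makes the window of length [m] that
    starts at [j0] a full block, to which [card_block_le] applies. *)
Lemma block_index (j j0 m : nat) : (0 < m)%N -> (j0 <= j < j0 + m)%N ->
  ((j + j0 * m.-1) %/ m)%N = j0.
Proof.
case: m => // m _ /andP[j0j jm] /=.
have -> : (j + j0 * m = j0 * m.+1 + (j - j0))%N by lia.
by rewrite divnMDl// divn_small ?addn0// -(ltn_add2r j0) subnK// addnC.
Qed.

Section hypercube.
Context {R : realType}.
Variable alpha : R.
Hypothesis alpha0 : 0 < alpha.

Let p := Num.truncn alpha.

Let p_alpha : p%:R <= alpha < p.+1%:R.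
Proof. exact: truncn_itv (ltW alpha0). Qed.

Definition bump_volatility (l A : R) M (th : 'I_M -> bool) (x : R) : R :=
  l + A * M%:R `^ (- alpha) * bump_train p th 0 x.

Section amplitude.
Variables (l A : R) (M : nat).
Hypothesis A0 : 0 < A.
Hypothesis M0 : (0 < M)%N.

Let M0R : 0 < M%:R :> R. Proof. by rewrite ltr0n. Qed.

Lemma height_ge0 : 0 <= A * M%:R `^ (- alpha).
Proof. by rewrite mulr_ge0 ?powR_ge0// ltW. Qed.

Lemma height_le : A * M%:R `^ (- alpha) <= A.
Proof.
rewrite -[leRHS]mulr1 ler_wpM2l ?(ltW A0)// -[leRHS](powRr0 M%:R).
by rewrite ler_powR ?ler1n// oppr_le0 ltW.
Qed.

Lemma bump_volatility_ge th x : l <= bump_volatility l A (M := M) th x.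
Proof.
rewrite lerDl mulr_ge0 ?height_ge0//.
by have /andP[] := bump_train_ge0_le1 p th x.
Qed.

Lemma bump_volatility_le th x : bump_volatility l A (M := M) th x <= l + A.
Proof.
rewrite lerD2l; apply: le_trans height_le.
rewrite -[leRHS]mulr1 ler_wpM2l ?height_ge0//.
by have /andP[] := bump_train_ge0_le1 p th x.
Qed.

(** The Hoelder norm of a bump of width [1 / M] and height [M ^ - alpha] does
   not depend on [M]; this fixes the relation between the two. *)
Lemma bump_volatility_holder L u B :
  (forall (th : 'I_M -> bool) x y, `|bump_train p th p y - bump_train p th p x| <=
    B * Num.min 1 (M%:R * `|y - x|)) ->
  0 <= B -> A * B <= L -> A <= u - l ->
  forall th, holder_class alpha L l u (bump_volatility l A (M := M) th).
Proof.
move=> hB B0 AB Au th; split; last first.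
  move=> x _; rewrite bump_volatility_ge/= (le_trans (bump_volatility_le _ _))//.
  by rewrite addrC -lerBrDr.
pose c := A * M%:R `^ (- alpha).
pose F j x := (if j is 0%N then l else 0) + c * M%:R ^+ j * bump_train p th j x.
have cM0 j : 0 <= c * M%:R ^+ j.
  by apply: mulr_ge0; [exact: height_ge0|exact: exprn_ge0].
have dF j : (j < p)%N -> is_deriv01 (F j) (F j.+1).
  move=> jp; have [D D0 hD] := @bump_train_taylor R p j M th jp.
  refine (is_deriv01_taylor (mulr_ge0 (cM0 j) D0) _) => x y.
  have -> : F j y - F j x - F j.+1 x * (y - x) = c * M%:R ^+ j *
    (bump_train p th j y - bump_train p th j x -
     M%:R * bump_train p th j.+1 x * (y - x)).
    by rewrite /F exprS; ring.
  by rewrite normrM (ger0_norm (cM0 j)) -[leRHS]mulrA ler_wpM2l.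
exists (F p).
  have -> : bump_volatility l A th = F 0%N.
    by apply/funext => x; rewrite /F expr0 mulr1.
  rewrite -{1}[p]add0n; apply: is_nderiv01_chain => j /andP[_].
  by rewrite add0n; exact: dF.
move=> x y _ _.
have -> : F p x - F p y = c * M%:R ^+ p * (bump_train p th p x - bump_train p th p y).
  by rewrite /F; ring.
have cM := cM0 p.
rewrite normrM (ger0_norm cM).
have b0 : 0 <= alpha - p%:R by move: p_alpha => /andP[? _]; rewrite subr_ge0.
have b1 : alpha - p%:R <= 1 by move: p_alpha => /andP[_]; rewrite -natr1 => ?; lra.
set r := `|x - y|.
have r0 : 0 <= r by rewrite normr_ge0.
have mr : Num.min 1 (M%:R * r) <= (M%:R * r) `^ (alpha - p%:R).
  have Mr0 : 0 <= M%:R * r by rewrite mulr_ge0.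
  have [Mr1|Mr1] := leP 1 (M%:R * r).
    by rewrite -[leLHS](powRr0 (M%:R * r)) ler_powR.
  move: Mr0; rewrite le_eqVlt => /orP[/eqP <-|Mr0]; first exact: powR_ge0.
  rewrite -[leLHS](powRr1 (ltW Mr0)).
  rewrite [X in _ `^ X <= _](_ : _ = (1 - (alpha - p%:R)) + (alpha - p%:R)); last by ring.
  rewrite [leLHS]powRD; last by rewrite (gt_eqF Mr0) implybT.
  rewrite -[leRHS]mul1r ler_wpM2r ?powR_ge0//.
  rewrite [leRHS](_ : 1 = 1 `^ (1 - (alpha - p%:R))); last by rewrite powR1.
  by rewrite ge0_ler_powR ?nnegrE ?subr_ge0 ?ler01// ltW.
apply: (le_trans (ler_wpM2l cM (hB _ _ _))).
rewrite -/r.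
apply: (@le_trans _ _ (c * M%:R ^+ p * (B * (M%:R * r) `^ (alpha - p%:R)))).
  by rewrite ler_wpM2l// ler_wpM2l.
rewrite powRM// -powR_mulrn//.
have -> : c * M%:R `^ p%:R * (B * (M%:R `^ (alpha - p%:R) * r `^ (alpha - p%:R))) =
  A * B * (M%:R `^ (- alpha) * M%:R `^ p%:R * M%:R `^ (alpha - p%:R)) * r `^ (alpha - p%:R).
  by rewrite /c; ring.
rewrite -!powRD; try by rewrite (gt_eqF M0R) implybT.
rewrite (_ : - alpha + p%:R + (alpha - p%:R) = 0); last by ring.
by rewrite powRr0 mulr1 ler_wpM2r// powR_ge0.
Qed.

(** For [1 <= alpha] the constant is at most [A * B], whatever [M] is. *)
Lemma bump_volatility_lipschitz B :
  (forall (th : 'I_M -> bool) x y, `|bump_train p th 0 y - bump_train p th 0 x| <=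
    B * Num.min 1 (M%:R * `|y - x|)) -> 0 <= B ->
  forall (th : 'I_M -> bool) x y,
  `|bump_volatility l A th x - bump_volatility l A th y| <=
  A * M%:R `^ (1 - alpha) * B * `|x - y|.
Proof.
move=> hB B0 th x y.
have -> : bump_volatility l A th x - bump_volatility l A th y =
  A * M%:R `^ (- alpha) * (bump_train p th 0 x - bump_train p th 0 y).
  by rewrite /bump_volatility; ring.
rewrite normrM (ger0_norm height_ge0).
apply: (le_trans (ler_wpM2l height_ge0 (hB _ _ _))).
rewrite (_ : 1 - alpha = - alpha + 1); last by rewrite addrC.
rewrite powRD ?(gt_eqF M0R) ?implybT// powRr1//.
have -> : A * (M%:R `^ (- alpha) * M%:R) * B * `|x - y| =
  A * M%:R `^ (- alpha) * (B * (M%:R * `|x - y|)) by ring.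
by rewrite ler_wpM2l ?height_ge0// ler_wpM2l// ge_min lexx orbT.
Qed.

Lemma bump_volatility_flip (th0 th1 : 'I_M -> bool) k x :
  (forall i, i != k -> th0 i = th1 i) -> ~~ th0 k -> th1 k ->
  bump_volatility l A th1 x - bump_volatility l A th0 x =
  A * M%:R `^ (- alpha) * cell_bump p 0 (M%:R * x - k%:R).
Proof.
move=> eq_th th0k th1k.
have -> : bump_volatility l A th1 x - bump_volatility l A th0 x =
  A * M%:R `^ (- alpha) * (bump_train p th1 0 x - bump_train p th0 0 x).
  by rewrite /bump_volatility; ring.
congr (_ * _); rewrite /bump_train -sumrB (bigD1 k)//= th1k (negbTE th0k).
rewrite big1 => [|i ik]; last by rewrite eq_th// subrr.
by rewrite mul1r mul0r subr0 addr0.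
Qed.

End amplitude.

Section flip.
Variables (l A tau : R) (M n N J : nat).
Hypotheses (A0 : 0 < A) (l0 : 0 < l) (tau0 : 0 < tau).
Hypotheses (M0 : (0 < M)%N) (n0 : (0 < n)%N) (N0 : (0 < N)%N).
Hypothesis JE : J = (n * N)%N.
Variables (th0 th1 : 'I_M -> bool) (k : 'I_M).
Hypotheses (eq_th : forall i, i != k -> th0 i = th1 i).
Hypotheses (th0k : ~~ th0 k) (th1k : th1 k).

Let M0R : 0 < M%:R :> R. Proof. by rewrite ltr0n. Qed.
Let J0 : (0 < J)%N. Proof. by rewrite JE muln_gt0 n0. Qed.
Let J0R : 0 < J%:R :> R. Proof. by rewrite ltr0n. Qed.

Definition grid_variance (th : 'I_M -> bool) (j : 'I_J) : R :=
  bump_volatility l A th (j.+1%:R / J%:R) / J%:R.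

(** A bump is active on a window of about [J / M] points of the grid. *)
Lemma card_flip :
  (#|[pred j | grid_variance th0 j != grid_variance th1 j]| <= (J %/ M).+1)%N.
Proof.
pose m := (J %/ M).+1; pose j0 := (k * J %/ M)%N.
apply: leq_trans (@card_block_le J (j0 * (J %/ M)) m j0 _) => //.
apply: subset_leq_card; apply/fintype.subsetP => j; rewrite !inE => vj.
have : (0 < M%:R * (j.+1%:R / J%:R : R) - k%:R < 1)%R.
  apply: contraNT vj => out; rewrite eq_sym -subr_eq0 /grid_variance -mulrBl.
  by rewrite (bump_volatility_flip l A _ eq_th th0k th1k) bump_out// mulr0 mul0r.
rewrite mulrA subr_gt0 ltrBlDr ltr_pdivlMr// ltr_pdivrMr// mulrDl mul1r.
rewrite -!natrM -natrD !ltr_nat => /andP[h1 h2].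
rewrite -[in X in (_ %/ X)%N]/m -[(J %/ M)%N]/(m.-1) block_index//.
by apply: divn_window => //; rewrite addnC -mulSnr mulSn.
Qed.

(** Blocks of [m] observations are used, with [m] of order [sqrt n]. A bump
    changes the variances of about [n * N / M] increments, each by at most
    [A * M ^ - alpha / J], while all variances are at least [l / J]. *)
Lemma observe_law_flip F : Num.sqrt n%:R <= M%:R `^ (2 * alpha + 1) ->
  (M <= 2 * n)%N -> 6 * A ^+ 2 * (l^-1 + 2 / tau ^+ 2) ^+ 2 <= 16^-1 ->
  measurable F ->
  (observe_law (n := n) N tau (grid_variance th0) F <=
     observe_law N tau (grid_variance th1) F + (4^-1)%:E /\
   observe_law N tau (grid_variance th1) F <=
     observe_law N tau (grid_variance th0) F + (4^-1)%:E)%E.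
Proof.
move=> nM Mn A_small mF.
pose c := A * M%:R `^ (- alpha).
pose s : R := Num.sqrt n%:R.
have s0 : 0 < s by rewrite sqrtr_gt0 ltr0n.
have sE : s ^+ 2 = n%:R by rewrite sqr_sqrtr.
have s1 : 1 <= s.
  by rewrite -[leLHS]sqrtr1 ler_wsqrtr// ler1n.
(* the length of the blocks balances [n / (m * l)] and [m / tau ^ 2] *)
pose m := (Num.truncn s).+1.
have /andP[ms sm] : (s <= m%:R) && (m%:R <= 2 * s).
  have /andP[h1 h2] := truncn_itv (ltW s0).
  by rewrite (ltW h2)/= /m -natr1; lra.
have m0 : (0 < m)%N by [].
have mR : 0 < m%:R :> R by rewrite ltr0n.
pose K := (J %/ M).+1.
have KJ : K%:R <= 3 * J%:R / M%:R :> R.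
  rewrite ler_pdivlMr// -!natrM ler_nat /K mulSn.
  have MJ : (M <= 2 * J)%N by rewrite (leq_trans Mn)// leq_mul2l JE leq_pmulr// orbT.
  by rewrite -[3%N]/(2 + 1)%N mulnDl mul1n leq_add// leq_trunc_div.
have JR : J%:R = s ^+ 2 * N%:R :> R by rewrite sE JE natrM.
have NR : 0 < N%:R :> R by rewrite ltr0n.
have c0 : 0 <= c by rewrite mulr_ge0 ?powR_ge0// ltW.
have lov j : l / J%:R <= grid_variance th0 j.
  by rewrite ler_wpM2r ?invr_ge0 ?(ltW J0R)// bump_volatility_ge.
have dv j : grid_variance th1 j - grid_variance th0 j =
    c * cell_bump p 0 (M%:R * (j.+1%:R / J%:R) - k%:R) / J%:R.
  by rewrite -mulrBl (bump_volatility_flip l A _ eq_th th0k th1k).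
have b01 (j : 'I_J) : 0 <= cell_bump p 0 (M%:R * (j.+1%:R / J%:R : R) - k%:R) <= 1.
  exact: bump0_ge0_le1.
have v01 j : grid_variance th0 j <= grid_variance th1 j.
  rewrite -subr_ge0 dv divr_ge0 ?(ltW J0R)// mulr_ge0//.
  by have /andP[] := b01 j.
have v1del j : grid_variance th1 j - grid_variance th0 j <= c / J%:R.
  rewrite dv ler_wpM2r ?invr_ge0 ?(ltW J0R)// -[leRHS]mulr1 ler_wpM2l//.
  by have /andP[] := b01 j.
have nNJ : (n * N <= J)%N by rewrite JE.
have lo0 : 0 < l / J%:R by rewrite divr_gt0.
pose c1 := l^-1 + 2 / tau ^+ 2.
have c10 : 0 < c1 by rewrite addr_gt0 ?invr_gt0// divr_gt0// exprn_gt0.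
pose b := ((m * N)%:R * (l / J%:R))^-1 + m%:R / tau ^+ 2.
have b0 : 0 <= b.
  rewrite addr_ge0//; last by rewrite divr_ge0// exprn_ge0// ltW.
  by rewrite invr_ge0 mulr_ge0// ltW.
have b_le : b <= s * c1.
  rewrite /b /c1 mulrDr lerD//.
    rewrite natrM JR.
    have -> : (m%:R * N%:R * (l / (s ^+ 2 * N%:R)))^-1 = s / m%:R * (s * l^-1).
      by field; rewrite !gt_eqF.
    rewrite -[leRHS]mul1r ler_wpM2r ?mulr_ge0 ?invr_ge0 ?(ltW s0) ?(ltW l0)//.
    by rewrite ler_pdivrMr// mul1r.
  by rewrite mulrA [s * 2]mulrC ler_wpM2r// invr_ge0 exprn_ge0// ltW.
have sM : s * c ^+ 2 / M%:R <= A ^+ 2.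
  have -> : s * c ^+ 2 / M%:R = A ^+ 2 * (s / M%:R * (M%:R `^ (- alpha)) ^+ 2).
    by rewrite /c; field; rewrite gt_eqF.
  rewrite -[leRHS]mulr1 ler_wpM2l ?sqr_ge0//.
  rewrite powRN exprVn -mulrA -invfM ler_pdivrMr ?mul1r ?mulr_gt0 ?exprn_gt0 ?powR_gt0//.
  apply: (le_trans nM); rewrite powRD ?(gt_eqF M0R) ?implybT// powRr1 ?(ltW M0R)//.
  by rewrite mulrC [2 * alpha]mulrC powRrM powR_mulrn ?powR_ge0.
have t_le : K%:R * (m * N)%:R * (c / J%:R) ^+ 2 * b ^+ 2 <= 16^-1.
  apply: le_trans A_small.
  apply: (@le_trans _ _ (3 * J%:R / M%:R * (2 * s * N%:R) * (c / J%:R) ^+ 2 *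
      (s * c1) ^+ 2)).
    rewrite ler_pM ?sqr_ge0//.
    - by rewrite mulr_ge0 ?sqr_ge0// mulr_ge0.
    - rewrite ler_wpM2r ?sqr_ge0// ler_pM//.
      by rewrite natrM ler_wpM2r.
    - by rewrite lerXn2r ?nnegrE// mulr_ge0 ?(ltW s0) ?(ltW c10).
  rewrite JR.
  have -> : 3 * (s ^+ 2 * N%:R) / M%:R * (2 * s * N%:R) *
      (c / (s ^+ 2 * N%:R)) ^+ 2 * (s * c1) ^+ 2 =
      6 * (s * c ^+ 2 / M%:R) * c1 ^+ 2.
    by field; rewrite !gt_eqF.
  by rewrite ler_wpM2r ?sqr_ge0// ler_wpM2l.
have t1 : K%:R * (m * N)%:R * (c / J%:R) ^+ 2 * b ^+ 2 <= 2^-1.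
  by apply: (le_trans t_le); rewrite lef_pV2 ?posrE// ler_nat.
have te : K%:R * (m * N)%:R * (c / J%:R) ^+ 2 * b ^+ 2 <= (4^-1 : R) ^+ 2.
  by apply: (le_trans t_le); rewrite exprVn lef_pV2 ?posrE//; lra.
have e0 : 0 <= 4^-1 :> R by rewrite invr_ge0.
exact: (observe_law_tv N0 m0 tau0 nNJ lo0 lov v01 v1del card_flip t1 e0 te mF).
Qed.

End flip.
End hypercube.

(** * Comparison of the two models with a random walk *)

Section sqrt_lipschitz.
Context {R : realType}.
Implicit Types (l lam : R) (f : R -> R).

Lemma sqrt_dist_le l a b : 0 < l -> l <= a -> l <= b ->
  `|Num.sqrt a - Num.sqrt b| <= `|a - b| / Num.sqrt l.
Proof.
move=> l0 la lb.
have sl : 0 < Num.sqrt l by rewrite sqrtr_gt0.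
rewrite ler_pdivlMr//.
have -> : a - b = (Num.sqrt a - Num.sqrt b) * (Num.sqrt a + Num.sqrt b).
  by rewrite -subr_sqr !sqr_sqrtr// (le_trans (ltW l0)).
rewrite normrM ler_wpM2l// ger0_norm ?addr_ge0 ?sqrtr_ge0//.
by rewrite (@le_trans _ _ (Num.sqrt a)) ?ler_wsqrtr// lerDl sqrtr_ge0.
Qed.

Lemma lipschitz_measurable f lam : (forall x y, `|f x - f y| <= lam * `|x - y|) ->
  measurable_fun setT f.
Proof.
move=> flip; apply: continuous_measurable_fun => x.
apply/cvgrPdist_lt => e e0.
have lam1 : 0 < `|lam| + 1 by rewrite ltr_wpDl.
have near_x : \forall y \near x, `|x - y| < e / (`|lam| + 1).
  have : nbhs x (ball x (e / (`|lam| + 1))) by apply: nbhsx_ballx; rewrite divr_gt0.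
  by apply: filterS.
near=> y; apply: (le_lt_trans (flip x y)).
apply: (@le_lt_trans _ _ ((`|lam| + 1) * `|x - y|)).
  by rewrite ler_wpM2r// (le_trans (ler_norm _))// lerDl.
by rewrite mulrC -ltr_pdivlMr//; near: y; exact: near_x.
Unshelve. all: by end_near.
Qed.

End sqrt_lipschitz.

Lemma tv_close_le (R : realType) d (T : measurableType d) (P : probability T R)
    d' (T' : measurableType d') (X Y : T -> T') (e1 e2 : R) : e1 <= e2 ->
  tv_close P X Y e1 -> tv_close P X Y e2.
Proof.
move=> e12 XY F mF; apply: (le_trans (XY F mF)).
by apply: leeD => //; rewrite lee_fin.
Qed.

Section models.
Local Open Scope ereal_scope.
Context (R : realType) d (T : measurableType d) (P : probability T R).
Variables (W : R -> {RV P >-> R}) (n : nat) (eps : 'I_n -> {RV P >-> R}).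
Hypothesis bm : brownian_motion01 W.
Hypothesis eps_normal : forall i, is_normal P (eps i) 0 1.
Hypothesis eps_indep : mutually_independent P (fun i => eps i).
Hypothesis W_eps : independent_systems P (sigma_generated `[0%R, 1%R] (fun t => W t))
  (sigma_generated setT (fun i => eps i)).
Variable tau : R.
Hypothesis tau0 : (0 < tau)%R.
Hypothesis n0 : (0 < n)%N.

Definition grid_observation (J N : nat) (f : R -> R) (w : T) : n.-tuple R :=
  [tuple (\sum_(j < J | (j < i.+1 * N)%N)
     Num.sqrt (f (j.+1%:R / J%:R) / J%:R) *
     increment W (fun k => k%:R / J%:R) j w + tau * eps i w)%R | i < n].

Lemma measurable_grid_observation J N f : measurable_fun setT (grid_observation J N f).
Proof.
apply: measurable_mktuple => i; apply: measurable_funD; last exact: measurable_funM.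
under eq_fun do rewrite big_mkcond/=.
apply: measurable_sum => j; case: (j < i.+1 * N)%N; last exact: measurable_cst.
by apply: measurable_funM => //; exact: measurable_increment.
Qed.

Lemma grid_observation_law J N f F : (0 < J)%N -> measurable F ->
  P [set w | F (grid_observation J N f w)] =
  observe_law N tau (fun j : 'I_J => f (j.+1%:R / J%:R) / J%:R)%R F.
Proof.
move=> J0 mF; have J0R : (0 < J%:R :> R)%R by rewrite ltr0n.
apply: (observe_increments bm eps_normal eps_indep W_eps N (J := J) tau
  (t := fun k => k%:R / J%:R)%R) => //.
- by move=> i j ij; rewrite ler_wpM2r ?invr_ge0 ?ler_nat// ltW.
- by move=> i _; rewrite ltr_pM2r ?invr_gt0// ltr_nat.
- by rewrite divff// gt_eqF.
Qed.

Section one_volatility.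
Variables (l lam : R) (f : R -> R) (Y : 'I_n -> {RV P >-> R}).
Hypothesis l0 : (0 < l)%R.
Hypothesis lam0 : (0 <= lam)%R.
Hypothesis lf : forall x, (l <= f x)%R.
Hypothesis flip : forall x y, (`|f x - f y| <= lam * `|x - y|)%R.

Let sg x := Num.sqrt (f x).

Let sg_lip x y : (`|sg x - sg y| <= lam / Num.sqrt l * `|x - y|)%R.
Proof.
apply: (le_trans (sqrt_dist_le l0 (lf x) (lf y))).
by rewrite mulrAC ler_wpM2r// invr_ge0 sqrtr_ge0.
Qed.

Let sg_sqr x : (sg x ^+ 2 = f x)%R.
Proof. by rewrite sqr_sqrtr// (le_trans (ltW l0)). Qed.

Let sg_ge x : (Num.sqrt l <= sg x)%R.
Proof. exact: ler_wsqrtr. Qed.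

(** For a fixed number of observations the error of the step integrals
    vanishes as the grid is refined. *)
Lemma integral_model_grid : integral_model W tau eps sg Y ->
  exists N0, forall N, (N0 < N)%N ->
    tv_close P (fun w => [tuple Y i w | i < n]) (grid_observation (n * N) N f) 8^-1.
Proof.
move=> YX.
pose X i := s2val (cid2 (YX i)).
have sgX i : is_wiener_integral W sg (grid_point i) (X i) := s2valP (cid2 (YX i)).
have YE i w : Y i w = (X i w + tau * eps i w)%R := s2valP' (cid2 (YX i)) w.
pose eta : R := (8^-1)%R.
have eta0 : (0 < eta)%R by rewrite invr_gt0.
have lam'0 : (0 <= lam / Num.sqrt l)%R by rewrite divr_ge0// sqrtr_ge0.
pose D := ((gauss_m2 R / eta + 1) / 2 *
  (n%:R * ((4 * gauss_m2 R * (lam / Num.sqrt l) ^+ 2) / tau ^+ 2)))%R.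
have D0 : (0 <= D)%R.
  have k0 := gauss_m2_ge0 R.
  rewrite mulr_ge0//; first by rewrite divr_ge0// addr_ge0// divr_ge0// ltW.
  by rewrite mulr_ge0// divr_ge0 ?sqr_ge0// mulr_ge0 ?sqr_ge0// mulr_ge0.
exists (Num.truncn (16 * D)) => N DN.
have N0 : (0 < N)%N by exact: leq_ltn_trans DN.
have N1 : (1 <= N%:R :> R)%R by rewrite ler1n.
have DNR : (16 * D <= N%:R)%R.
  have /andP[_ h] := truncn_itv (mulr_ge0 (ler0n _ 16) D0).
  by rewrite (le_trans (ltW h))// ler_nat.
have -> : (fun w => [tuple Y i w | i < n]) =
    (fun w => [tuple (X i w + tau * eps i w)%R | i < n]).
  by apply/funext => w; apply: eq_mktuple => i; rewrite YE.
have -> : grid_observation (n * N) N f = (fun w => [tuple (\sum_(j < n * N | (j < i.+1 * N)%N)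
       Num.sqrt (sg (j.+1%:R / (n * N)%:R) ^+ 2 / (n * N)%:R) *
       increment W (fun k => k%:R / (n * N)%:R) j w + tau * eps i w)%R | i < n]).
  apply/funext => w; apply: eq_mktuple => i; congr (_ + _)%R.
  by apply: eq_bigr => j _; rewrite sg_sqr.
have msg : measurable_fun setT sg := lipschitz_measurable sg_lip.
have sg0 x : (0 <= sg x)%R by exact: sqrtr_ge0.
have lip01 : {in `[0%R, 1%R] &, forall x y, `|sg x - sg y| <= lam / Num.sqrt l * `|x - y|}%R.
  by move=> x y _ _.
apply: tv_close_le (integral_model_tv bm eps_normal eps_indep W_eps tau0 lam'0 eta0 n0
  sg0 msg lip01 sgX N0).
have nR : (1 <= n%:R :> R)%R by rewrite ler1n.
have bound : ((gauss_m2 R / eta + 1) / 2 * (n%:R * (4 * gauss_m2 R *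
    (lam / Num.sqrt l / (n * N)%:R) ^+ 2 / tau ^+ 2)) <= D / N%:R)%R.
  have -> : ((gauss_m2 R / eta + 1) / 2 * (n%:R * (4 * gauss_m2 R *
    (lam / Num.sqrt l / (n * N)%:R) ^+ 2 / tau ^+ 2)) =
    D / N%:R * (n%:R ^+ 2 * N%:R)^-1)%R.
    have nR0 : (0 < n%:R :> R)%R by rewrite (lt_le_trans ltr01).
    have NR0 : (0 < N%:R :> R)%R by rewrite (lt_le_trans ltr01).
    have sl : (0 < Num.sqrt l)%R by rewrite sqrtr_gt0.
    by rewrite /D natrM; field; rewrite !gt_eqF.
  rewrite -[leRHS]mulr1 ler_wpM2l ?divr_ge0// invf_le1.
    by rewrite mulr_ege1// exprn_ege1.
  by rewrite mulr_gt0 ?exprn_gt0// (lt_le_trans ltr01).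
rewrite (_ : 8^-1 = eta / 2 + 16^-1)%R; last by rewrite /eta; field.
rewrite lerD2l (le_trans bound)// ler_pdivrMr ?(lt_le_trans ltr01)//.
by rewrite mulrC ler_pdivlMr// mulrC.
Qed.

(** The ratio of the volatilities at two neighbouring points of the grid
    differs from one by [O (lam / n)]. The variance of the walk is at most of
    order [n], before scaling, at each of the [n] times, so that the energy of the
    feedback is of order [lam ^ 2], uniformly in [n]. *)
Lemma product_model_grid :
  ((8 * gauss_m2 R + 1) / 2 * (lam ^+ 2 * gauss_m2 R / l ^+ 2) <= 16^-1)%R ->
  product_model W tau eps sg Y ->
  tv_close P (fun w => [tuple Y i w | i < n]) (grid_observation n 1 f) 8^-1.
Proof.
move=> small YE.
pose eta : R := (8^-1)%R.
have eta0 : (0 < eta)%R by rewrite invr_gt0.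
have -> : (fun w => [tuple Y i w | i < n]) = (fun w => [tuple (sg (grid_point i) *
    W (grid_point i) w + tau * eps i w)%R | i < n]).
  by apply/funext => w; apply: eq_mktuple => i; rewrite YE.
have -> : grid_observation n 1 f = (fun w => [tuple (\sum_(j < n | (j < i.+1 * 1)%N)
       Num.sqrt (sg (grid_point j) ^+ 2 / n%:R) *
         increment W (fun k => k%:R / n%:R) j w + tau * eps i w)%R | i < n]).
  apply/funext => w; apply: eq_mktuple => i; congr (_ + _)%R.
  by apply: eq_bigr => j _; rewrite sg_sqr.
have sl : (0 < Num.sqrt l)%R by rewrite sqrtr_gt0.
have sgp x : (0 < sg x)%R by rewrite (lt_le_trans sl).
have sg01 x : x \in `[0%R, 1%R] -> (0 < sg x)%R by [].
have nR : (0 < n%:R :> R)%R by rewrite ltr0n.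
apply: tv_close_le (product_model_tv bm eps_normal eps_indep W_eps n0 tau sg01 eta0).
rewrite (_ : 8^-1 = eta / 2 + 16^-1)%R; last by rewrite /eta; field.
rewrite lerD2l; apply: le_trans small.
rewrite (_ : gauss_m2 R / eta = 8 * gauss_m2 R)%R; last by rewrite /eta invrK mulrC.
have k0 := gauss_m2_ge0 R.
rewrite ler_wpM2l//; first by rewrite divr_ge0// addr_ge0// mulr_ge0.
have term (i : 'I_n) : ((sg (i%:R / n%:R) / sg (grid_point i) - 1) ^+ 2 *
    (i%:R * gauss_m2 R) <= lam ^+ 2 * gauss_m2 R / l ^+ 2 / n%:R)%R.
  have h : (`|sg (i%:R / n%:R) / sg (grid_point i) - 1| <= lam / l / n%:R)%R.
    have -> : (sg (i%:R / n%:R) / sg (grid_point i) - 1 =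
        (sg (i%:R / n%:R) - sg (grid_point i)) / sg (grid_point i))%R.
      by field; rewrite gt_eqF.
    rewrite normrM normfV (gtr0_norm (sgp _)) ler_pdivrMr//.
    apply: (le_trans (sg_lip _ _)).
    have -> : (`|i%:R / n%:R - grid_point i| = n%:R^-1 :> R)%R.
      rewrite /grid_point -mulrBl -natr1 opprD addrA subrr add0r mulN1r normrN.
      by rewrite ger0_norm// invr_ge0 ltW.
    rewrite [leRHS]mulrAC ler_wpM2r ?invr_ge0 ?(ltW nR)//.
    rewrite -[leRHS]mulrA ler_wpM2l//.
    have -> : ((Num.sqrt l)^-1 = l^-1 * Num.sqrt l)%R.
      by rewrite -{2}(sqr_sqrtr (ltW l0)); field; rewrite gt_eqF.
    by rewrite ler_wpM2l ?invr_ge0 ?(ltW l0).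
  have -> : (lam ^+ 2 * gauss_m2 R / l ^+ 2 / n%:R =
      (lam / l / n%:R) ^+ 2 * (n%:R * gauss_m2 R))%R.
    by field; rewrite !gt_eqF.
  rewrite ler_pM ?sqr_ge0 ?mulr_ge0//.
    rewrite -real_normK ?num_real// lerXn2r ?nnegrE//.
    by rewrite !divr_ge0// ltW.
  by rewrite ler_wpM2r// ler_nat ltnW.
apply: (le_trans (ler_sum _ (fun i _ => term i))).
by rewrite sumr_const card_ord -[leLHS]mulr_natr divfK// gt_eqF.
Qed.

End one_volatility.

(** The triangle inequality, with [1/8 + 1/4 + 1/8 = 1/2]. *)
Lemma grid_observation_tv J N f0 f1 (Y0 Y1 : 'I_n -> {RV P >-> R}) : (0 < J)%N ->
  tv_close P (fun w => [tuple Y0 i w | i < n]) (grid_observation J N f0) 8^-1 ->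
  tv_close P (fun w => [tuple Y1 i w | i < n]) (grid_observation J N f1) 8^-1 ->
  (forall F : set (n.-tuple R), measurable F ->
     observe_law N tau (fun j : 'I_J => f0 (j.+1%:R / J%:R) / J%:R)%R F <=
     observe_law N tau (fun j : 'I_J => f1 (j.+1%:R / J%:R) / J%:R)%R F + (4^-1)%:E) ->
  tv_close P (fun w => [tuple Y0 i w | i < n]) (fun w => [tuple Y1 i w | i < n]) 2^-1.
Proof.
move=> J0 h0 h1 h01.
rewrite (_ : 2^-1 = 8^-1 + (4^-1 + 8^-1))%R; last by field.
apply: (tv_close_trans h0).
apply: (tv_close_trans (Y := grid_observation J N f1)).
  by move=> F mF; rewrite /= !grid_observation_law//; exact: h01.
apply: (tv_close_sym _ _ h1); last exact: measurable_grid_observation.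
exact: measurable_mktuple.
Qed.

End models.

(** * Assouad's method in L2 *)

Section assouad.

Definition flip_coord M (k : 'I_M) (th : {ffun 'I_M -> bool}) : {ffun 'I_M -> bool} :=
  [ffun i => if i == k then ~~ th i else th i].

Lemma flip_coordK M (k : 'I_M) : involutive (flip_coord k).
Proof.
by move=> th; apply/ffunP => i; rewrite !ffunE; case: eqP => // _; rewrite negbK.
Qed.

(** Averaging over the cube, each coordinate contributes half of the smallest
   total error at the two ends of an edge in its direction. *)
Lemma assouad_average (R : realFieldType) M (a : {ffun 'I_M -> bool} -> 'I_M -> R) (c : R) :
  (forall (th : {ffun 'I_M -> bool}) k, ~~ th k -> c <= a th k + a (flip_coord k th) k) ->
  exists th, M%:R * (c / 2) <= \sum_(k < M) a th k.
Proof.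
move=> edge; apply/not_existsP => small.
pose C := {ffun 'I_M -> bool}.
have edge' (th : C) k : c <= a th k + a (flip_coord k th) k.
  have [thk|] := boolP (th k); last exact: edge.
  rewrite addrC -{2}(flip_coordK k th); apply: edge.
  by rewrite ffunE eqxx thk.
have lt : \sum_(th : C) \sum_(k < M) a th k < \sum_(th : C) M%:R * (c / 2).
  apply: ltr_sum => [|th _]; last by rewrite ltNge; apply/negP; exact: small.
  by apply/hasP; exists [ffun=> false] => //; rewrite mem_index_enum.
move: lt; apply/negP; rewrite -leNgt exchange_big/=.
have -> : \sum_(th : C) M%:R * (c / 2) = \sum_(k < M) #|C|%:R * (c / 2).
  by rewrite !sumr_const card_ord -[LHS]mulr_natl -[RHS]mulr_natl mulrCA.
apply: ler_sum => k _.
have h : \sum_(th : C) a th k = \sum_(th : C) a (flip_coord k th) k.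
  by rewrite (reindex_inj (can_inj (flip_coordK k))).
have : \sum_(th : C) c <= \sum_(th : C) a th k + \sum_(th : C) a th k.
  by rewrite {2}h -big_split/=; apply: ler_sum => th _; exact: edge'.
by rewrite sumr_const -[X in X <= _ -> _]mulr_natl; lra.
Qed.

End assouad.

Section L2_tests.
Local Open Scope ereal_scope.
Context {R : realType}.
Implicit Types f g : R -> R.

Lemma L2norm_sqr f :
  L2norm f ^+ 2 = \int[@lebesgue_measure R]_(x in `[0%R, 1%R]) (f x ^+ 2)%:E.
Proof.
have pow2 (y : \bar R) : 0 <= y -> y ^+ 2 = y `^ 2%R.
  case: y => [r r0|_|//].
    by rewrite poweR_EFin powR_mulrn// -EFin_expe.
  by rewrite poweRyr.
rewrite pow2 ?Lnorm_ge0// /L2norm poweR_Lnorm// [RHS]integral_mkcond.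
apply: eq_integral => x _.
rewrite /= /patch; case: ifP => _ /=; rewrite powR_mulrn// real_normK ?num_real//.
by rewrite expr0n.
Qed.

(** Estimators are only known to be measurable for open sets of L2; through
    these sets, the error of an estimator on [D] becomes an event. *)
Lemma L2_open_near f (D : set R) (rho : R) : measurable D -> D `<=` `[0%R, 1%R] ->
  measurable_fun D f -> (0 < rho)%R ->
  L2_open [set g | \int[lebesgue_measure]_(x in D) ((g x - f x) ^+ 2)%:E < rho%:E].
Proof.
move=> mD D01 mf rho0 g [mg _] /=; set a := (X in X < _ -> _) => gf.
have a0 : 0 <= a by apply: integral_ge0 => x _; rewrite lee_fin sqr_ge0.
have afin : a \is a fin_num by rewrite ge0_fin_numE// (lt_trans gf) ?ltry.
move: gf; rewrite -(fineK afin) lte_fin; set r := fine a => r_rho.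
have r0 : (0 <= r)%R by exact: fine_ge0.
pose delta := ((rho - r) / (2 * (r + 1)))%R.
have delta0 : (0 < delta)%R by rewrite divr_gt0 ?subr_gt0// mulr_gt0// ltr_wpDl.
pose k := (1 + delta^-1)%R.
have k0 : (0 < k)%R by rewrite addr_gt0// invr_gt0.
pose e2 := ((rho - r) / (4 * k))%R.
have e20 : (0 < e2)%R by rewrite divr_gt0 ?subr_gt0// mulr_gt0.
exists (Num.sqrt e2); first by rewrite sqrtr_gt0.
move=> h [mh _] hg /=.
have D_meas (q : R -> R) : measurable_fun (`[0%R, 1%R] : set R) q -> measurable_fun D q.
  by apply: measurable_funS.
have hg2 : \int[@lebesgue_measure R]_(x in D) ((h x - g x) ^+ 2)%:E <= e2%:E.
  apply: (@le_trans _ _ (L2norm (h \- g)%R ^+ 2)).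
    rewrite L2norm_sqr; apply: ge0_subset_integral => //.
    - by apply/measurable_EFinP/measurable_funX/measurable_funB.
    - by move=> x _; rewrite lee_fin sqr_ge0.
  have n0 : 0 <= L2norm (h \- g)%R by exact: Lnorm_ge0.
  have nfin : L2norm (h \- g)%R \is a fin_num by rewrite ge0_fin_numE// (lt_trans hg) ?ltry.
  move: n0 hg; rewrite -(fineK nfin) lte_fin lee_fin => n0 hg.
  rewrite -EFin_expe lee_fin -(sqr_sqrtr (ltW e20)).
  by rewrite lerXn2r ?nnegrE ?sqrtr_ge0// ltW.
have -> : (fun x => ((h x - f x) ^+ 2)%:E) =
    (fun x => (((g x - f x) + (h x - g x)) ^+ 2)%:E).
  by apply/funext => x; congr ((_ ^+ 2)%:E); ring.
have mgf : measurable_fun D (fun x => g x - f x)%R by apply: measurable_funB => //; exact: D_meas.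
have mhg : measurable_fun D (fun x => h x - g x)%R by apply: measurable_funB; exact: D_meas.
have := @integral_sqrD_weighted _ _ _ lebesgue_measure D _ _ mD mgf mhg delta a e2%:E
  delta0 (lexx a) hg2.
move=> /le_lt_trans; apply.
rewrite -(fineK afin) -/r -!EFinM -EFinD lte_fin -/k.
have -> : (k * e2 = (rho - r) / 4)%R by rewrite /e2; field; rewrite gt_eqF.
have : (delta * r <= (rho - r) / 2)%R.
  rewrite /delta mulrAC ler_pdivrMr ?mulr_gt0// ?ltr_wpDl//.
  rewrite -subr_ge0.
  have -> : ((rho - r) / 2 * (2 * (r + 1)) - (rho - r) * r = rho - r)%R by field.
  by rewrite subr_ge0 ltW.
have -> : ((1 + delta) * r = r + delta * r)%R by ring.
by move: (delta * r)%R => dr; lra.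
Qed.

(** The integral of a nonnegative function is a supremum over the simple
    functions below it, which is monotone with no measurability. *)
Lemma ge0_le_integral_nonmeasurable d (T : measurableType d)
    (mu : {measure set T -> \bar R}) (f g : T -> \bar R) :
  (forall x, 0 <= f x) -> (forall x, f x <= g x) ->
  \int[mu]_x f x <= \int[mu]_x g x.
Proof.
move=> f0 fg; rewrite !ge0_integralTE//; last by move=> x; exact: le_trans (fg x).
by apply: ereal_sup_le => _ [h hf <-]; exists h => // x; exact: le_trans (fg x).
Qed.

End L2_tests.

Section cells.
Local Open Scope ereal_scope.
Context {R : realType}.
Variables (alpha l A : R) (M : nat).
Hypotheses (A0 : (0 < A)%R) (M0 : (0 < M)%N).

Let M0R : (0 < M%:R :> R)%R. Proof. by rewrite ltr0n. Qed.

Local Notation vol th := (bump_volatility alpha l A (M := M) th).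

Definition cell_middle (k : 'I_M) : set R :=
  `[((k%:R + 4^-1) / M%:R)%R, ((k%:R + 3 / 4) / M%:R)%R]%classic.

Lemma cell_middleP k x : cell_middle k x -> (4^-1 <= M%:R * x - k%:R <= 3 / 4)%R.
Proof.
rewrite /cell_middle /= in_itv/= ler_pdivrMr// ler_pdivlMr// [(x * _)%R]mulrC.
by move=> /andP[? ?]; apply/andP; split; lra.
Qed.

Lemma measurable_cell_middle k : measurable (cell_middle k).
Proof. exact: measurable_itv. Qed.

Lemma cell_middle01 k : cell_middle k `<=` `[0%R, 1%R]%classic.
Proof.
move=> x /cell_middleP /andP[h1 h2] /=; rewrite in_itv/=.
have kM : (k%:R + 1 <= M%:R :> R)%R by rewrite natr1 ler_nat ltn_ord.
have k0 : (0 <= k%:R :> R)%R by [].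
apply/andP; split; first by rewrite -(pmulr_rge0 _ M0R); lra.
by rewrite -(ler_pM2l M0R) mulr1; lra.
Qed.

(** In the middle of a cell only the bump of this cell is active. *)
Lemma bump_volatility_local (th th' : 'I_M -> bool) k x : cell_middle k x ->
  th k = th' k -> vol th x = vol th' x.
Proof.
move=> /cell_middleP /andP[h1 h2] thk; congr (_ + _ * _)%R.
apply: eq_bigr => i _; have [->|ik] := eqVneq i k; first by rewrite thk.
rewrite bump_out ?mulr0//; apply: contraNN ik => /andP[i1 i2].
have : (i%:R < k%:R + 1 :> R)%R by lra.
have : (k%:R < i%:R + 1 :> R)%R by lra.
rewrite !natr1 !ltr_nat !ltnS => ki ik.
by apply/eqP/val_inj/eqP; rewrite eqn_leq ik ki.
Qed.

Lemma measurable_bump_volatility (th : 'I_M -> bool) : measurable_fun setT (vol th).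
Proof.
have [B B0 hB] := @bump_train_lipschitz R (Num.truncn alpha) 0 (leq0n _).
apply: (lipschitz_measurable (lam := (A * M%:R `^ (1 - alpha) * B)%R)) => x y.
exact: (bump_volatility_lipschitz l A0 M0 (hB M) (ltW B0)).
Qed.

(** Any vertex with the given value at [k] would do, by
    [bump_volatility_local]. *)
Definition cell_vertex (b : bool) (k : 'I_M) : 'I_M -> bool := fun i => (i == k) && b.

Let c0 : R := ((3 / 16) ^+ (Num.truncn alpha).+1)%R.

(** A quarter of a lower bound for the squared distance, in the middle of a cell,
    of the two volatilities that differ by the bump of the cell: the middle has
    length [1 / (2 M)], and there the bump is at least [c0] times its height. *)
Definition cell_radius : R :=
  ((A * M%:R `^ (- alpha) * c0) ^+ 2 / (2 * M%:R) / 4)%R.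

Lemma cell_radius_gt0 : (0 < cell_radius)%R.
Proof.
have c_gt0 : (0 < c0)%R by rewrite exprn_gt0.
have h_gt0 : (0 < A * M%:R `^ (- alpha))%R by rewrite mulr_gt0// powR_gt0.
have m_gt0 : (0 < 2 * M%:R :> R)%R by rewrite mulr_gt0.
by apply: divr_gt0 => //; apply: divr_gt0 => //; apply: exprn_gt0; exact: mulr_gt0.
Qed.

Definition cell_near (b : bool) (k : 'I_M) : set (R -> R) :=
  [set g | \int[lebesgue_measure]_(x in cell_middle k)
     ((g x - vol (cell_vertex b k) x) ^+ 2)%:E < cell_radius%:E].

Lemma L2_open_cell_near b k : L2_open (cell_near b k).
Proof.
apply: L2_open_near; [exact: measurable_cell_middle|exact: cell_middle01| |].
  by apply: (measurable_funS measurableT) => //; exact: measurable_bump_volatility.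
exact: cell_radius_gt0.
Qed.

Lemma cell_separation k :
  (4 * cell_radius)%:E <= \int[@lebesgue_measure R]_(x in cell_middle k)
    ((vol (cell_vertex true k) x - vol (cell_vertex false k) x) ^+ 2)%:E.
Proof.
pose c := (A * M%:R `^ (- alpha))%R.
have c_ge0 : (0 <= c)%R by rewrite mulr_ge0 ?powR_ge0// ltW.
have len : lebesgue_measure (cell_middle k) = ((2 * M%:R)^-1 : R)%:E.
  rewrite lebesgue_measure_itv/= lte_fin ltr_pM2r ?invr_gt0// ltrD2l.
  rewrite ifT; last by lra.
  by rewrite -EFinB; congr EFin; field; rewrite gt_eqF.
apply: (@le_trans _ _ (\int[@lebesgue_measure R]_(x in cell_middle k)
    ((c * c0) ^+ 2)%:E)).
  rewrite integral_cst; last exact: measurable_cell_middle.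
  rewrite [X in _ * X]len -EFinM lee_fin le_eqVlt; apply/orP; left; apply/eqP.
  by rewrite /cell_radius -/c; field; rewrite gt_eqF.
apply: ge0_le_integral => //.
- exact: measurable_cell_middle.
- by move=> x _; rewrite lee_fin sqr_ge0.
- apply/measurable_EFinP/measurable_funX/measurable_funB;
    by apply: (measurable_funS measurableT) => //; exact: measurable_bump_volatility.
- move=> x /cell_middleP kx; rewrite lee_fin.
  rewrite (@bump_volatility_flip _ alpha l A M _ _ k); last 3 first.
  + by move=> i ik; rewrite /cell_vertex (negbTE ik).
  + by rewrite /cell_vertex andbF.
  + by rewrite /cell_vertex eqxx.
  rewrite -/c lerXn2r ?nnegrE; last 3 first.
  + by rewrite mulr_ge0// exprn_ge0.
  + by rewrite mulr_ge0//; have /andP[] := bump0_ge0_le1 (Num.truncn alpha) (M%:R * x - k%:R).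
  + by rewrite ler_wpM2l// bump0_middle.
  by [].
Qed.

(** The squared distance of the two volatilities in the middle of the cell is
    at least four times [cell_radius]. *)
Lemma cell_near_disjoint g k : in_L2 g -> cell_near true k g -> cell_near false k g -> False.
Proof.
move=> [mg _] near1 near0.
have := cell_separation k; apply/negP; rewrite -ltNge.
have mv b : measurable_fun (cell_middle k) (vol (cell_vertex b k)).
  by apply: (measurable_funS measurableT) => //; exact: measurable_bump_volatility.
have mgk : measurable_fun (cell_middle k) g.
  by apply: measurable_funS mg => //; exact: cell_middle01.
have m1 : measurable_fun (cell_middle k) (fun x => vol (cell_vertex true k) x - g x)%R.
  exact: measurable_funB.
have m0 : measurable_fun (cell_middle k) (fun x => g x - vol (cell_vertex false k) x)%R.
  exact: measurable_funB.
have -> : (fun x => ((vol (cell_vertex true k) x - vol (cell_vertex false k) x) ^+ 2)%:E) =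
   (fun x => (((vol (cell_vertex true k) x - g x) + (g x - vol (cell_vertex false k) x)) ^+ 2)%:E).
  by apply/funext => x; congr ((_ ^+ 2)%:E); ring.
have near1' : \int[@lebesgue_measure R]_(x in cell_middle k)
    ((vol (cell_vertex true k) x - g x) ^+ 2)%:E < cell_radius%:E.
  by under eq_integral do rewrite -sqrrN opprB; exact: near1.
have := @integral_sqrD _ _ _ lebesgue_measure _ _ _ (measurable_cell_middle k) m1 m0 _ _
  (lexx _) (lexx _).
move=> /le_lt_trans; apply.
have -> : (4 * cell_radius)%:E = 2%:E * cell_radius%:E + 2%:E * cell_radius%:E.
  by rewrite -!EFinM -EFinD; congr EFin; ring.
by apply: lteD; rewrite lte_pmul2l.
Qed.

(** The middles of the cells are disjoint, so that the errors add up. *)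
Lemma cell_errors_le g (th : 'I_M -> bool) : in_L2 g ->
  \sum_(k < M) (cell_radius * (`[< ~ cell_near (th k) k g >] : nat)%:R)%:E <=
  L2norm (g \- vol th)%R ^+ 2.
Proof.
move=> [mg _]; rewrite L2norm_sqr.
pose h x := (((g x - vol th x)%R ^+ 2)%:E : \bar R).
have h0 x : 0 <= h x by rewrite lee_fin sqr_ge0.
have mh : measurable_fun (`[0%R, 1%R] : set R) h.
  apply/measurable_EFinP/measurable_funX/measurable_funB => //.
  by apply: (measurable_funS measurableT) => //; exact: measurable_bump_volatility.
apply: (@le_trans _ _ (\sum_(k < M) \int[@lebesgue_measure R]_(x in `[0%R, 1%R])
    (h \_ (cell_middle k)) x)).
  apply: lee_sum => k _.
  rewrite -integral_mkcondr setIidr; last exact: cell_middle01.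
  case: asboolP => [far|_]; last first.
    by rewrite mulr0; apply: integral_ge0.
  rewrite mulr1; move/negP: far; rewrite -leNgt => /le_trans; apply.
  rewrite le_eqVlt; apply/orP; left; apply/eqP.
  apply: eq_integral => x; rewrite inE => kx; rewrite /h.
  by rewrite (@bump_volatility_local (cell_vertex (th k) k) th k x kx)// /cell_vertex eqxx.
have mhk k : measurable_fun (`[0%R, 1%R] : set R) (h \_ (cell_middle k)).
  apply/measurable_restrict => //; first exact: measurable_cell_middle.
  by apply: measurable_funS mh => // x [].
apply: (@le_trans _ _ (\int[@lebesgue_measure R]_(x in `[0%R, 1%R])
    \sum_(k < M) (h \_ (cell_middle k)) x)).
  rewrite le_eqVlt; apply/orP; left; apply/eqP/esym; apply: ge0_integral_sum => //.
  by move=> k x _; rewrite /patch; case: ifP.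
apply: ge0_le_integral => //.
- by move=> x _; apply: sume_ge0 => k _; rewrite /patch; case: ifP.
- exact: emeasurable_sum.
- move=> x _.
  have [/existsP/= [k kx]|/existsPn/= no] := boolP [exists k : 'I_M, `[< cell_middle k x >]].
    have {}kx : cell_middle k x by apply/asboolP.
    rewrite (bigD1 k)//= big1 ?adde0 => [|i ik].
      by rewrite /patch mem_set.
    rewrite /patch memNset// => ix; move/eqP: ik; apply.
    have /andP[a1 a2] := cell_middleP kx; have /andP[b1 b2] := cell_middleP ix.
    have : (i%:R < k%:R + 1 :> R)%R by lra.
    have : (k%:R < i%:R + 1 :> R)%R by lra.
    rewrite !natr1 !ltr_nat !ltnS => ki ik.
    by apply/val_inj/eqP; rewrite eqn_leq ik ki.
  rewrite big1 ?h0// => k _; rewrite /patch memNset// => kx.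
  by have := no k; rewrite (asboolT kx).
Qed.

End cells.

Section hypercube_risk.
Local Open Scope ereal_scope.
Context {R : realType} d (T : measurableType d) (P : probability T R).
Variables (alpha l A : R) (M n : nat).
Hypotheses (A0 : (0 < A)%R) (M0 : (0 < M)%N).
Variable Y : {ffun 'I_M -> bool} -> 'I_n -> {RV P >-> R}.
Hypothesis Y_flip : forall (th : {ffun 'I_M -> bool}) k, ~~ th k ->
  tv_close P (fun w => [tuple Y th i w | i < n])
    (fun w => [tuple Y (flip_coord k th) i w | i < n]) 2^-1.
Variable est : n.-tuple R -> R -> R.
Hypothesis estimator_est : estimator n est.

Local Notation vol th := (bump_volatility alpha l A (M := M) th).
Local Notation rho := (cell_radius alpha A M).

Let mY th : measurable_fun setT (fun w => [tuple Y th i w | i < n]).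
Proof. exact: measurable_mktuple. Qed.

Let near_event (th : {ffun 'I_M -> bool}) b (k : 'I_M) := [set w | cell_near alpha l A b k (est [tuple Y th i w | i < n])].

Let measurable_near b (k : 'I_M) : measurable [set y | cell_near alpha l A b k (est y)].
Proof. by apply: estimator_est.2; exact: L2_open_cell_near. Qed.

Let measurable_near_event th b k : measurable (near_event th b k).
Proof. exact: (measurable_preimage (mY th) (measurable_near b k)). Qed.

Let err (th : {ffun 'I_M -> bool}) k : R := fine (P (~` near_event th (th k) k)).

Let errE th k : P (~` near_event th (th k) k) = (err th k)%:E.
Proof. by rewrite fineK// fin_num_measure//; exact: measurableC. Qed.

Let err_edge (th : {ffun 'I_M -> bool}) k : ~~ th k ->
  (2^-1 <= err th k + err (flip_coord k th) k)%R.
Proof.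
move=> thk; have far := negbTE thk.
rewrite -lee_fin EFinD -!errE /flip_coord ffunE eqxx -/(flip_coord k th) far/=.
rewrite probability_setC//.
have sub : P (near_event (flip_coord k th) false k) <=
    P (~` near_event (flip_coord k th) true k).
  apply: le_measure; rewrite ?inE//; first exact: measurableC.
  move=> w near0 near1; exact: (@cell_near_disjoint R alpha l A M A0 M0 _ k (estimator_est.1 _) near1 near0).
have close := Y_flip thk (measurable_near false k).
have {close} close : P (near_event th false k) <=
    P (~` near_event (flip_coord k th) true k) + (2^-1)%:E.
  by apply: (le_trans close); apply: leeD.
move: close.
rewrite -(fineK (fin_num_measure P _ (measurable_near_event th false k))).
rewrite -(fineK (fin_num_measure P _ (measurableC (measurable_near_event (flip_coord k th) true k)))).
rewrite -EFinD -EFinB -EFinD !lee_fin; lra.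
Qed.

(** On a cell the two ends of an edge cannot both be estimated well: an estimate
    is near at most one of them, and the laws of the observations at the two ends
    are too close for it to be near the right one at both. *)
Lemma hypercube_risk (K : R) : (0 <= K)%R -> exists th : {ffun 'I_M -> bool},
  (K * rho * (M%:R / 4))%:E <=
  \int[P]_w (K%:E * L2norm (est [tuple Y th i w | i < n] \- vol th)%R ^+ 2).
Proof.
move=> K0; have [th hth] := assouad_average err_edge.
exists th.
have rho0 := ltW (cell_radius_gt0 alpha A0 M0).
have Krho0 : (0 <= K * rho)%R by rewrite mulr_ge0.
apply: (@le_trans _ _ (\int[P]_w \sum_(k < M)
   ((K * rho)%:E * (\1_(~` near_event th (th k) k) w)%:E))).
  rewrite ge0_integral_sum//; last 2 first.
  - move=> k; apply: measurable_funeM; apply/measurable_EFinP.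
    by apply: measurable_indic; exact: measurableC.
  - by move=> k w _; rewrite -EFinM lee_fin mulr_ge0.
  rewrite (eq_bigr (fun k => (K * rho * err th k)%:E)) => [|k _].
    rewrite sumEFin lee_fin -mulr_sumr ler_wpM2l//.
    by rewrite (_ : (M%:R / 4 = M%:R * (2^-1 / 2))%R)//; field.
  have mfar := measurableC (measurable_near_event th (th k) k).
  have mI : measurable_fun setT (fun w => (\1_(~` near_event th (th k) k) w : R)%:E).
    by apply/measurable_EFinP; exact: measurable_indic.
  have I0 w : setT w -> 0 <= (\1_(~` near_event th (th k) k) w : R)%:E by [].
  rewrite (ge0_integralZl _ measurableT mI I0) ?lee_fin//.
  rewrite (integral_indic _ measurableT mfar) setIT.
  by rewrite [RHS]EFinM -errE.
apply: ge0_le_integral_nonmeasurable => [w|w].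
  by apply: sume_ge0 => k _; rewrite -EFinM lee_fin mulr_ge0.
have := @cell_errors_le R alpha l A M A0 M0 _ th (estimator_est.1 [tuple Y th i w | i < n]).
move=> /(lee_wpmul2l (x := K%:E)); rewrite lee_fin => /(_ K0).
apply: le_trans; rewrite ge0_sume_distrr; last first.
  by move=> k _; rewrite lee_fin mulr_ge0.
apply: lee_sum => k _; rewrite -!EFinM lee_fin indicE [leRHS]mulrA.
by apply: ler_wpM2l => //; rewrite ler_nat.
Qed.

End hypercube_risk.

(** * The rate of convergence *)

Section rate.
Context {R : realType}.
Variables (alpha : R) (n : nat).
Hypotheses (alpha0 : 0 < alpha) (n0 : (0 < n)%N).

Let x : R := n%:R `^ (4 * alpha + 2)^-1.

Definition cell_number := (Num.truncn x).+1.

Let a0 : 0 < 4 * alpha + 2. Proof. by rewrite addr_gt0// mulr_gt0. Qed.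

Let n1 : 1 <= n%:R :> R. Proof. by rewrite ler1n. Qed.

Let x1 : 1 <= x.
Proof. by rewrite -[leLHS](powRr0 n%:R) ler_powR// invr_ge0 ltW. Qed.

Let x_M : x <= cell_number%:R <= 2 * x.
Proof.
have /andP[h1 h2] := truncn_itv (le_trans ler01 x1).
by rewrite (ltW h2)/= /cell_number -natr1; have := x1; lra.
Qed.

Let x_pow b : x `^ b = n%:R `^ (b / (4 * alpha + 2)).
Proof. by rewrite /x -powRrM mulrC. Qed.

(** This is the condition under which an edge of the cube is hard to
    detect; it holds because [(2 alpha + 1) / (4 alpha + 2) = 1 / 2]. *)
Lemma sqrt_le_cell_number : Num.sqrt n%:R <= cell_number%:R `^ (2 * alpha + 1).
Proof.
have -> : Num.sqrt n%:R = x `^ (2 * alpha + 1).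
  rewrite x_pow -powR12_sqrt//; congr (_ `^ _).
  have h : 4 * alpha + 2 != 0 by rewrite gt_eqF.
  have -> : 4 * alpha + 2 = 2 * (2 * alpha + 1) by ring.
  field; move: h; have -> : 4 * alpha + 2 = 2 * (2 * alpha + 1) by ring.
  by rewrite mulf_eq0 negb_or => /andP[].
have /andP[xM _] := x_M.
rewrite ge0_ler_powR ?nnegrE//; last by rewrite (le_trans ler01).
by rewrite addr_ge0// mulr_ge0// ltW.
Qed.

Lemma cell_number_le : (cell_number <= 2 * n)%N.
Proof.
have /andP[_ Mx] := x_M.
rewrite -(ler_nat R) natrM (le_trans Mx)// ler_wpM2l//.
rewrite -[leRHS](powRr1 (ler0n R n)) ler_powR//.
have := alpha0; rewrite invf_le1//; lra.
Qed.

(** The number of cells is as large as the rate of convergence permits. *)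
Lemma cell_number_rate :
  2 `^ (- (2 * alpha)) <=
  n%:R `^ (alpha / (2 * alpha + 1)) * (cell_number%:R `^ (- alpha)) ^+ 2.
Proof.
have /andP[xM Mx] := x_M.
have M0 : 0 < cell_number%:R :> R by rewrite ltr0n.
have x0 : 0 < x by rewrite (lt_le_trans ltr01).
have -> : n%:R `^ (alpha / (2 * alpha + 1)) = x `^ (2 * alpha).
  rewrite x_pow; congr (_ `^ _).
  by field; rewrite !gt_eqF//; have := alpha0; lra.
rewrite -powR_mulrn ?powR_ge0// -powRrM (_ : - alpha * 2%:R = - (2 * alpha)); last by ring.
rewrite !powRN ler_pdivlMr ?powR_gt0// mulrC ler_pdivrMr ?powR_gt0//.
rewrite -powRM ?(ltW x0)//.
rewrite ge0_ler_powR ?nnegrE ?mulr_ge0 ?(ltW x0) ?(ltW alpha0)//.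
by rewrite mulrC.
Qed.

End rate.

Lemma small_square (R : realFieldType) (c A : R) :
  0 <= c -> 0 <= A -> A <= (16 * (c + 1))^-1 -> c * A ^+ 2 <= 16^-1.
Proof.
move=> c0 A0 Ac; have c1 : 0 < c + 1 by rewrite ltr_wpDl.
have A1 : A <= 1.
  by rewrite (le_trans Ac)// invf_le1 ?mulr_gt0//; lra.
apply: (@le_trans _ _ (c * A)); first by rewrite ler_wpM2l// expr2 ler_piMr.
apply: (@le_trans _ _ ((c + 1) * A)); first by rewrite ler_wpM2r// lerDl.
by rewrite mulrC -ler_pdivlMr// -invfM.
Qed.

Lemma limn_einf_ge (R : realType) (u : nat -> \bar R) (c : \bar R) :
  (forall n, (0 < n)%N -> (c <= u n)%E) -> (c <= limn_einf u)%E.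
Proof.
move=> cu; rewrite limn_einf_lim; apply: lime_ge; first exact: is_cvg_einfs.
near=> n; apply: le_ereal_inf_tmp => _ [k /= nk <-]; apply: cu.
by apply: leq_trans nk; near: n; exact: nbhs_infty_gt.
Unshelve. all: by end_near.
Qed.

Section lower_bound.
Local Open Scope ereal_scope.
Context (R : realType) d (T : measurableType d) (P : probability T R).
Variables (W : R -> {RV P >-> R}) (n M : nat) (eps : 'I_n -> {RV P >-> R}).
Hypothesis bm : brownian_motion01 W.
Hypothesis eps_normal : forall i, is_normal P (eps i) 0 1.
Hypothesis eps_indep : mutually_independent P (fun i => eps i).
Hypothesis W_eps : independent_systems P (sigma_generated `[0%R, 1%R] (fun t => W t))
  (sigma_generated setT (fun i => eps i)).
Variables (alpha tau l A B : R).
Hypotheses (tau0 : (0 < tau)%R) (l0 : (0 < l)%R) (A0 : (0 < A)%R).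
Hypotheses (n0 : (0 < n)%N) (M0 : (0 < M)%N).
Hypotheses (nM : (Num.sqrt n%:R <= M%:R `^ (2 * alpha + 1))%R) (Mn : (M <= 2 * n)%N).
Hypothesis A_small : (6 * A ^+ 2 * (l^-1 + 2 / tau ^+ 2) ^+ 2 <= 16^-1)%R.
Hypothesis B0 : (0 <= B)%R.
Hypothesis train_lip : forall (th : 'I_M -> bool) x y,
  (`|bump_train (Num.truncn alpha) th 0 y - bump_train (Num.truncn alpha) th 0 x| <=
    B * Num.min 1 (M%:R * `|y - x|))%R.
Variable Y : {ffun 'I_M -> bool} -> 'I_n -> {RV P >-> R}.

Local Notation vol th := (bump_volatility alpha l A (M := M) th).
Local Notation sg th := (fun t => Num.sqrt (vol th t)).

Let flip_eq (th : {ffun 'I_M -> bool}) (k i : 'I_M) : i != k ->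
  th i = flip_coord k th i.
Proof. by rewrite ffunE => /negbTE ->. Qed.

Let lam := (A * M%:R `^ (1 - alpha) * B)%R.

Let lam0 : (0 <= lam)%R.
Proof. by rewrite mulr_ge0// mulr_ge0 ?powR_ge0// ltW. Qed.

Let vol_ge (th : {ffun 'I_M -> bool}) x : (l <= vol th x)%R.
Proof. exact: bump_volatility_ge. Qed.

Let vol_lip (th : {ffun 'I_M -> bool}) x y : (`|vol th x - vol th y| <= lam * `|x - y|)%R.
Proof. exact: (bump_volatility_lipschitz l A0 M0 train_lip B0). Qed.

Let flip_tv J N (th : {ffun 'I_M -> bool}) k : (0 < N)%N -> J = (n * N)%N -> ~~ th k ->
  tv_close P (fun w => [tuple Y th i w | i < n])
    (grid_observation W eps tau J N (vol th)) 8^-1 ->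
  tv_close P (fun w => [tuple Y (flip_coord k th) i w | i < n])
    (grid_observation W eps tau J N (vol (flip_coord k th))) 8^-1 ->
  tv_close P (fun w => [tuple Y th i w | i < n])
    (fun w => [tuple Y (flip_coord k th) i w | i < n]) 2^-1.
Proof.
move=> N0 JE thk h0 h1.
have thk' : flip_coord k th k by rewrite ffunE eqxx.
have J0 : (0 < J)%N by rewrite JE muln_gt0 n0.
apply: (grid_observation_tv bm eps_normal eps_indep W_eps J0 h0 h1) => F mF.
exact: (observe_law_flip A0 l0 tau0 M0 n0 N0 JE (flip_eq th (k := k)) thk thk' nM Mn A_small mF).1.
Qed.

Lemma integral_model_flip : (forall th : {ffun 'I_M -> bool}, integral_model W tau eps (sg th) (Y th)) ->
  forall (th : {ffun 'I_M -> bool}) k, ~~ th k ->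
  tv_close P (fun w => [tuple Y th i w | i < n])
    (fun w => [tuple Y (flip_coord k th) i w | i < n]) 2^-1.
Proof.
move=> model th k thk.
have grid (th' : {ffun 'I_M -> bool}) := integral_model_grid bm eps_normal eps_indep
  W_eps tau0 n0 l0 lam0 (vol_ge th') (@vol_lip th') (model th').
have [N1 h1] := grid th; have [N2 h2] := grid (flip_coord k th).
have N10 : (N1 < (maxn N1 N2).+1)%N by rewrite ltnS leq_maxl.
have N20 : (N2 < (maxn N1 N2).+1)%N by rewrite ltnS leq_maxr.
exact: (flip_tv (ltn0Sn _) erefl thk (h1 _ N10) (h2 _ N20)).
Qed.

Lemma product_model_flip : (1 <= alpha)%R ->
  ((8 * gauss_m2 R + 1) / 2 * ((A * B) ^+ 2 * gauss_m2 R / l ^+ 2) <= 16^-1)%R ->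
  (forall th : {ffun 'I_M -> bool}, product_model W tau eps (sg th) (Y th)) ->
  forall (th : {ffun 'I_M -> bool}) k, ~~ th k ->
  tv_close P (fun w => [tuple Y th i w | i < n])
    (fun w => [tuple Y (flip_coord k th) i w | i < n]) 2^-1.
Proof.
move=> alpha1 small model th k thk.
have k0 := gauss_m2_ge0 R.
have lam_le : (lam <= A * B)%R.
  rewrite /lam mulrAC -[leRHS]mulr1 ler_wpM2l ?mulr_ge0 ?(ltW A0)//.
  by rewrite -[leRHS](powRr0 M%:R) ler_powR ?ler1n// subr_le0.
have lam_small : ((8 * gauss_m2 R + 1) / 2 * (lam ^+ 2 * gauss_m2 R / l ^+ 2) <= 16^-1)%R.
  apply: le_trans small; apply: ler_wpM2l.
    by rewrite divr_ge0// addr_ge0// mulr_ge0.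
  rewrite ler_wpM2r ?invr_ge0 ?sqr_ge0// ler_wpM2r//.
  by rewrite lerXn2r ?nnegrE// (le_trans lam0).
have grid (th' : {ffun 'I_M -> bool}) := product_model_grid bm eps_normal eps_indep
  W_eps n0 l0 lam0 (vol_ge th') (@vol_lip th') lam_small (model th').
exact: (flip_tv (N := 1) (J := n) (ltn0Sn 0) (esym (muln1 n)) thk (grid _) (grid _)).
Qed.

End lower_bound.

Theorem theorem2p1 (R : realType) (alpha tau L l u : R)
    (tau_gt0 : 0 < tau) (L_gt0 : 0 < L) (l_gt0 : 0 < l) (l_lt_u : l < u) :
  exists2 C : R, 0 < C &
  forall (d : measure_display) (T : measurableType d) (P : probability T R)
    (W : R -> {RV P >-> R}) (eps : forall n : nat, 'I_n -> {RV P >-> R})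
    (Y : (R -> R) -> forall n : nat, 'I_n -> {RV P >-> R}),
  brownian_motion01 W ->
  (forall n i, is_normal P (eps n i) 0 1) ->
  (forall n, mutually_independent P (fun i => eps n i)) ->
  (forall n, independent_systems P (sigma_generated `[0, 1] (fun t => W t))
                                   (sigma_generated setT (fun i => eps n i))) ->
  (1 / 2 < alpha /\
   (forall f n, holder_class alpha L l u f -> (0 < n)%N ->
      integral_model W tau (eps n) (fun t => Num.sqrt (f t)) (Y f n)))
  \/
  (1 <= alpha /\
   (forall f n, holder_class alpha L l u f -> (0 < n)%N ->
      product_model W tau (eps n) (fun t => Num.sqrt (f t)) (Y f n))) ->
  (C%:E <= limn_einf (fun n : nat =>
     ereal_inf [set ereal_sup [set scaled_risk alpha (Y f n) est f
                              | f in holder_class alpha L l u]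
               | est in estimator n]))%E.
Proof.
have [alpha_le0|alpha0] := leP alpha 0.
  by exists 1 => // d T P W eps Y _ _ _ _ [[? _]|[? _]]; exfalso; lra.
pose p := Num.truncn alpha.
have [Bp Bp0 hBp] := @bump_train_lipschitz R p p (leqnn p).
have [B B0 hB] := @bump_train_lipschitz R p 0 (leq0n p).
have k0 := gauss_m2_ge0 R.
pose c1 : R := 6 * (l^-1 + 2 / tau ^+ 2) ^+ 2.
pose c2 : R := (8 * gauss_m2 R + 1) / 2 * (B ^+ 2 * gauss_m2 R / l ^+ 2).
have c10 : 0 <= c1 by rewrite mulr_ge0// sqr_ge0.
have c20 : 0 <= c2.
  rewrite mulr_ge0//; first by rewrite divr_ge0// addr_ge0// mulr_ge0.
  by rewrite divr_ge0 ?sqr_ge0// mulr_ge0 ?sqr_ge0.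
(* the amplitude: small enough for the Hoelder class, for the bound [u], for an
   edge of the cube to be hard to detect, and for the product model *)
pose A := Num.min (Num.min (L / Bp) (u - l))
  (Num.min (16 * (c1 + 1))^-1 (16 * (c2 + 1))^-1).
have A0 : 0 < A.
  rewrite !lt_min divr_gt0// subr_gt0 l_lt_u !invr_gt0 !mulr_gt0// ltr_wpDl//.
have A_L : A * Bp <= L by rewrite -ler_pdivlMr// !ge_min lexx.
have A_u : A <= u - l by rewrite !ge_min lexx !orbT.
have A_1 : c1 * A ^+ 2 <= 16^-1.
  by apply: small_square; rewrite ?(ltW A0)// !ge_min lexx !orbT.
have A_2 : c2 * A ^+ 2 <= 16^-1.
  by apply: small_square; rewrite ?(ltW A0)// !ge_min lexx !orbT.
pose c0 : R := (3 / 16) ^+ p.+1.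
exists (2 `^ (- (2 * alpha)) * ((A * c0) ^+ 2 / 32)).
  by rewrite mulr_gt0 ?powR_gt0// divr_gt0// exprn_gt0// mulr_gt0// exprn_gt0.
move=> d T P W eps Y bm eps_normal eps_indep W_eps setting.
apply: limn_einf_ge => n n0; apply: le_ereal_inf_tmp => _ [est est_n <-].
pose M := cell_number alpha n.
have M0 : (0 < M)%N by [].
have nM := sqrt_le_cell_number alpha0 n0.
have Mn := cell_number_le alpha0 n0.
pose vol (th : {ffun 'I_M -> bool}) := bump_volatility alpha l A th.
have vol_holder th : holder_class alpha L l u (vol th).
  exact: (bump_volatility_holder alpha0 A0 M0 (hBp M) (ltW Bp0) A_L A_u).
have A_small : 6 * A ^+ 2 * (l^-1 + 2 / tau ^+ 2) ^+ 2 <= 16^-1.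
  by rewrite mulrAC.
have flip (th : {ffun 'I_M -> bool}) k : ~~ th k ->
    tv_close P (fun w => [tuple Y (vol th) n i w | i < n])
      (fun w => [tuple Y (vol (flip_coord k th)) n i w | i < n]) 2^-1.
  move: th k; case: setting => -[alpha1 model].
    apply: (integral_model_flip bm (eps_normal n) (eps_indep n) (W_eps n) tau_gt0
      l_gt0 A0 n0 M0 nM Mn A_small (ltW B0) (hB M)) => th.
    exact: (model _ _ (vol_holder th) n0).
  apply: (product_model_flip bm (eps_normal n) (eps_indep n) (W_eps n) tau_gt0
    l_gt0 A0 n0 M0 nM Mn A_small (ltW B0) (hB M)) => //.
    apply: le_trans A_2; rewrite le_eqVlt; apply/orP; left; apply/eqP.
    by rewrite /c2; ring.
  by move=> th; exact: (model _ _ (vol_holder th) n0).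
pose K := n%:R `^ (alpha / (2 * alpha + 1)).
have [th hth] 
  := @hypercube_risk R d T P alpha l A M n A0 M0
       (fun th => Y (vol th) n) flip est est_n K (powR_ge0 _ _).
apply: (@le_trans _ _ (scaled_risk alpha (Y (vol th) n) est (vol th))); last first.
  by apply: ereal_sup_ubound; exists (vol th).
apply: le_trans hth.
have -> : K * cell_radius alpha A M * (M%:R / 4) =
    K * (M%:R `^ (- alpha)) ^+ 2 * ((A * c0) ^+ 2 / 32).
  by rewrite /cell_radius -/p -/c0; field; rewrite gt_eqF// ltr0n.
rewrite lee_fin ler_wpM2r ?divr_ge0 ?sqr_ge0//.
exact: cell_number_rate.
Qed.
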